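(* Let $\lambda>0$ and $c>0$, and let $(X(t),Y(t))_{t\ge 0}$ be the planar random flight with speed $c$ and Poisson rate $\lambda$ started at $(0,0)$. For each $n\ge 1$ suppose it is observed at the times $t_i=i\Delta_n$, $i=0,1,\dots,n$. Put $(X_i,Y_i)=(X(t_i),Y(t_i))$, and for $i=1,\dots,n$ $$u_{n,i}=c^2\Delta_n^2-(X_i-X_{i-1})^2-(Y_i-Y_{i-1})^2 ,$$ let $n^+$ be the number of indices $i\in\{1,\dots,n\}$ with $u_{n,i}>0$, and define the pseudo-maximum likelihood estimator $$\hat\lambda_n=\frac{c\,n^+}{c\,n\Delta_n-\sum_{i:\,u_{n,i}>0}\sqrt{u_{n,i}}}.$$ If $\Delta_n\to 0$ and $n\Delta_n=T\to\infty$ as $n\to\infty$, then $\hat\lambda_n$ is a consistent, asymptotically normal and asymptotically efficient estimator of $\lambda$; that is, $\hat\lambda_n\to\lambda$ in probability and $\sqrt{n\Delta_n}\,(\hat\lambda_n-\lambda)$ converges in distribution to $N(0,\lambda)$.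
   Context: Planar random flight: let $N$ be a homogeneous Poisson process of rate $\lambda>0$ with event times $s_1<s_2<\cdots$, and let $\theta_1,\theta_2,\dots$ be i.i.d. uniform on $(0,2\pi]$, independent of $N$. With $s_0=0$ and, for given $t$, $s_{N(t)+1}$ replaced by $t$, the flight with speed $c>0$ started at $(x_0,y_0)$ is $X(t)=x_0+c\sum_{j=1}^{N(t)+1}(s_j-s_{j-1})\cos\theta_j$, $Y(t)=y_0+c\sum_{j=1}^{N(t)+1}(s_j-s_{j-1})\sin\theta_j$. Thus the particle moves at constant speed $c$ and picks a new independent uniform direction at every Poisson event. The speed $c$ is known and $\lambda$ is the unknown parameter. Almost surely $u_{n,i}>0$ if and only if at least one change of direction occurs in the $i$-th observation interval. Asymptotic efficiency is understood relative to continuous observation of the flight on $[0,T]$, where the optimal estimator is $N(T)/T$: an estimator $\lambda_n^*$ is asymptotically efficient if $\sqrt{n\Delta_n}(\lambda_n^*-\lambda)$ has the same limit law as $\sqrt{T}(N(T)/T-\lambda)$, namely $N(0,\lambda)$. *)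

(* Defs.v *)
From HB Require Import structures.
From mathcomp Require Import all_boot all_order all_algebra.
From mathcomp Require Import all_classical all_reals all_analysis.

Set Implicit Arguments.
Unset Strict Implicit.
Unset Printing Implicit Defensive.

Import Order.TTheory GRing.Theory Num.Theory.
Import numFieldNormedType.Exports.

Local Open Scope classical_set_scope.
Local Open Scope ring_scope.

(* Mutual independence: the product rule over every finite subfamily. *)
Definition mutually_independent d d' (T : measurableType d)
    (T' : measurableType d') (R : realType) (P : probability T R)
    (I : eqType) (X : I -> T -> T') : Prop :=
  forall (J : seq I) (A : I -> set T'), uniq J -> (forall i, measurable (A i)) ->
    P (\big[setI/setT]_(i <- J) (X i @^-1` A i)) =
      (\prod_(i <- J) P (X i @^-1` A i))%E.

Definition sigma_generated d d' (T : measurableType d) (T' : measurableType d')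
    (I : Type) (D : set I) (X : I -> T -> T') : set (set T) :=
  <<s \bigcup_(i in D) preimage_set_system setT (X i) measurable >>.

Definition independent_systems d (T : measurableType d) (R : realType)
    (P : probability T R) (G H : set (set T)) : Prop :=
  forall A B, G A -> H B -> P (A `&` B) = (P A * P B)%E.

(* [N t] is the number of events in ]0, t]; [s 0, s 1, s 2, ...] are the origin
   0 followed by the successive event times. Only times [t >= 0] matter. *)
Record poisson_process d (T : measurableType d) (R : realType)
    (P : probability T R) (lambda : R) (N : R -> {RV P >-> nat})
    (s : nat -> T -> R) : Prop := PoissonProcess {
  event_time0 : forall w, s 0%N w = 0 ;
  event_time_lt : forall k w, s k w < s k.+1 w ;
  counting : forall t k w, 0 <= t -> N t w = k <-> s k w <= t < s k.+1 w ;
  independent_increments : forall tau : nat -> R,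
    0 <= tau 0%N -> (forall k, tau k <= tau k.+1) ->
    mutually_independent P (fun k w => (N (tau k.+1) w - N (tau k) w)%N) ;
  poisson_increments : forall a b k, 0 <= a -> a < b ->
    P [set w | (N b w - N a w)%N = k] = (poisson_pmf (lambda * (b - a)) k)%:E
}.

Lemma two_pi_gt0 (R : realType) : 0 < 2 * pi :> R.
Proof. by rewrite mulr_gt0 ?pi_gt0. Qed.

(* The library's [uniform_prob] charges [`[0, 2 * pi]]; as a measure it is the
   uniform law on [`]0, 2 * pi]]. *)
Definition iid_uniform_directions d (T : measurableType d) (R : realType)
    (P : probability T R) (theta : nat -> {RV P >-> R}) : Prop :=
  mutually_independent P (fun j => theta j : T -> R) /\
  forall j (A : set R), measurable A ->
    distribution P (theta j) A = uniform_prob (two_pi_gt0 R) A.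

(* Legs are numbered from 0: leg [j] runs from time [s j] to time [s j.+1], cut
   off at [t] for the last leg [j = N t], and has direction [theta j]; so
   [theta j] is the usual theta_{j+1}. *)
Definition leg_duration (T : Type) (R : realType) (N : R -> T -> nat)
    (s : nat -> T -> R) (t : R) (j : nat) (w : T) : R :=
  (if (j < N t w)%N then s j.+1 w else t) - s j w.

Definition flight_x (T : Type) (R : realType) (x0 c : R) (N : R -> T -> nat)
    (s theta : nat -> T -> R) (t : R) (w : T) : R :=
  x0 + c * \sum_(j < (N t w).+1) leg_duration N s t j w * cos (theta j w).

Definition flight_y (T : Type) (R : realType) (y0 c : R) (N : R -> T -> nat)
    (s theta : nat -> T -> R) (t : R) (w : T) : R :=
  y0 + c * \sum_(j < (N t w).+1) leg_duration N s t j w * sin (theta j w).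

Definition defect (T : Type) (R : realType) (c delta : R) (X Y : R -> T -> R)
    (i : nat) (w : T) : R :=
  c ^+ 2 * delta ^+ 2
  - (X (i%:R * delta) w - X (i.-1%:R * delta) w) ^+ 2
  - (Y (i%:R * delta) w - Y (i.-1%:R * delta) w) ^+ 2.

Definition n_plus (T : Type) (R : realType) (c delta : R) (X Y : R -> T -> R)
    (n : nat) (w : T) : nat :=
  (\sum_(1 <= i < n.+1 | (0 < defect c delta X Y i w)%R) 1)%N.

Definition pseudo_mle (T : Type) (R : realType) (c delta : R)
    (X Y : R -> T -> R) (n : nat) (w : T) : R :=
  c * (n_plus c delta X Y n w)%:R /
  (c * n%:R * delta
   - \sum_(1 <= i < n.+1 | 0 < defect c delta X Y i w)
       Num.sqrt (defect c delta X Y i w)).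

(* Measurability is part of both modes of convergence, since a measure has no
   prescribed value on non-measurable sets. *)
Definition cvg_in_probability d (T : measurableType d) (R : realType)
    (P : probability T R) (X : nat -> T -> R) (l : R) : Prop :=
  (forall n, measurable_fun setT (X n)) /\
  forall eps : R, 0 < eps ->
    P [set w | eps < `|X n w - l|] @[n --> \oo] --> 0%E.

Definition cvg_in_distribution d (T : measurableType d) (R : realType)
    (P : probability T R) (X : nat -> T -> R) (mu : probability (measurableTypeR R) R) : Prop :=
  (forall n, measurable_fun setT (X n)) /\
  forall f : R -> R, continuous f -> (exists M, forall x, `|f x| <= M) ->
    (\int[P]_w (f (X n w))%:E)%E @[n --> \oo] --> (\int[mu]_x (f x)%:E)%E.

Definition consistent d (T : measurableType d) (R : realType)
    (P : probability T R) (lambda : R) (est : nat -> T -> R) : Prop :=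
  cvg_in_probability P est lambda.

(* [horizon n] is the length of the observation window of the n-th sample. *)
Definition normalized_error (T : Type) (R : realType) (lambda : R)
    (horizon : nat -> R) (est : nat -> T -> R) (n : nat) (w : T) : R :=
  Num.sqrt (horizon n) * (est n w - lambda).

Definition asymptotically_normal d (T : measurableType d) (R : realType)
    (P : probability T R) (lambda : R) (horizon : nat -> R)
    (est : nat -> T -> R) (variance : R) : Prop :=
  cvg_in_distribution P (normalized_error lambda horizon est)
    (normal_prob 0 (Num.sqrt variance)).

(* Efficiency is relative to continuous observation of the flight on
   [0, horizon n], for which the optimal estimator is N(T) / T. *)
Definition asymptotically_efficient d (T : measurableType d) (R : realType)
    (P : probability T R) (lambda : R) (N : R -> T -> nat)
    (horizon : nat -> R) (est : nat -> T -> R) : Prop :=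
  exists mu : probability (measurableTypeR R) R,
    cvg_in_distribution P (normalized_error lambda horizon est) mu /\
    cvg_in_distribution P
      (normalized_error lambda horizon
         (fun n w => (N (horizon n) w)%:R / horizon n)) mu.

(* Main.v *)
Require Import Defs.
From HB Require Import structures.
From mathcomp Require Import all_boot all_order all_algebra.
From mathcomp Require Import all_classical all_reals all_analysis.
From mathcomp Require Import measurable_realfun.
From mathcomp Require Import ring lra zify.

(** Take unit speed and steps of length [D = Delta n], put [T = n * D], and write [K_i]
for the number of events in the [i]-th step, [r_i] for the length of the
displacement over it and [C_i = sqrt (D ^ 2 - r_i ^ 2)]. Since a step without
event is straight, and a step with events is almost surely not
([full_step_no_event]), [n_plus] counts the steps with [K_i > 0] and the estimator is
[n_plus / (T - \sum C_i)]. As [n_plus = N T - \sum (K_i - 1)_+], its error satisfies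
[lambda_hat - lambda =
(N T - lambda * T - \sum (K_i - 1)_+ + lambda * \sum C_i) / (T - \sum C_i)].

The mean of [(K_i - 1)_+] is [lambda * D - (1 - exp (- lambda * D))], and the point
of the proof is that this is exactly [lambda] times the mean of [C_i]
([expect_step_norm]). So both sums may be centered without any bias term
([pseudo_mle_error]). The [K_i] are independent, and the [C_i] are uncorrelated
([expect_step_norm_pair]), with second moments of order [D ^ 2]; hence the centered
sums are of order [D * sqrt n = sqrt (D * T)], negligible against [sqrt T]
([hidden_events_variance], [step_norm_variance]). The ratio [\sum C_i / T] has mean
at most [lambda * D] and is negligible too ([lost_time_mean]). What remains is
[(N T - lambda * T) / sqrt T], the normalized error of the estimator based on continuous
observation, which gives efficiency; [perturbation_expect] and [perturbation_tail]
turn these bounds into the two convergences.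

The central limit theorem for the Poisson variable [N T] is proved by Stein's method.
For bounded continuous [f] the equation [lambda * G' x - x * G x = f x - m], [m] the normal
mean of [f], has a bounded solution with bounded continuous derivative
([stein_equation]), while a Poisson variable satisfies the same equation with the
derivative replaced by a difference quotient of step [1 / sqrt T]
([poisson_identity], [poisson_central_limit]).

The law of [r_i] is reached through moments, with no integration over the event
times. Sampled on a mesh of step [h], the heading is a chain that keeps its value with
probability [exp (- lambda * h)] and is otherwise drawn afresh
([expect_next_heading]). Let [Z] be the displacement since the start of a step and [V]
the heading. The moments of [r ^ (2 i) * (Z . V) ^ j] along the mesh then obey a linear
recursion ([weighted_moment_step]), an Euler scheme for a system of differential
equations with an explicit solution ([expands_cross_moment]); stability of the scheme
([scheme_stable]) identifies the limit ([weighted_moment_cvg]). A weight depending on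
the past passes through the argument unchanged, which decorrelates different
steps. The moments are those of [D ^ 2 - R ^ 2] with [R = max 0 (D - E)] and [E]
exponential, so polynomial approximation of the square root gives the mean of [C_i],
and high powers of [r_i ^ 2 / D ^ 2] give the probability that [r_i = D]. *)

Set Implicit Arguments.
Unset Strict Implicit.
Unset Printing Implicit Defensive.

Import Order.TTheory GRing.Theory Num.Theory.
Import numFieldNormedType.Exports.

Local Open Scope classical_set_scope.
Local Open Scope ring_scope.

(** * Expectations of bounded functions *)

(** Every function whose mean is taken along the discretised flight is of this kind,
    and all closure properties hold without integrability side conditions. *)
Definition bounded_measurable {d} {T : measurableType d} {R : realType}
    (f : T -> R) : Prop :=
  measurable_fun setT f /\ exists M : R, forall x, `|f x| <= M.

Section bounded_measurable_closure.
Context {d} {T : measurableType d} {R : realType}.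
Implicit Types f g : T -> R.

Lemma bounded_measurable_cst (c : R) : bounded_measurable (fun _ : T => c).
Proof. by split; [exact: measurable_cst|exists `|c|]. Qed.

Lemma bounded_measurableD f g : bounded_measurable f -> bounded_measurable g ->
  bounded_measurable (fun x => f x + g x).
Proof.
move=> [mf [A fA]] [mg [B gB]]; split; first exact: measurable_funD.
by exists (A + B) => x; rewrite (le_trans (ler_normD _ _))// lerD.
Qed.

Lemma bounded_measurableM f g : bounded_measurable f -> bounded_measurable g ->
  bounded_measurable (fun x => f x * g x).
Proof.
move=> [mf [A fA]] [mg [B gB]]; split; first exact: measurable_funM.
by exists (A * B) => x; rewrite normrM ler_pM.
Qed.

Lemma bounded_measurableZ (c : R) f : bounded_measurable f ->
  bounded_measurable (fun x => c * f x).
Proof. exact/bounded_measurableM/bounded_measurable_cst. Qed.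

Lemma bounded_measurableB f g : bounded_measurable f -> bounded_measurable g ->
  bounded_measurable (fun x => f x - g x).
Proof.
move=> bf bg; under eq_fun do rewrite -[in X in _ + X]mulN1r.
exact/bounded_measurableD/bounded_measurableZ.
Qed.

Lemma bounded_measurableX n f : bounded_measurable f ->
  bounded_measurable (fun x => f x ^+ n).
Proof.
move=> bf; elim: n => [|n ih]; first exact: bounded_measurable_cst.
under eq_fun do rewrite exprS.
exact: bounded_measurableM.
Qed.

Lemma bounded_measurable_sum (I : Type) (r : seq I) (Q : pred I)
    (F : I -> T -> R) : (forall i, bounded_measurable (F i)) ->
  bounded_measurable (fun x => \sum_(i <- r | Q i) F i x).
Proof.
move=> bF; elim: r => [|i r ih].
  under eq_fun do rewrite big_nil.
  exact: bounded_measurable_cst.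
case: (boolP (Q i)) => Qi.
  under eq_fun => x do rewrite big_cons Qi.
  exact: bounded_measurableD.
by under eq_fun => x do rewrite big_cons (negbTE Qi).
Qed.

Lemma bounded_measurable_prod (I : Type) (r : seq I) (F : I -> T -> R) :
  (forall i, bounded_measurable (F i)) ->
  bounded_measurable (fun x => \prod_(i <- r) F i x).
Proof.
move=> bF; elim: r => [|i r ih].
  under eq_fun do rewrite big_nil.
  exact: bounded_measurable_cst.
by under eq_fun do rewrite big_cons; exact: bounded_measurableM.
Qed.

Lemma bounded_measurable_indic (A : set T) :
  measurable A -> bounded_measurable (\1_A : T -> R).
Proof.
move=> mA; split; first exact: measurable_indic.
by exists 1 => x; rewrite indicE ger0_norm ?ler0n// lern1 leq_b1.
Qed.

(** Every set of natural numbers is measurable, so [G] is arbitrary. *)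
Lemma measurable_fun_nat {d'} {T' : measurableType d'} (K : T -> nat)
    (G : nat -> T') : measurable_fun setT K -> measurable_fun setT (fun x => G (K x)).
Proof. by move=> mK; apply: measurableT_comp. Qed.

Lemma bounded_measurable_bool (b : nat -> bool) (K : T -> nat) :
  measurable_fun setT K -> bounded_measurable (fun x => (b (K x))%:R : R).
Proof.
move=> mK; split; first exact: (@measurable_fun_nat _ _ K (fun n => (b n)%:R : R) mK).
by exists 1 => x; rewrite ger0_norm ?ler0n// lern1 leq_b1.
Qed.

(** Headings are directions with a random index, [theta (N t w) w]; they are
    measurable by cutting along the countably many values of the index. *)
Lemma measurable_fun_select {d'} {T' : measurableType d'} (K : T -> nat)
    (G : nat -> T -> T') :
  measurable_fun setT K -> (forall k, measurable_fun setT (G k)) ->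
  measurable_fun setT (fun x => G (K x) x).
Proof.
move=> mK mG _ B mB; rewrite setTI.
rewrite (_ : _ @^-1` B = \bigcup_k (K @^-1` [set k] `&` G k @^-1` B)).
  apply: bigcup_measurable => k _; apply: measurableI.
    by rewrite -[_ @^-1` _]setTI; exact: mK.
  by rewrite -[_ @^-1` _]setTI; exact: mG.
apply/seteqP; split => [x Bx|x [k _ [<-]]//].
by exists (K x).
Qed.

End bounded_measurable_closure.

Lemma bounded_measurable_comp {d d'} {T : measurableType d}
    {T' : measurableType d'} {R : realType} (g : T' -> R) (f : T -> T') :
  bounded_measurable g -> measurable_fun setT f ->
  bounded_measurable (g \o f).
Proof.
move=> [mg [M gM]] mf; split; first exact: measurableT_comp.
by exists M => x; exact: gM.
Qed.

Section expectation_of_bounded_functions.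
Context {d} {T : measurableType d} {R : realType} (P : probability T R).
Implicit Types f g : T -> R.

Lemma bounded_measurable_integrable f : bounded_measurable f ->
  P.-integrable setT (EFin \o f).
Proof.
move=> [mf [M fM]].
apply: (le_integrable measurableT _ _
    (finite_measure_integrable_cst P M measurableT)).
- exact/measurable_EFinP.
- by move=> x _ /=; rewrite lee_fin (le_trans (fM x))// ler_norm.
Qed.
Hint Resolve bounded_measurable_integrable : core.

Lemma expectD f g : bounded_measurable f -> bounded_measurable g ->
  \int[P]_x (f x + g x) = \int[P]_x f x + \int[P]_x g x.
Proof. by move=> bf bg; apply: RintegralD => //; auto. Qed.

Lemma expectB f g : bounded_measurable f -> bounded_measurable g ->
  \int[P]_x (f x - g x) = \int[P]_x f x - \int[P]_x g x.
Proof. by move=> bf bg; apply: RintegralB => //; auto. Qed.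

Lemma expectZ c f : bounded_measurable f ->
  \int[P]_x (c * f x) = c * \int[P]_x f x.
Proof. by move=> bf; apply: RintegralZl => //; auto. Qed.

Lemma expect_cst (c : R) : \int[P]_x c = c.
Proof.
by rewrite Rintegral_cst// (_ : fine _ = 1) ?mulr1//= (@probability_setT _ _ _ P).
Qed.

Lemma expect_sum (I : Type) (r : seq I) (Q : pred I) (F : I -> T -> R) :
  (forall i, bounded_measurable (F i)) ->
  \int[P]_x (\sum_(i <- r | Q i) F i x) = \sum_(i <- r | Q i) \int[P]_x F i x.
Proof.
move=> bF; elim: r => [|i r ih].
  by under eq_Rintegral do rewrite big_nil; rewrite expect_cst big_nil.
rewrite big_cons; under eq_Rintegral do rewrite big_cons.
case: ifP => _ //; rewrite expectD// ?ih//.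
exact: bounded_measurable_sum.
Qed.

Lemma eq_expect f g : f =1 g -> \int[P]_x f x = \int[P]_x g x.
Proof. by move=> fg; apply: eq_Rintegral => x _. Qed.

Lemma le_expect f g : bounded_measurable f -> bounded_measurable g ->
  (forall x, f x <= g x) -> \int[P]_x f x <= \int[P]_x g x.
Proof. by move=> bf bg fg; apply: le_Rintegral => //; auto. Qed.

Lemma expect_norm_le f (M : R) : measurable_fun setT f ->
  (forall x, `|f x| <= M) -> `|\int[P]_x f x| <= M.
Proof.
move=> mf fM; have bf : bounded_measurable f by split => //; exists M.
rewrite (le_trans (le_normr_Rintegral _ _))//; auto.
rewrite -[leRHS]expect_cst; apply: le_expect => //; first last.
- exact: bounded_measurable_cst.
- split; first exact: measurableT_comp.
  by exists M => x; rewrite normr_id.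
Qed.

Lemma expect_indic (A : set T) : measurable A -> \int[P]_x \1_A x = fine (P A).
Proof. by move=> mA; rewrite /Rintegral integral_indic// setIT. Qed.

(** Bounded convergence; the first two conclusions transfer measurability and
    the bound from the discretised flight to the flight itself. *)
Lemma expect_cvg (f_ : nat -> T -> R) f (M : R) :
  (forall n, measurable_fun setT (f_ n)) ->
  (forall n x, `|f_ n x| <= M) -> (forall x, f_ n x @[n --> \oo] --> f x) ->
  measurable_fun setT f /\ (forall x, `|f x| <= M) /\
  \int[P]_x f_ n x @[n --> \oo] --> \int[P]_x f x.
Proof.
move=> mf fM ff.
have mf' : measurable_fun setT f.
  by apply: (@measurable_fun_cvg _ _ _ setT f_) => // x _; exact: ff.
have fM' x : `|f x| <= M.
  have nff : `|f_ n x| @[n --> \oo] --> `|f x| by apply: cvg_norm; exact: ff.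
  rewrite -(cvg_lim _ nff)//; apply: limr_le; first exact: cvgP nff.
  by apply: nearW => n; exact: fM.
split=> //; split=> //.
have bf : bounded_measurable f by split=> //; exists M.
have mf_E n : measurable_fun setT (EFin \o f_ n) by exact/measurable_EFinP.
have mfE : measurable_fun setT (EFin \o f) by exact/measurable_EFinP.
have ae_cvg : {ae P, forall x, setT x ->
    ((EFin \o f_ n) x)%E @[n --> \oo] --> ((EFin \o f) x)%E}.
  apply: aeW => x _; apply: cvg_EFin; last exact: ff.
  exact: nearW.
have ae_dom : {ae P, forall x n, setT x ->
    (`|(EFin \o f_ n) x| <= (EFin \o cst M) x)%E}.
  by apply: aeW => x n _ /=; rewrite lee_fin.
have [_ _ H] := dominated_convergence measurableT mf_E mfE ae_cvg
  (finite_measure_integrable_cst P M measurableT) ae_dom.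
apply: fine_cvg; rewrite fineK; first exact: H.
by apply: integrable_fin_num => //; exact: bounded_measurable_integrable.
Qed.

End expectation_of_bounded_functions.

(** Counting the thresholds [1, 2, ...] below [y] gives its integer part: this is
    the layer decomposition behind [expect_mul_of_indic]. *)
Lemma sum_thresholds {R : realType} (y : R) K : 0 <= y ->
  (K%:R <= y -> \sum_(k < K) (k.+1%:R <= y)%R%:R = K%:R :> R) /\
  (y <= K%:R -> y - 1 <= \sum_(k < K) (k.+1%:R <= y)%R%:R <= y).
Proof.
move=> y0; elim: K => [|K [ih1 ih2]].
  by rewrite big_ord0; split=> // yle; apply/andP; split=> //; lra.
rewrite big_ord_recr/=; split=> [yK|yK].
  rewrite yK/= ih1 ?natr1//.
  by rewrite (le_trans _ yK)// ler_nat.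
have [Ky|yltK] := leP K%:R y.
  rewrite ih1//; have [K1y|_] := boolP (K.+1%:R <= y).
    by have -> : y = K.+1%:R by [lra]; rewrite natr1 lexx -natr1; lra.
  by rewrite addr0 Ky andbT lerBlDr natr1.
rewrite (_ : (K.+1%:R <= y) = false) ?addr0; last first.
  by apply/negbTE; rewrite -ltNge (lt_trans yltK)// ltr_nat.
by apply: ih2; exact: ltW.
Qed.

Section independence.
Context {d} {T : measurableType d} {R : realType} (P : probability T R).

(** Bounded functions are uniform limits of combinations of indicators of
    their upper level sets, so a product rule known on indicators extends. *)
Lemma expect_mul_of_indic {d'} {T' : measurableType d'} (F : T -> R)
    (X : T -> T') (c : R) (phi : T' -> R) :
  bounded_measurable F -> measurable_fun setT X ->
  (forall B, measurable B ->
    \int[P]_w (F w * \1_B (X w)) = c * \int[P]_w \1_B (X w)) ->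
  bounded_measurable phi ->
  \int[P]_w (F w * phi (X w)) = c * \int[P]_w phi (X w).
Proof.
move=> bF mX H bphi; have [mphi [M phiM]] := bphi.
have [_ [CF FC]] := bF.
have bcomp (g : T' -> R) : bounded_measurable g -> bounded_measurable (fun w => g (X w)).
  by move=> bg; exact: (bounded_measurable_comp bg mX).
pose B n k := [set x | (k.+1%:R <= (phi x + M) * n.+1%:R)%R].
have mB n k : measurable (B n k).
  have mb : measurable_fun setT
      (fun x => (k.+1%:R <= (phi x + M) * n.+1%:R)%R).
    apply: measurable_fun_ler => //.
    by apply: measurable_funM => //; exact: measurable_funD.
  by rewrite /B -[X in measurable X]setTI; exact: (mb measurableT [set true]).
pose q K n x := n.+1%:R^-1 * (\sum_(k < K) \1_(B n k) x) - M.
have bq K n : bounded_measurable (q K n).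
  apply: bounded_measurableB; last exact: bounded_measurable_cst.
  apply: bounded_measurableZ; apply: bounded_measurable_sum => k.
  exact: bounded_measurable_indic.
have Hq K n : \int[P]_w (F w * q K n (X w)) = c * \int[P]_w q K n (X w).
  rewrite /q expectB; last 2 first.
  - apply: bounded_measurableZ; apply: bounded_measurable_sum => k.
    exact/bcomp/bounded_measurable_indic.
  - exact: bounded_measurable_cst.
  rewrite (@expectZ _ _ _ P); last first.
    apply: bounded_measurable_sum => k.
    exact/bcomp/bounded_measurable_indic.
  rewrite expect_sum; last by move=> k; exact/bcomp/bounded_measurable_indic.
  under eq_expect do rewrite mulrBr mulrCA mulr_sumr.
  rewrite expectB; last 2 first.
  - apply: bounded_measurableZ; apply: bounded_measurable_sum => k.
    apply: bounded_measurableM => //.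
    exact/bcomp/bounded_measurable_indic.
  - by apply: bounded_measurableM => //; exact: bounded_measurable_cst.
  rewrite expectZ; last first.
    apply: bounded_measurable_sum => k; apply: bounded_measurableM => //.
    exact/bcomp/bounded_measurable_indic.
  rewrite expect_sum; last first.
    move=> k; apply: bounded_measurableM => //.
    exact/bcomp/bounded_measurable_indic.
  rewrite mulrBr mulrCA; congr (_ * _ - _).
    by rewrite mulr_sumr; apply: eq_bigr => k _; exact: H.
  have EF : \int[P]_w F w = c.
    rewrite -[RHS]mulr1 -(expect_cst P 1).
    have := H setT measurableT; rewrite indicT => <-.
    by apply: eq_expect => w; rewrite mulr1.
  under eq_expect do rewrite mulrC.
  by rewrite expectZ// EF expect_cst mulrC.
have close n : exists K, forall x, `|phi x - q K n x| <= n.+1%:R^-1.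
  have [K KM] : exists K : nat, ((M + M) * n.+1%:R < K%:R)%R.
    by exists (Num.trunc ((M + M) * n.+1%:R)).+1; exact: truncnS_gt.
  exists K => x; have /ler_normlP[h1 h2] := phiM x.
  have y0 : 0 <= (phi x + M) * n.+1%:R by rewrite mulr_ge0//; lra.
  have [_] := sum_thresholds K y0.
  have -> : (phi x + M) * n.+1%:R <= K%:R.
    by rewrite (le_trans _ (ltW KM))// ler_wpM2r//; lra.
  move=> /(_ isT); rewrite /q.
  have -> : \sum_(k < K) \1_(B n k) x =
      \sum_(k < K) (k.+1%:R <= (phi x + M) * n.+1%:R)%R%:R :> R.
    apply: eq_bigr => k _; rewrite indicE; congr (_%:R).
    by congr nat_of_bool; apply/idP/idP => [/set_mem|/mem_set].
  set S := \sum_(k < K) _; move=> /andP[S1 S2].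
  have n0 : (0 : R) < n.+1%:R by rewrite ltr0n.
  have -> : phi x - (n.+1%:R^-1 * S - M) =
    n.+1%:R^-1 * ((phi x + M) * n.+1%:R - S) by field; rewrite lt0r_neq0.
  rewrite normrM gtr0_norm ?invr_gt0//.
  apply: ler_piMr; first by rewrite invr_ge0 ltW.
  by rewrite ler_norml; apply/andP; split; lra.
have main n : `|\int[P]_w (F w * phi (X w)) - c * \int[P]_w phi (X w)| <=
    (CF + `|c|) * n.+1%:R^-1.
  have [K HK] := close n.
  have bphiX := bcomp _ bphi; have bqX := bcomp _ (bq K n).
  have -> : \int[P]_w (F w * phi (X w)) - c * \int[P]_w phi (X w) =
    \int[P]_w (F w * (phi (X w) - q K n (X w))) -
    c * \int[P]_w (phi (X w) - q K n (X w)).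
    rewrite [in X in _ = _ - c * X]expectB//.
    rewrite (@eq_expect _ _ _ P (fun w => F w * (phi (X w) - q K n (X w)))
      (fun w => F w * phi (X w) - F w * q K n (X w))); last first.
      by move=> w; rewrite mulrBr.
    by rewrite expectB; [rewrite Hq; ring|exact: bounded_measurableM..].
  rewrite (le_trans (ler_normB _ _))// mulrDl lerD//.
    apply: expect_norm_le => [|w].
      exact: (bounded_measurableM bF (bounded_measurableB bphiX bqX)).1.
    by rewrite normrM ler_pM.
  rewrite normrM ler_wpM2l//; apply: expect_norm_le => [|w]; last exact: HK.
  exact: (bounded_measurableB bphiX bqX).1.
apply/eqP; rewrite -subr_eq0 -normr_le0.
have lim0 : (CF + `|c|) * n.+1%:R^-1 @[n --> \oo] --> ((CF + `|c|) * 0 : R).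
  by apply: cvgMr; exact: cvg_harmonic.
rewrite mulr0 in lim0.
rewrite -(cvg_lim _ lim0)//; apply: limr_ge; first exact: cvgP lim0.
by apply: nearW => n; exact: main.
Qed.

End independence.

(** * The Poisson process and the directions *)

(** The real line carries two copies of its Borel structure, that differ by
    their display; this map goes from one to the other. *)
Definition borel_id {R : realType} : measurableTypeR R -> R := idfun.

HB.instance Definition _ {R : realType} :=
  @isMeasurableFun.Build _ _ _ _ (@borel_id R) (@measurable_id _ _ setT).

Section random_flight_model.
Context {d} {T : measurableType d} {R : realType} (P : probability T R).
Variables (lambda : R) (N : R -> {RV P >-> nat}) (s : nat -> T -> R).
Variable theta : nat -> {RV P >-> R}.
Hypothesis poissonN : poisson_process lambda N s.
Hypothesis directions : iid_uniform_directions theta.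

Local Notation sigmaN :=
  (sigma_generated [set t : R | 0 <= t] (fun t => N t : T -> nat)).
Hypothesis indep : independent_systems P sigmaN
  (sigma_generated [set: nat] (fun j => theta j : T -> R)).

Definition direction_mean (phi : R -> R) : R :=
  \int[uniform_prob (two_pi_gt0 R)]_x phi x.

Lemma expect_direction j (phi : R -> R) : bounded_measurable phi ->
  \int[P]_w phi (theta j w) = direction_mean phi.
Proof.
move=> bphi; rewrite /direction_mean /Rintegral.
have mphi : measurable_fun setT (EFin \o phi).
  by apply/measurable_EFinP; exact: bphi.1.
rewrite -(@integral_distribution _ _ _ _ _ P (theta j) (EFin \o phi))//; last first.
  apply: (@bounded_measurable_integrable _ _ _ P (phi \o theta j)).
  exact: bounded_measurable_comp.
congr fine.
rewrite (eq_measure_integral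
  (pushforward (uniform_prob (two_pi_gt0 R)) borel_id)); last first.
  by move=> A mA _; exact: directions.2.
rewrite integral_pushforward//.
apply: (@bounded_measurable_integrable _ _ _ (uniform_prob (two_pi_gt0 R))).
exact: (@bounded_measurable_comp _ _ _ _ _ _ borel_id).
Qed.

Lemma sigmaN_measurable A : sigmaN A -> measurable A.
Proof.
apply: (@smallest_sub _ _ _ (@measurable _ T) (sigma_algebra_measurable T)).
by move=> B [t _ [C mC <-]]; rewrite setTI; exact: measurable_funPTI.
Qed.

Lemma sigmaN_event t k : 0 <= t -> sigmaN [set w | N t w = k].
Proof.
move=> t0; apply: sub_sigma_algebra; exists t => //.
by exists [set k] => //; rewrite setTI.
Qed.

Lemma event_countP t k w : 0 <= t -> N t w = k <-> s k w <= t < s k.+1 w.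
Proof. exact: (Defs.counting poissonN). Qed.

Lemma event_count_mono a b w : 0 <= a -> a <= b -> (N a w <= N b w)%N.
Proof.
move=> a0 ab; have b0 := le_trans a0 ab.
have [+ _] := event_countP (N a w) w a0 => /(_ erefl)/andP[h1 _].
have [+ _] := event_countP (N b w) w b0 => /(_ erefl)/andP[_ h2].
have smono : {homo (fun k => s k w) : i j / (i <= j)%N >-> i <= j}.
  by apply/nondecreasing_seqP => k; exact/ltW/(event_time_lt poissonN).
rewrite leqNgt; apply/negP => /smono/=; rewrite leNgt => /negP; apply.
by rewrite (le_lt_trans _ h2)// (le_trans h1).
Qed.

Lemma event_count0 w : N 0 w = 0%N.
Proof.
apply/event_countP => //; rewrite (event_time0 poissonN) lexx/=.
by rewrite -(event_time0 poissonN w) (event_time_lt poissonN).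
Qed.

Definition increment (h : R) (i : nat) (w : T) : nat :=
  (N (i.+1%:R * h) w - N (i%:R * h) w)%N.

Section grid.
Variable h : R.
Hypothesis h_gt0 : 0 < h.

Lemma grid_ge0 i : 0 <= i%:R * h.
Proof. by rewrite mulr_ge0// ltW. Qed.

Lemma grid_le i j : (i <= j)%N -> i%:R * h <= j%:R * h.
Proof. by move=> ij; rewrite ler_pM2r// ler_nat. Qed.

(** The truncated difference in [increment] loses nothing, counts being
    monotone. *)
Lemma increment_addE i w :
  (N (i%:R * h) w + increment h i w)%N = N (i.+1%:R * h) w.
Proof. by rewrite subnKC// event_count_mono// ?grid_ge0// grid_le. Qed.

Lemma measurable_increment i : measurable_fun setT (increment h i).
Proof. exact: measurable_fun_subn. Qed.

(** The independence hypothesis only speaks of events of the form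
    [sigmaN], so each event about increments has to be placed there. *)
Lemma sigmaN_increment i k : sigmaN [set w | increment h i w = k].
Proof.
rewrite /sigma_generated; set G := \bigcup_(t in _) _.
rewrite (_ : [set w | _] = \bigcup_m
  ([set w | N (i%:R * h) w = m] `&` [set w | N (i.+1%:R * h) w = m + k]%N)).
  apply: (@bigcup_measurable _ (g_sigma_algebraType G)) => m _.
  by apply: measurableI; apply: sigmaN_event; exact: grid_ge0.
apply/seteqP; split => w /=.
  by move=> <-; exists (N (i%:R * h) w) => //; rewrite /= increment_addE.
by move=> [m _ [/= <-]]; rewrite -increment_addE => /addnI.
Qed.

Lemma increment_prob i k :
  P [set w | increment h i w = k] = (poisson_pmf (lambda * h) k)%:E.
Proof.
rewrite (poisson_increments poissonN) ?grid_ge0 ?ltr_pM2r ?ltr_nat//.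
by congr (poisson_pmf (lambda * _) k)%:E; rewrite -natr1; ring.
Qed.

Local Notation pmf k := (poisson_pmf (lambda * h) k).

Definition increments_are r (delta : nat -> nat) : set T :=
  \big[setI/setT]_(i <- iota 0 r) (increment h i @^-1` [set delta i]).

Lemma sigmaN_increments_are r delta : sigmaN (increments_are r delta).
Proof.
rewrite /sigma_generated; set G := \bigcup_(t in _) _.
apply: (@bigsetI_measurable _ (g_sigma_algebraType G)) => i _.
exact: sigmaN_increment.
Qed.

Lemma increments_are_prob r delta :
  P (increments_are r delta) = (\prod_(i < r) pmf (delta i))%:E.
Proof.
have := @independent_increments _ _ _ _ _ _ _ poissonN (fun k => k%:R * h).
move=> /(_ (grid_ge0 0) (fun k => grid_le (leqnSn k))) H.
rewrite /increments_are (H _ (fun i => [set delta i]))//; last exact: iota_uniq.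
rewrite -prodEFin -(big_mkord xpredT (fun i => (pmf (delta i))%:E)) /index_iota subn0.
by apply: eq_bigr => i _; exact: increment_prob.
Qed.

Lemma indic_increments_are r delta w :
  \1_(increments_are r delta) w =
  \prod_(i < r) (increment h i w == delta i)%:R :> R.
Proof.
rewrite -(big_mkord xpredT (fun i => (increment h i w == delta i)%:R)).
rewrite /index_iota subn0 /increments_are; elim: (iota _ _) => [|i l ih].
  by rewrite !big_nil indicT.
rewrite !big_cons indicI/= ih; congr (_ * _).
by rewrite indicE; congr (nat_of_bool _)%:R; apply/idP/eqP => [/set_mem|/mem_set].
Qed.

End grid.

(** The product rule for events and independence of the directions extend to
    bounded functions one direction at a time, by [expect_mul_of_indic]. *)
Lemma expect_prod_directions A (J : seq nat) (phi : nat -> R -> R) :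
  sigmaN A -> uniq J -> (forall j, bounded_measurable (phi j)) ->
  \int[P]_w (\1_A w * \prod_(j <- J) phi j (theta j w)) =
  fine (P A) * \prod_(j <- J) direction_mean (phi j).
Proof.
move=> sA uJ bphi; have mA := sigmaN_measurable sA.
have bA := @bounded_measurable_indic _ _ R _ mA.
have bdir j (g : R -> R) : bounded_measurable g ->
    bounded_measurable (fun w => g (theta j w)).
  by move=> bg; apply: (bounded_measurable_comp bg).
have dmean_indic B : measurable B ->
    direction_mean \1_B = fine (uniform_prob (two_pi_gt0 R) B).
  by move=> mB; rewrite /direction_mean /Rintegral integral_indic// setIT.
suff H : forall J1 J2 (B : nat -> set R), uniq (J1 ++ J2) ->
    (forall j, measurable (B j)) ->
    \int[P]_w ((\1_A w * \prod_(j <- J2) \1_(B j) (theta j w)) *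
       \prod_(j <- J1) phi j (theta j w)) =
    (fine (P A) * \prod_(j <- J2) direction_mean \1_(B j)) *
      \prod_(j <- J1) direction_mean (phi j).
  have := H J [::] (fun=> setT); rewrite cats0 !big_nil => /(_ uJ (fun=> measurableT)).
  by under eq_expect do rewrite big_nil mulr1; rewrite mulr1.
elim=> [|j J1 ih] J2 B u mB.
  rewrite big_nil mulr1; under eq_expect do rewrite big_nil mulr1.
  pose E := \big[setI/setT]_(j <- J2) (theta j @^-1` B j).
  have sE : sigma_generated [set: nat] (fun j => theta j : T -> R) E.
    rewrite /sigma_generated; set G := \bigcup_(i in _) _.
    apply: (@bigsetI_measurable _ (g_sigma_algebraType G)) => j _.
    apply: sub_sigma_algebra; exists j => //.
    by exists (B j) => //; rewrite setTI.
  have mE : measurable E.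
    by apply: bigsetI_measurable => j _; exact: measurable_funPTI.
  transitivity (\int[P]_w \1_(A `&` E) w).
    apply: eq_expect => w; rewrite indicI/=; congr (_ * _).
    rewrite /E; elim: J2 {u E sE mE} => [|j J2 ihJ]; first by rewrite !big_nil indicT.
    by rewrite !big_cons indicI/= ihJ.
  rewrite expect_indic; last exact: measurableI.
  rewrite (indep sA sE) /E directions.1//.
  rewrite (eq_bigr (fun j => (direction_mean \1_(B j))%:E)); last first.
    move=> j _; rewrite dmean_indic// fineK; first by rewrite -(directions.2 j).
    by rewrite -(directions.2 j)//; exact: fin_num_measure.
  by rewrite prodEFin fineM//; exact: fin_num_measure.
have [jJ uJ1J2] : j \notin J1 ++ J2 /\ uniq (J1 ++ J2) by move: u => /= /andP[].
transitivity (\int[P]_w ((\1_A w * \prod_(i <- J2) \1_(B i) (theta i w) *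
    \prod_(i <- J1) phi i (theta i w)) * phi j (theta j w))).
  by apply: eq_expect => w; rewrite big_cons; ring.
rewrite (@expect_mul_of_indic _ _ _ P _ _ _ (theta j)
  (fine (P A) * (\prod_(i <- J2) direction_mean \1_(B i)) *
   \prod_(i <- J1) direction_mean (phi i)))//.
- by rewrite expect_direction// big_cons; ring.
- apply: bounded_measurableM; first apply: bounded_measurableM => //.
    apply: bounded_measurable_prod => i.
    exact/bdir/bounded_measurable_indic.
  by apply: bounded_measurable_prod => i; exact/bdir/bphi.
move=> C mC; rewrite expect_direction; last exact: bounded_measurable_indic.
pose B' i := if i == j then C else B i.
have B'E i : i \in J2 -> B' i = B i.
  rewrite /B'; case: eqP => // -> jJ2.
  by move: jJ; rewrite mem_cat jJ2 orbT.
have B'j : B' j = C by rewrite /B' eqxx.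
have mB' i : measurable (B' i) by rewrite /B'; case: ifP.
have uJ' : uniq (J1 ++ j :: J2).
  by rewrite -cat_rcons cat_uniq/= -/(uniq (_ :: _)) -cat_uniq cat_rcons
    uniq_catC/= uniq_catC mem_cat orbC -mem_cat jJ.
have := ih (j :: J2) B' uJ' mB'.
rewrite !big_cons B'j.
have -> : \prod_(i <- J2) direction_mean \1_(B' i) =
    \prod_(i <- J2) direction_mean \1_(B i).
  by apply: eq_big_seq => i /B'E ->.
move=> ihE; transitivity (\int[P]_w (\1_A w *
    (\prod_(i <- j :: J2) \1_(B' i) (theta i w)) *
    \prod_(i <- J1) phi i (theta i w))).
  apply: eq_expect => w; rewrite big_cons B'j.
  rewrite (_ : \prod_(i <- J2) \1_(B' i) (theta i w) =
    \prod_(i <- J2) \1_(B i) (theta i w)); last first.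
    by apply: eq_big_seq => i /B'E ->.
  by ring.
by rewrite ihE; ring.
Qed.

End random_flight_model.

(** * The chain of headings on a mesh *)

(** Means are computed under a fixed value of an event count; this removes the
    condition without summing conditional means, by bounded convergence over
    finite unions of slices. *)
Lemma expect_eq0_of_slices {d} {T : measurableType d} {R : realType}
    (P : probability T R) (K : T -> nat) (H : T -> R) :
  measurable_fun setT K -> bounded_measurable H ->
  (forall k, \int[P]_w (H w * (K w == k)%:R) = 0) -> \int[P]_w H w = 0.
Proof.
move=> mK bH H0; have [mH [C HC]] := bH.
have bK (b : nat -> bool) : bounded_measurable (fun w => H w * (b (K w))%:R).
  by apply: bounded_measurableM => //; exact: bounded_measurable_bool.
have HM M : \int[P]_w (H w * (K w < M)%N%:R) = 0.
  transitivity (\int[P]_w (\sum_(k < M) (H w * (K w == k)%:R))).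
    apply: eq_expect => w; rewrite -mulr_sumr; congr (_ * _).
    rewrite -natr_sum; congr (_%:R); have [KM|MK] := ltnP (K w) M.
      rewrite (bigD1 (Ordinal KM))//= eqxx big1// => i.
      by rewrite eq_sym -val_eqE/= => /negbTE ->.
    rewrite big1// => i _; case: eqP => // Ki.
    by move: MK; rewrite Ki leqNgt ltn_ord.
  rewrite expect_sum; first by rewrite big1.
  by move=> i; exact: (bK (fun n => n == i)).
have HMC M w : `|H w * (K w < M)%N%:R| <= C.
  rewrite normrM (le_trans _ (HC w))// ler_piMr// ger0_norm//.
  by rewrite lern1 leq_b1.
have Hcvg w : H w * (K w < M)%N%:R @[M --> \oo] --> H w.
  apply: cvg_near_cst; near=> M; rewrite (_ : (K w < M)%N) ?mulr1//.
  by near: M; exact: nbhs_infty_gt.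
have [_ [_ cv]] := @expect_cvg _ _ _ P _ _ C
  (fun M => (bK (fun n => n < M)%N).1) HMC Hcvg.
have cv0 : \int[P]_x (H x * (K x < M)%N%:R) @[M --> \oo] --> (0 : R).
  by under eq_fun do rewrite HM; exact: cvg_cst.
exact: cvg_unique cv cv0.
Unshelve. all: by end_near. Qed.

Section heading_chain.
Context {d} {T : measurableType d} {R : realType} (P : probability T R).
Variables (lambda : R) (N : R -> {RV P >-> nat}) (s : nat -> T -> R).
Variable theta : nat -> {RV P >-> R}.
Hypothesis poissonN : poisson_process lambda N s.
Hypothesis directions : iid_uniform_directions theta.
Hypothesis indep : independent_systems P
  (sigma_generated [set t : R | 0 <= t] (fun t => N t : T -> nat))
  (sigma_generated [set: nat] (fun j => theta j : T -> R)).
Hypothesis lambda_gt0 : 0 < lambda.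
Variable h : R.
Hypothesis h_gt0 : 0 < h.

Local Notation pmf k := (poisson_pmf (lambda * h) k).
Local Notation inc := (increment N h).

Definition heading (i : nat) (w : T) : R := theta (N (i%:R * h) w) w.

Definition heading_prod (psi : nat -> R -> R) (l : nat) (w : T) : R :=
  \prod_(i < l.+1) psi i (heading i w).

Lemma measurable_heading i : measurable_fun setT (heading i).
Proof.
by apply: (@measurable_fun_select _ _ _ _ (N (i%:R * h)) (fun k => theta k)).
Qed.

Lemma bounded_heading (phi : R -> R) i : bounded_measurable phi ->
  bounded_measurable (fun w => phi (heading i w)).
Proof.
by move=> b; exact: (bounded_measurable_comp b (measurable_heading i)).
Qed.

Lemma bounded_heading_prod psi l : (forall i, bounded_measurable (psi i)) ->
  bounded_measurable (heading_prod psi l).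
Proof.
by move=> b; apply: bounded_measurable_prod => i; exact: bounded_heading.
Qed.

Lemma heading_prodS psi l w :
  heading_prod psi l.+1 w = heading_prod psi l w * psi l.+1 (heading l.+1 w).
Proof. by rewrite /heading_prod big_ord_recr. Qed.

Lemma heading_prod1 l w : heading_prod (fun _ _ => 1) l w = 1.
Proof. by rewrite /heading_prod big1_eq. Qed.

(** A factor depending on an earlier heading can be absorbed in the product,
    which is what makes products of test functions a convenient description of
    the past. *)
Lemma heading_prodM psi l i (g : R -> R) w : (i <= l)%N ->
  heading_prod psi l w * g (heading i w) =
  heading_prod (fun j x => if j == i then psi j x * g x else psi j x) l w.
Proof.
move=> il; rewrite /heading_prod.
rewrite (bigD1 (Ordinal (il : (i < l.+1)%N)))//= [in RHS](bigD1 (Ordinal (il : (i < l.+1)%N)))//= eqxx.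
rewrite mulrAC; congr (_ * _); apply: eq_bigr => j.
by rewrite -val_eqE/= => /negbTE ->.
Qed.

(** The past up to grid time [l], on the event that it contains [k] events,
    together with [r] later increments and with directions of indices [J]; the
    latter are not yet in use when [k < j]. *)
Definition slice psi l k r (delta : nat -> nat) (J : seq nat)
    (chi : nat -> R -> R) (w : T) : R :=
  heading_prod psi l w * (N (l%:R * h) w == k)%:R *
  (\prod_(i < r) (inc (l + i)%N w == delta i)%:R) *
  \prod_(j <- J) chi j (theta j w).

Lemma bounded_slice psi l k r delta J chi :
  (forall i, bounded_measurable (psi i)) ->
  (forall i, bounded_measurable (chi i)) ->
  bounded_measurable (slice psi l k r delta J chi).
Proof.
move=> bpsi bchi; apply: bounded_measurableM; last first.
  apply: bounded_measurable_prod => j.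
  exact: (bounded_measurable_comp (bchi j)).
apply: bounded_measurableM; last first.
  apply: bounded_measurable_prod => i.
  apply: (bounded_measurable_bool (fun n => n == delta i)).
  exact: measurable_increment.
apply: bounded_measurableM; first exact: bounded_heading_prod.
exact: (bounded_measurable_bool (fun n => n == k)).
Qed.

(** The constant [G] is the mean of the past alone, which need not be
    known. *)
Definition slice_factors psi l k (G : R) : Prop :=
  forall r delta J chi, uniq J -> all (fun j => k < j)%N J ->
    (forall j, bounded_measurable (chi j)) ->
    \int[P]_w slice psi l k r delta J chi w =
    G * \prod_(i < r) pmf (delta i) * \prod_(j <- J) direction_mean (chi j).

(** By induction on [l]: the count [k] splits according to its value [m] one step
    before. If [m = k] the heading is still [theta k], and its test function joins that
    of the previous heading; if [m < k] the heading is a direction not used before, and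
    [k] joins [J]. In both cases the last increment joins the later ones. *)
Lemma expect_slice l psi k : (forall i, bounded_measurable (psi i)) ->
  exists G, slice_factors psi l k G.
Proof.
elim: l psi k => [|l ih] psi k bpsi.
  have N0 w : N (0%:R * h) w = 0%N by rewrite mul0r (event_count0 poissonN).
  have [->|k0] := eqVneq k 0%N; last first.
    exists 0 => r delta J chi uJ kJ bchi; rewrite !mul0r -[RHS](expect_cst P).
    by apply: eq_expect => w; rewrite /slice N0 eq_sym (negbTE k0) mulr0 !mul0r.
  exists (direction_mean (psi 0%N)) => r delta J chi uJ kJ bchi.
  pose phi j := if j == 0%N then psi 0%N else chi j.
  have phiJ j : j \in J -> phi j = chi j.
    by rewrite /phi; case: eqP => // -> /(allP kJ).
  transitivity (\int[P]_w (\1_(increments_are N h r delta) w *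
      \prod_(j <- 0%N :: J) phi j (theta j w))).
    apply: eq_expect => w; rewrite /slice N0 eqxx mulr1 indic_increments_are.
    rewrite big_cons /heading_prod big_ord_recl big_ord0 /heading N0.
    rewrite (_ : \prod_(j <- J) phi j (theta j w) =
      \prod_(j <- J) chi j (theta j w)); last first.
      by apply: eq_big_seq => j /phiJ ->.
    by rewrite {1}/phi/=; ring.
  rewrite (expect_prod_directions directions indep)//.
  - rewrite (increments_are_prob poissonN h_gt0)/= big_cons {1}/phi/=.
    rewrite (_ : \prod_(j <- J) direction_mean (phi j) =
      \prod_(j <- J) direction_mean (chi j)); last first.
      by apply: eq_big_seq => j /phiJ ->.
    by ring.
  - exact: (sigmaN_increments_are poissonN h_gt0).
  - by rewrite /= uJ andbT; apply/negP => /(allP kJ).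
  - by move=> j; rewrite /phi; case: ifP.
pose upd (m : nat) : nat -> R -> R := if m == k then
  (fun i x => if i == l then psi i x * psi l.+1 x else psi i x) else psi.
have bupd m i : bounded_measurable (upd m i).
  rewrite /upd; case: (m == k) => //; have [->|il] := eqVneq i l.
    exact: (bounded_measurableM (bpsi l) (bpsi l.+1)).
  exact: bpsi.
have /choice[G HG] : forall m, exists g, slice_factors (upd m) l m g.
  by move=> m; exact: ih.
exists (\sum_(m < k.+1) G m * pmf (k - m)%N *
  (if m == k :> nat then 1 else direction_mean (psi l.+1))).
move=> r delta J chi uJ kJ bchi.
pose delta' m i := if i is i'.+1 then delta i' else (k - m)%N.
pose J' m := if m == k then J else k :: J.
pose chi' j := if j == k then psi l.+1 else chi j.
have chiJ j : j \in J -> chi' j = chi j.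
  by rewrite /chi'; case: eqP => // -> /(allP kJ); rewrite ltnn.
have bchi' j : bounded_measurable (chi' j) by rewrite /chi'; case: ifP.
transitivity (\int[P]_w (\sum_(m < k.+1)
    slice (upd m) l m r.+1 (delta' m) (J' m) chi' w)).
  apply: eq_expect => w; rewrite /slice.
  have incE := increment_addE poissonN h_gt0 l w.
  have termE m : (\prod_(i < r.+1) (inc (l + i)%N w == delta' m i)%:R) =
     (inc l w == k - m)%N%:R * \prod_(i < r) (inc (l.+1 + i)%N w == delta i)%:R :> R.
    rewrite big_ord_recl addn0; congr (_ * _).
    by apply: eq_bigr => i _; rewrite lift0 addSnnS.
  have JE : \prod_(j <- J) chi' j (theta j w) = \prod_(j <- J) chi j (theta j w).
    by apply: eq_big_seq => j /chiJ ->.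
  under [RHS]eq_bigr do rewrite termE.
  have [Nk|Nk] := eqVneq (N (l.+1%:R * h) w) k; last first.
    rewrite mulr0 !mul0r big1// => m _.
    have [Nm|_] := eqVneq (N (l%:R * h) w) m; last by rewrite mulr0 !mul0r.
    have [im|_] := eqVneq (inc l w) (k - m)%N; last by rewrite !mul0r mulr0 mul0r.
    by move: Nk; rewrite -incE Nm im subnKC ?eqxx// -ltnS.
  have mk : (N (l%:R * h) w < k.+1)%N by rewrite ltnS -Nk -incE leq_addr.
  rewrite [RHS](bigD1 (Ordinal mk))//= [X in _ = _ + X]big1 ?addr0; last first.
    move=> m; rewrite -val_eqE/= eq_sym => /negbTE ->.
    by rewrite mulr0 !mul0r.
  rewrite eqxx !mulr1.
  have -> : (inc l w == k - N (l%:R * h) w)%N by rewrite -Nk -incE addKn.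
  rewrite mul1r heading_prodS {1}/heading Nk /J' /upd.
  case: eqP => [Nlk|_].
    rewrite JE -heading_prodM ?leqnn//.
    by rewrite /heading Nlk; ring.
  by rewrite big_cons JE {1}/chi' eqxx; ring.
rewrite expect_sum; last by move=> m; exact: bounded_slice.
rewrite !mulr_suml; apply: eq_bigr => m _; rewrite HG//.
- rewrite big_ord_recl.
  have -> : \prod_(i < r) pmf (delta' m (lift ord0 i)) = \prod_(i < r) pmf (delta i).
    by apply: eq_bigr => i _; rewrite lift0.
  have JE : \prod_(j <- J) direction_mean (chi' j) =
      \prod_(j <- J) direction_mean (chi j).
    by apply: eq_big_seq => j /chiJ ->.
  rewrite /J'; case: eqP => _; first by rewrite JE /=; ring.
  by rewrite big_cons JE {1}/chi' eqxx /=; ring.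
- rewrite /J'; case: eqP => //= _; rewrite uJ andbT.
  by apply/negP => /(allP kJ); rewrite ltnn.
- have mlek : (m <= k)%N by rewrite -ltnS.
  have Jm : all (fun j => m < j)%N J.
    by apply/allP => j /(allP kJ); exact: leq_ltn_trans.
  by rewrite /J'; case: eqP => //= /eqP mk; rewrite ltn_neqAle mk mlek.
Qed.

Local Notation q := (expR (- (lambda * h))).

Lemma pmf0 : pmf 0%N = q.
Proof. by rewrite /poisson_pmf mulr_gt0// expr0 fact0 invr1 !mul1r. Qed.

(** Without an event in the next step, of probability [q], the heading stays; with
    [a > 0] events it becomes the direction of index [k + a], which is independent of the
    past by [expect_slice]. *)
Lemma expect_next_heading psi phi l : (forall i, bounded_measurable (psi i)) ->
  bounded_measurable phi ->
  \int[P]_w (heading_prod psi l w * phi (heading l.+1 w)) =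
  q * \int[P]_w (heading_prod psi l w * phi (heading l w)) +
  (1 - q) * direction_mean phi * \int[P]_w heading_prod psi l w.
Proof.
move=> bpsi bphi.
have bhp psi' : (forall i, bounded_measurable (psi' i)) ->
  bounded_measurable (heading_prod psi' l) by exact: bounded_heading_prod.
have binc (b : nat -> bool) : bounded_measurable (fun w => (b (inc l w))%:R : R).
  by apply: bounded_measurable_bool; exact: measurable_increment.
have sliceE psi' k r delta J chi w : slice psi' l k r delta J chi w =
  heading_prod psi' l w * (\prod_(i < r) (inc (l + i)%N w == delta i)%:R) *
  (\prod_(j <- J) chi j (theta j w)) * (N (l%:R * h) w == k)%:R.
  by rewrite /slice; ring.
have keep psi' : (forall i, bounded_measurable (psi' i)) ->
    \int[P]_w (heading_prod psi' l w * (inc l w == 0)%N%:R) =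
    q * \int[P]_w heading_prod psi' l w.
  move=> bpsi'.
  have b1 : bounded_measurable (fun w => heading_prod psi' l w * (inc l w == 0)%N%:R).
    by apply: bounded_measurableM; [exact: bhp|exact: (binc (fun n => n == 0)%N)].
  apply/eqP; rewrite -subr_eq0 -expectZ; last exact: bhp.
  rewrite -expectB//; last exact/bounded_measurableZ/bhp.
  apply/eqP; apply: (@expect_eq0_of_slices _ _ _ _ (N (l%:R * h))) => // [|k].
    by apply: bounded_measurableB => //; exact/bounded_measurableZ/bhp.
  have [G HG] := expect_slice l k bpsi'.
  have := HG 1%N (fun=> 0%N) [::] (fun=> phi) isT isT (fun=> bphi).
  have := HG 0%N (fun=> 0%N) [::] (fun=> phi) isT isT (fun=> bphi).
  rewrite big_ord_recl !big_ord0 !big_nil !mulr1 pmf0 => H0 H1.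
  transitivity (\int[P]_w (slice psi' l k 1 (fun=> 0%N) [::] (fun=> phi) w -
     q * slice psi' l k 0 (fun=> 0%N) [::] (fun=> phi) w)).
    apply: eq_expect => w; rewrite !sliceE big_ord_recl !big_ord0 !big_nil addn0.
    by ring.
  rewrite expectB ?expectZ ?H0 ?H1; [ring|exact: bounded_slice..|].
  exact/bounded_measurableZ/bounded_slice.
pose psi1 j x := if j == l then psi j x * phi x else psi j x.
have bpsi1 j : bounded_measurable (psi1 j).
  rewrite /psi1; have [->|jl] := eqVneq j l; last exact: bpsi.
  exact: (bounded_measurableM (bpsi l) bphi).
have hp1 w : heading_prod psi l w * phi (heading l w) = heading_prod psi1 l w.
  by rewrite heading_prodM.
have bH l' : bounded_measurable (fun w => phi (heading l' w)).
  exact: bounded_heading.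
pose m := direction_mean phi.
pose H w := heading_prod psi l w * (phi (heading l.+1 w) - m) * (inc l w != 0)%N%:R.
have bHH : bounded_measurable H.
  apply: bounded_measurableM; last exact: (binc (fun n => n != 0)%N).
  apply: bounded_measurableM; first exact: bhp.
  by apply: bounded_measurableB => //; exact: bounded_measurable_cst.
have H0 : \int[P]_w H w = 0.
  apply: (@expect_eq0_of_slices _ _ _ _ (inc l)) => //.
    exact: measurable_increment.
  move=> a; apply: (@expect_eq0_of_slices _ _ _ _ (N (l%:R * h))) => //.
    by apply: bounded_measurableM => //; exact: (binc (fun n => n == a)).
  move=> k; have [->|a0] := eqVneq a 0%N.
    rewrite -[RHS](expect_cst P); apply: eq_expect => w; rewrite /H.
    by case: eqP => _; rewrite ?(mulr0,mul0r).
  have [G HG] := expect_slice l k bpsi.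
  have := HG 1%N (fun=> a) [::] (fun=> phi) isT isT (fun=> bphi).
  have := HG 1%N (fun=> a) [:: (k + a)%N] (fun=> phi) isT _ (fun=> bphi).
  rewrite /= -[X in (X < _)%N]addn0 ltn_add2l lt0n a0 => /(_ isT).
  rewrite !big_ord_recl !big_ord0 !big_cons !big_nil !mulr1 -/m => E1 E0.
  transitivity (\int[P]_w (slice psi l k 1 (fun=> a) [:: (k + a)%N] (fun=> phi) w -
     m * slice psi l k 1 (fun=> a) [::] (fun=> phi) w)).
    apply: eq_expect => w; rewrite !sliceE !big_ord_recl !big_ord0 !big_cons
      !big_nil addn0 /H.
    have [ia|_] := eqVneq (inc l w) a; last by rewrite /= ?mulr0n; ring.
    have [Nk|_] := eqVneq (N (l%:R * h) w) k; last by rewrite /= ?mulr0n; ring.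
    have -> : heading l.+1 w = theta (k + a)%N w.
      by rewrite /heading -(increment_addE poissonN h_gt0) Nk ia.
    by rewrite ia a0 /= ?mulr1n; ring.
  rewrite expectB ?expectZ ?E0 ?E1; [ring|exact: bounded_slice..|].
  exact/bounded_measurableZ/bounded_slice.
transitivity (\int[P]_w (H w + heading_prod psi1 l w * (inc l w == 0)%N%:R +
    m * (heading_prod psi l w - heading_prod psi l w * (inc l w == 0)%N%:R))).
  apply: eq_expect => w; rewrite /H -hp1.
  case: (eqVneq (inc l w) 0%N) => [i0|_] /=; last by ring.
  have -> : heading l.+1 w = heading l w.
    by rewrite /heading -(increment_addE poissonN h_gt0) i0 addn0.
  by ring.
have b0 psi' : (forall i, bounded_measurable (psi' i)) ->
    bounded_measurable (fun w => heading_prod psi' l w * (inc l w == 0)%N%:R).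
  move=> b; apply: bounded_measurableM; first exact: bhp.
  exact: (binc (fun n => n == 0)%N).
rewrite expectD; last 2 first.
- by apply: bounded_measurableD => //; exact: b0.
- by apply: bounded_measurableZ; apply: bounded_measurableB; [exact: bhp|exact: b0].
rewrite expectD ?H0//; last exact: b0.
rewrite expectZ; last by apply: bounded_measurableB; [exact: bhp|exact: b0].
rewrite expectB; [|exact: bhp|exact: b0].
rewrite !keep// (eq_expect P hp1). rewrite /m; ring.
Qed.

End heading_chain.

(** * Uniform means of powers of a projection *)

Section direction_means.
Context {R : realType}.

Lemma bounded_measurable_cos : bounded_measurable (@cos R).
Proof.
split; first by apply: continuous_measurable_fun; exact: continuous_cos.
by exists 1 => x; rewrite ler_norml cos_geN1 cos_le1.
Qed.

Lemma bounded_measurable_sin : bounded_measurable (@sin R).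
Proof.
split; first by apply: continuous_measurable_fun; exact: continuous_sin.
by exists 1 => x; rewrite ler_norml sin_geN1 sin_le1.
Qed.

(** The fundamental theorem of calculus over one period. *)
Lemma direction_mean_deriv (F f : R -> R) (M : R) : continuous f ->
  (forall x, `|f x| <= M) -> (forall x : R, is_derive x 1 F (f x)) ->
  F 0 = F (2 * pi) -> direction_mean f = 0.
Proof.
move=> cf fM dF F02.
have bf : bounded_measurable f.
  by split; [exact: continuous_measurable_fun|exists M].
have pi0 : (0 : R) < 2 * pi := two_pi_gt0 R.
pose g x := f x + M.
have g0 x : 0 <= g x by have := fM x; rewrite ler_norml /g => /andP[? _]; lra.
have cg : continuous g by move=> x; apply: cvgD; [exact: cf|exact: cvg_cst].
pose G x := F x + M * x.
have dG (x : R) : is_derive x 1 G (g x).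
  by apply: is_derive_eq; rewrite /g [M *: _]mulr1.
have cG : continuous G.
  by move=> x; apply: differentiable_continuous; apply/derivable1_diffP.
have : (\int[uniform_prob pi0]_x (g x)%:E = M%:E)%E.
  rewrite integral_uniform//; last first.
    by apply/measurable_EFinP; exact: continuous_measurable_fun.
  rewrite (@continuous_FTC2 _ g G)//.
  - rewrite /G F02 !mulr0 -EFinB -EFinM; congr EFin.
    by move: (pi : R) (lt0r_neq0 (pi_gt0 R)) => p p0; field.
  - exact: continuous_subspaceT.
  - split.
    + by move=> x _.
    + exact/cvg_at_right_filter/cG.
    + exact/cvg_at_left_filter/cG.
  - by move=> x _; rewrite derive1E; exact: derive_val.
move=> H; have : direction_mean g = M by rewrite /direction_mean /Rintegral H.
rewrite /direction_mean expectD//; last exact: bounded_measurable_cst.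
by rewrite expect_cst => /(canRL (addrK _)); rewrite subrr.
Qed.

(** The mean of [cos ^ n] over a period. *)
Fixpoint wallis (n : nat) : R :=
  match n with
  | 0 => 1
  | 1 => 0
  | n'.+2 => n'.+1%:R / n'.+2%:R * wallis n'
  end.

Lemma wallisSS n : n.+2%:R * wallis n.+2 = n.+1%:R * wallis n.
Proof. by rewrite /= mulrA mulrCA mulfV ?mulr1// pnatr_eq0. Qed.

Lemma wallis_odd n : odd n -> wallis n = 0.
Proof.
elim/ltn_ind: n => -[|[|n]] ih //; rewrite oddS oddS negbK => on.
by rewrite /= ih ?mulr0// ltnS.
Qed.

Lemma bounded_measurable_projection (x y : R) :
  bounded_measurable (fun t : R => x * cos t + y * sin t).
Proof.
apply: bounded_measurableD; apply: bounded_measurableZ.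
  exact: bounded_measurable_cos.
exact: bounded_measurable_sin.
Qed.

(** With [w = x cos + y sin] one has [w'' = - w] and [w' ^ 2 = r ^ 2 - w ^ 2],
    so integrating the derivative of [w ^ n * w'] over a period gives Wallis'
    recursion. *)
Lemma direction_mean_projection (x y : R) n :
  direction_mean (fun t => (x * cos t + y * sin t) ^+ n) =
  wallis n * (x ^+ 2 + y ^+ 2) ^+ n./2.
Proof.
pose w (t : R) := x * cos t + y * sin t.
pose w' (t : R) := y * cos t - x * sin t.
have dw (t : R) : is_derive t 1 w (w' t).
  by apply: is_derive_eq; rewrite /w' /GRing.scale/=; ring.
have dw' (t : R) : is_derive t 1 w' (- w t).
  by apply: is_derive_eq; rewrite /w /GRing.scale/=; ring.
have cw : continuous w.
  by move=> t; apply: differentiable_continuous; apply/derivable1_diffP.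
have bw : bounded_measurable w by exact: bounded_measurable_projection.
have bwX k := bounded_measurableX k bw.
have ww' t : w' t ^+ 2 = x ^+ 2 + y ^+ 2 - w t ^+ 2.
  have := cos2Dsin2 t; rewrite /w /w' => cs.
  rewrite -[X in X + _ - _]mulr1 -[X in _ + X - _]mulr1 -cs; ring.
have cwX k : continuous (fun t => w t ^+ k).
  move=> t; apply: (@continuous_comp _ _ _ w (fun z => z ^+ k)); first exact: cw.
  exact: exprn_continuous.
have w02 : w (2 * pi) = w 0.
  by rewrite /w -[2 * pi]add0r mulr_natl cosD2pi sinD2pi.
have w'02 : w' (2 * pi) = w' 0.
  by rewrite /w' -[2 * pi]add0r mulr_natl cosD2pi sinD2pi.
have M k : direction_mean (fun t => w t ^+ k.+2) =
    k.+1%:R / k.+2%:R * (x ^+ 2 + y ^+ 2) * direction_mean (fun t => w t ^+ k).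
  pose f t := k.+1%:R * (x ^+ 2 + y ^+ 2) * w t ^+ k - k.+2%:R * w t ^+ k.+2.
  have bf : bounded_measurable f.
    by apply: bounded_measurableB; apply: bounded_measurableZ.
  have [_ [B fB]] := bf.
  have : direction_mean f = 0.
    apply: (@direction_mean_deriv (fun t => w t ^+ k.+1 * w' t) _ B) => //.
    - by move=> t; apply: cvgB; apply: cvgM; (exact: cvg_cst || exact: cwX).
    - move=> t; have d1 := is_deriveM (is_deriveX k.+1 (dw t)) (dw' t).
      rewrite (_ : (fun t0 => _) = (w ^+ k.+1) * w'); last first.
        by apply/funext => u; rewrite /GRing.mul/= exprfctE.
      apply: is_derive_eq d1 _; rewrite /GRing.scale/= exprfctE /f.
      rewrite (_ : w' t * _ = k.+1%:R * w t ^+ k * w' t ^+ 2); last by ring.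
      by rewrite ww' -[k.+2%:R]natr1 !exprS; ring.
    - by rewrite w02 w'02.
  rewrite /direction_mean expectB; [|exact/bounded_measurableZ/bwX..].
  rewrite !expectZ; [|exact: bwX..].
  move=> /eqP; rewrite subr_eq0 => /eqP H.
  apply: (mulfI (_ : k.+2%:R != 0 :> R)); first by rewrite pnatr_eq0.
  by rewrite -H -!mulrA [RHS]mulrCA mulVKf// pnatr_eq0.
rewrite -/(w _); elim/ltn_ind: n => -[|[|n]] ih.
- by rewrite /direction_mean expect_cst !expr0 mulr1.
- rewrite mul0r; have [_ [B wB]] := bw.
  apply: (@direction_mean_deriv (fun t => - w' t) _ B) => //.
  + by move=> t; apply: is_derive_eq; rewrite opprK.
  + by rewrite w'02.
- rewrite M ih//= [X in _ = _ * X]exprS; ring.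
Qed.

End direction_means.

(** * Uniform first-order expansions *)

Section first_order_expansions.
Context {R : realType}.
Implicit Types (t C x y : R) (g f : R -> R).

(** Differentiability on [0, t] in the quantitative form consumed by the Euler
    scheme: one constant bounds the function, its derivative and, uniformly,
    the quadratic remainder. *)
Definition expands t g (g' : R -> R) : Prop :=
  exists C, forall x y, 0 <= x -> 0 <= y -> x + y <= t ->
    [/\ `|g x| <= C, `|g' x| <= C & `|g (x + y) - g x - y * g' x| <= C * y ^+ 2].

Lemma eq_expands t g g1 g2 : (forall x, g1 x = g2 x) ->
  expands t g g1 -> expands t g g2.
Proof. by move=> g12 [C H]; exists C => x y; rewrite -g12; exact: H. Qed.

Lemma eq_expandsl t g1 g2 g' : (forall x, g1 x = g2 x) ->
  expands t g1 g' -> expands t g2 g'.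
Proof. by move=> g12 [C H]; exists C => x y; rewrite -!g12; exact: H. Qed.

Lemma expands_eq t f g f' g' : expands t f f' ->
  (forall x, f x = g x) -> (forall x, f' x = g' x) -> expands t g g'.
Proof. by move=> H fg f'g'; apply: eq_expands f'g' (eq_expandsl fg H). Qed.

Lemma expands_cst t (a : R) : expands t (fun=> a) (fun=> 0).
Proof.
exists `|a| => x y _ _ _; split; rewrite ?normr0//.
by rewrite subrr mulr0 subr0 normr0 mulr_ge0// sqr_ge0.
Qed.

Lemma expands_id t : expands t id (fun=> 1).
Proof.
exists (`|t| + 1) => x y x0 y0 xyt; split.
- by rewrite ger0_norm// (le_trans _ (_ : `|t| <= _))// ?lerDl// ler_normr; apply/orP; left; lra.
- by rewrite normr1 lerDr.
- rewrite (_ : _ - _ - _ = 0); last by rewrite /=; ring.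
  by rewrite normr0 mulr_ge0 ?sqr_ge0// addr_ge0.
Qed.

Lemma expandsD t f g f' g' : expands t f f' -> expands t g g' ->
  expands t (fun x => f x + g x) (fun x => f' x + g' x).
Proof.
move=> [A HA] [B HB]; exists (A + B) => x y x0 y0 xyt.
have [a1 a2 a3] := HA x y x0 y0 xyt; have [b1 b2 b3] := HB x y x0 y0 xyt.
split; [exact: le_trans (ler_normD _ _) (lerD _ _)..|].
rewrite (_ : _ - _ - _ = (f (x + y) - f x - y * f' x) +
  (g (x + y) - g x - y * g' x)); last by ring.
by rewrite (le_trans (ler_normD _ _))// mulrDl lerD.
Qed.

Lemma expandsM t f g f' g' : expands t f f' -> expands t g g' ->
  expands t (fun x => f x * g x) (fun x => f' x * g x + f x * g' x).
Proof.
move=> [A HA] [B HB].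
exists (A * (B + B * `|t| + B * t ^+ 2) + A * B + A * B + `|t| * (A * B)).
move=> x y x0 y0 xyt.
have [a1 a2 a3] := HA x y x0 y0 xyt; have [b1 b2 b3] := HB x y x0 y0 xyt.
have A0 : 0 <= A by exact: le_trans (normr_ge0 _) a1.
have B0 : 0 <= B by exact: le_trans (normr_ge0 _) b1.
have AB0 : 0 <= A * B by exact: mulr_ge0.
have t2 : 0 <= t ^+ 2 := sqr_ge0 t.
have tt := normr_ge0 t.
have E0 : 0 <= A * (B + B * `|t| + B * t ^+ 2).
  by rewrite mulr_ge0// !addr_ge0// mulr_ge0.
have tAB : 0 <= `|t| * (A * B) by rewrite mulr_ge0.
have E1 : A * B <= A * (B + B * `|t| + B * t ^+ 2).
  by rewrite ler_wpM2l// -addrA lerDl addr_ge0// mulr_ge0.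
split.
- by rewrite normrM (le_trans (ler_pM _ _ a1 b1))//; lra.
- rewrite (le_trans (ler_normD _ _))// !normrM.
  have := ler_pM (normr_ge0 _) (normr_ge0 _) a2 b1.
  have := ler_pM (normr_ge0 _) (normr_ge0 _) a1 b2.
  by lra.
set ef := f (x + y) - f x - y * f' x in a3.
set eg := g (x + y) - g x - y * g' x in b3.
have y2 : 0 <= y ^+ 2 := sqr_ge0 y.
have yt : y <= `|t| by rewrite ler_normr; apply/orP; left; lra.
have yt2 : y ^+ 2 <= t ^+ 2 by rewrite -(real_normK (num_real t)) ler_sqr ?nnegrE.
have gxy : `|g (x + y)| <= B + B * `|t| + B * t ^+ 2.
  rewrite (_ : g (x + y) = g x + y * g' x + eg); last by rewrite /eg; ring.
  rewrite (le_trans (ler_normD _ _))// lerD//; last first.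
    by rewrite (le_trans b3)// ler_wpM2l.
  rewrite (le_trans (ler_normD _ _))// lerD// normrM mulrC ler_pM//.
  by rewrite ger0_norm.
rewrite (_ : _ - _ - _ = ef * g (x + y) + f x * eg + y ^+ 2 * (f' x * g' x) +
    y * (f' x * eg)); last by rewrite /ef /eg; ring.
clearbody ef eg; rewrite !mulrDl.
rewrite (le_trans (ler_normD _ _))// lerD//; last first.
  rewrite !normrM (ger0_norm y0) -!mulrA ler_pM ?mulr_ge0//.
  by rewrite ler_pM.
rewrite (le_trans (ler_normD _ _))// lerD//; last first.
  rewrite !normrM ger0_norm// mulrC ler_wpM2r// ler_pM//.
rewrite (le_trans (ler_normD _ _))// lerD//; last first.
  by rewrite normrM -mulrA ler_pM.
by rewrite normrM mulrAC ler_pM.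
Qed.

Lemma expandsZ t (a : R) f f' : expands t f f' ->
  expands t (fun x => a * f x) (fun x => a * f' x).
Proof.
move=> H; have := expandsM (expands_cst t a) H.
by apply: eq_expands => x; rewrite mul0r add0r.
Qed.

Lemma expandsX t n f f' : expands t f f' ->
  expands t (fun x => f x ^+ n) (fun x => n%:R * f x ^+ n.-1 * f' x).
Proof.
move=> H; elim: n => [|n ih].
  apply: eq_expands (expands_cst t 1) => x; by rewrite !mul0r.
apply: eq_expandsl (fun x => esym (exprS (f x) n)) _.
apply: eq_expands (expandsM H ih) => x /=.
case: n {ih} => [|n]; first by rewrite /= !expr0; ring.
by rewrite /= exprS -[n.+2%:R]natr1; ring.
Qed.

Lemma expands_sum t n (F F' : nat -> R -> R) :
  (forall i, (i < n)%N -> expands t (F i) (F' i)) ->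
  expands t (fun x => \sum_(i < n) F i x) (fun x => \sum_(i < n) F' i x).
Proof.
elim: n => [|n ih] H.
  apply: (@eq_expandsl _ (fun=> 0)) => [x|]; first by rewrite big_ord0.
  by apply: eq_expands (expands_cst t 0) => x; rewrite big_ord0.
apply: (@eq_expandsl _ (fun x => \sum_(i < n) F i x + F n x)) => [x|].
  by rewrite big_ord_recr.
apply: eq_expands (expandsD (ih _) (H n _)) => // [x|i ilt].
  by rewrite [RHS]big_ord_recr.
by apply: H; rewrite ltnS ltnW.
Qed.

Lemma expRN_bounds y : 0 <= y -> 1 - y <= expR (- y) <= 1 - y + y ^+ 2.
Proof.
move=> y0; apply/andP; split; first exact: expR_ge1Dx.
have e1 := expR_ge1Dx y.
have ey : 0 < expR y := expR_gt0 y.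
rewrite expRN -[X in X <= _]mul1r ler_pdivrMr//.
have : 1 <= (1 - y + y ^+ 2) * (1 + y).
  have -> : (1 - y + y ^+ 2) * (1 + y) = 1 + y ^+ 3 by ring.
  by rewrite lerDl exprn_ge0.
move=> /le_trans; apply; apply: ler_wpM2l => //.
have -> : 1 - y + y ^+ 2 = (1 - y / 2) ^+ 2 + 3 / 4 * y ^+ 2 by field.
by rewrite addr_ge0 ?sqr_ge0// mulr_ge0 ?sqr_ge0//; lra.
Qed.

Lemma expands_expRN t (lambda : R) : 0 <= lambda ->
  expands t (fun x => expR (- (lambda * x))) (fun x => - lambda * expR (- (lambda * x))).
Proof.
move=> l0; exists (1 + lambda + lambda ^+ 2) => x y x0 y0 xyt.
have l2 : 0 <= lambda ^+ 2 := sqr_ge0 _.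
have e0 : 0 <= expR (- (lambda * x)) := expR_ge0 _.
have e1 : expR (- (lambda * x)) <= 1.
  by rewrite -expR0 ler_expR oppr_le0 mulr_ge0.
split.
- by rewrite ger0_norm//; lra.
- rewrite normrM normrN (ger0_norm l0) (ger0_norm e0).
  by have := ler_wpM2l l0 e1; lra.
have /expRN_bounds/andP[b1 b2] : 0 <= lambda * y by rewrite mulr_ge0.
rewrite mulrDr opprD expRD.
rewrite (_ : _ - _ - _ = expR (- (lambda * x)) *
  (expR (- (lambda * y)) - (1 - lambda * y))); last by ring.
rewrite normrM (ger0_norm e0) ger0_norm ?subr_ge0//.
have y2 := sqr_ge0 y.
apply: (@le_trans _ _ (1 * (lambda * y) ^+ 2)).
  by apply: ler_pM => //; rewrite ?subr_ge0//; lra.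
by rewrite mul1r exprMn ler_wpM2r//; lra.
Qed.

Lemma expands_expR t (lambda : R) : 0 <= lambda -> 0 <= t ->
  expands t (fun x => expR (lambda * x)) (fun x => lambda * expR (lambda * x)).
Proof.
move=> l0 t0; set E := expR (lambda * t).
have E1 : 1 <= E by rewrite -expR0 ler_expR mulr_ge0.
have E0 : 0 <= E := le_trans ler01 E1.
exists ((1 + lambda + lambda ^+ 2) * E ^+ 2) => x y x0 y0 xyt.
have l2 : 0 <= lambda ^+ 2 := sqr_ge0 _.
have EE : E <= E ^+ 2 by rewrite expr2 ler_peMl.
have eE z : 0 <= z -> z <= t -> expR (lambda * z) <= E.
  by move=> z0 zt; rewrite ler_expR ler_wpM2l.
have xt : x <= t by lra.
have yt : y <= t by lra.
have ex0 z : 0 <= expR (lambda * z) := expR_ge0 _.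
have EE0 : 0 <= E ^+ 2 := sqr_ge0 _.
split.
- rewrite ger0_norm// (le_trans (eE x x0 xt))// (le_trans EE)// ler_peMl//; lra.
- rewrite normrM (ger0_norm l0) ger0_norm// ler_pM//; first lra.
  by rewrite (le_trans (eE x x0 xt)).
rewrite mulrDr expRD.
rewrite (_ : _ - _ - _ = expR (lambda * x) *
  (expR (lambda * y) - 1 - lambda * y)); last by ring.
set z := lambda * y; have z0 : 0 <= z by rewrite mulr_ge0.
have e1 : 1 + z <= expR z := expR_ge1Dx z.
have e2 : expR z * (1 - z) <= 1.
  have := ler_wpM2l (expR_ge0 z) (expR_ge1Dx (- z)).
  by rewrite -expRD subrr expR0.
have e3 : expR z - 1 - z <= z ^+ 2 * expR z.
  have : expR z - 1 <= z * expR z by lra.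
  by move=> /(ler_wpM2l z0); rewrite mulrA -expr2; lra.
rewrite normrM (ger0_norm (ex0 x)) ger0_norm; last by lra.
rewrite (_ : _ * E ^+ 2 * y ^+ 2 = E * (((1 + lambda + lambda ^+ 2) * y ^+ 2) * E)); last by ring.
apply: ler_pM => //; first lra.
  exact: eE.
rewrite (le_trans e3)// ler_pM ?sqr_ge0 ?expR_ge0//; last exact: eE.
by rewrite /z exprMn ler_wpM2r ?sqr_ge0//; lra.
Qed.

(** Mean value inequality, from the remainder bound alone: cut the interval into [n]
    pieces and let [n] tend to infinity. *)
Lemma expands_increment_le t a f f' (e : R) : 0 <= a -> a <= t -> expands t f f' ->
  (forall x, a <= x <= t -> f' x <= e) -> f t <= f a + (t - a) * e.
Proof.
move=> a0 at0 [C HC] He; have d0 : 0 <= t - a by rewrite subr_ge0.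
have step n : f t <= f a + (t - a) * e + C * (t - a) ^+ 2 * n.+1%:R^-1.
  pose y := (t - a) / n.+1%:R.
  have n0 : (0 : R) < n.+1%:R by rewrite ltr0n.
  have y0 : 0 <= y by rewrite divr_ge0// ltW.
  have ty : n.+1%:R * y = t - a by rewrite /y mulrC divfK// lt0r_neq0.
  have H k : (k <= n.+1)%N -> f (a + k%:R * y) <= f a + k%:R * y * e + k%:R * (C * y ^+ 2).
    elim: k => [|k ih] kn; first by rewrite !mul0r !addr0.
    have ky0 : 0 <= k%:R * y by rewrite mulr_ge0.
    have kyt : k%:R * y + y <= t - a.
      have -> : k%:R * y + y = k.+1%:R * y by rewrite -natr1; ring.
      by rewrite -ty ler_wpM2r// ler_nat.
    have aky : 0 <= a + k%:R * y by rewrite addr_ge0.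
    have akyt : a + k%:R * y + y <= t by lra.
    have [_ _ h3] := HC _ _ aky y0 akyt.
    have {}ih := ih (ltnW kn).
    have fe : f' (a + k%:R * y) <= e by apply: He; apply/andP; split; lra.
    have fey := ler_wpM2l y0 fe.
    have -> : a + k.+1%:R * y = a + k%:R * y + y by rewrite -natr1; ring.
    rewrite -[k.+1%:R]natr1.
    by move: h3; rewrite ler_norml => /andP[_ h3]; lra.
  have := H _ (leqnn _); rewrite ty addrC subrK => /le_trans; apply.
  rewrite lerD2l (_ : _ * (C * y ^+ 2) = C * (t - a) * y); last by rewrite -ty; ring.
  by rewrite /y expr2 !mulrA.
have lim0 : f a + (t - a) * e + C * (t - a) ^+ 2 * n.+1%:R^-1 @[n --> \oo] -->
    f a + (t - a) * e + C * (t - a) ^+ 2 * 0.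
  by apply: cvgD; [exact: cvg_cst|apply: cvgMr; exact: cvg_harmonic].
rewrite mulr0 addr0 in lim0.
rewrite -(cvg_lim _ lim0)//; apply: limr_ge; first exact: cvgP lim0.
by apply: nearW.
Qed.

End first_order_expansions.

(** * The explicit moments and their evolution equations *)

Section moment_functions.
Context {R : realType}.
Variable lambda : R.
Hypothesis lambda_gt0 : 0 < lambda.

Local Notation wallis := (@wallis R).

(** [lapse_moment b s] is the mean of [max 0 (s - E) ^ b] on the event
    [E < s], where [E] is exponential with parameter [lambda]. *)
Fixpoint lapse_moment (b : nat) (s : R) : R :=
  if b is b'.+1 then s ^+ b - b%:R / lambda * lapse_moment b' s
  else 1 - expR (- (lambda * s)).

Lemma expands_lapse_moment t b : expands t (lapse_moment b)
  (fun s => lambda * (s ^+ b - lapse_moment b s)).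
Proof.
have l0 := lt0r_neq0 lambda_gt0.
elim: b => [|b ih].
  apply: expands_eq (expandsD (expands_cst t 1) (expandsZ (-1)
    (expands_expRN t (ltW lambda_gt0)))) _ _ => x /=; ring.
apply: expands_eq (expandsD (expandsX b.+1 (expands_id t))
  (expandsZ (- (b.+1%:R / lambda)) ih)) _ _ => x /=; first by rewrite mulNr.
by field.
Qed.

(** The mean of [R ^ (2 k)] at time [s], where [R] is the Lorentz norm
    [sqrt (s ^ 2 - r ^ 2)] of the flight: [R] has the law of
    [max 0 (s - E)]. *)
Definition norm_moment (k : nat) (s : R) : R :=
  lapse_moment (2 * k) s + (k == 0)%N%:R * expR (- (lambda * s)).

Lemma norm_moment0 s : norm_moment 0 s = 1.
Proof. by rewrite /norm_moment /= mul1r subrK. Qed.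

Lemma norm_moment_at0 k : norm_moment k 0 = (k == 0)%N%:R.
Proof.
have H b : lapse_moment b 0 = 0.
  elim: b => [|b ih]; first by rewrite /= mulr0 oppr0 expR0 subrr.
  by rewrite /= ih expr0n/= mulr0 subrr.
by rewrite /norm_moment H add0r mulr0 oppr0 expR0 mulr1.
Qed.

Lemma expands_norm_moment t k : expands t (norm_moment k)
  (fun s => lambda * (s ^+ (2 * k) - norm_moment k s)).
Proof.
apply: expands_eq (expandsD (expands_lapse_moment t (2 * k))
  (expandsZ ((k == 0)%N%:R) (expands_expRN t (ltW lambda_gt0)))) _ _ => // x.
by rewrite /norm_moment; ring.
Qed.

(** The mean of [r ^ (2 i)] where [r ^ 2 = s ^ 2 - R ^ 2], by the binomial
    formula. *)
Definition radius_moment (i : nat) (s : R) : R :=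
  \sum_(k < i.+1) 'C(i, k)%:R * (-1) ^+ k * (s ^+ (2 * (i - k)) * norm_moment k s).

Lemma radius_moment0 s : radius_moment 0 s = 1.
Proof.
by rewrite /radius_moment big_ord1/= bin0 norm_moment0 subnn muln0 !expr0 !mulr1.
Qed.

Lemma radius_moment_at0 i : radius_moment i.+1 0 = 0.
Proof.
rewrite /radius_moment big1// => k _; rewrite norm_moment_at0.
have [->|k0] := eqVneq (k : nat) 0%N; last by rewrite !mulr0.
by rewrite subn0 expr0n/= mul0r mulr0.
Qed.

Lemma alternating_binomial_sum n :
  \sum_(k < n.+2) 'C(n.+1, k)%:R * (-1) ^+ k = 0 :> R.
Proof.
transitivity ((1 - 1) ^+ n.+1 : R); last by rewrite subrr expr0n.
rewrite exprBn.
by apply: eq_bigr => k _; rewrite !expr1n !mulr1 mulr_natl.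
Qed.

Lemma expands_radius_moment t i : expands t (radius_moment i.+1)
  (fun s => 2 * i.+1%:R * s * radius_moment i s - lambda * radius_moment i.+1 s).
Proof.
have H (k : nat) : (k < i.+2)%N -> expands t
    (fun s => 'C(i.+1, k)%:R * (-1) ^+ k * (s ^+ (2 * (i.+1 - k)) * norm_moment k s))
    (fun s => 'C(i.+1, k)%:R * (-1) ^+ k *
      (((2 * (i.+1 - k))%N%:R * s ^+ (2 * (i.+1 - k)).-1 * 1) * norm_moment k s +
       s ^+ (2 * (i.+1 - k)) * (lambda * (s ^+ (2 * k) - norm_moment k s)))).
  move=> _; apply: expandsZ; apply: expandsM; last exact: expands_norm_moment.
  exact: expandsX (expands_id t).
apply: expands_eq (expands_sum H) _ _ => // x.
transitivity (\sum_(k < i.+2) ('C(i.+1, k)%:R * (-1) ^+ k *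
    ((2 * (i.+1 - k))%N%:R * x ^+ (2 * (i.+1 - k)).-1 * norm_moment k x)) +
  lambda * x ^+ (2 * i.+1) * (\sum_(k < i.+2) 'C(i.+1, k)%:R * (-1) ^+ k) -
  lambda * radius_moment i.+1 x).
  rewrite /radius_moment !mulr_sumr -big_split/= -sumrB.
  apply: eq_bigr => k _.
  have -> : x ^+ (2 * i.+1) = x ^+ (2 * (i.+1 - k)) * x ^+ (2 * k).
    by rewrite -exprD -mulnDr subnK// -ltnS.
  by ring.
rewrite alternating_binomial_sum mulr0 addr0; congr (_ - _).
rewrite big_ord_recr/= subnn muln0 !mul0r mulr0 addr0 /radius_moment mulr_sumr.
apply: eq_bigr => k _.
have ki : (k <= i)%N by rewrite -ltnS.
rewrite subSn// mulnS /= exprS.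
have := congr1 (fun n => n%:R : R) (mul_bin_down i.+1 k).
rewrite /= subSn// !natrM => E.
rewrite natrD natrM.
transitivity (2 * ((i - k).+1%:R * 'C(i.+1, k)%:R) * (-1) ^+ k *
   (x * x ^+ (2 * (i - k)) * norm_moment k x)).
  by rewrite -[(i - k).+1%:R]natr1; ring.
by rewrite -E; ring.
Qed.

(** The mean of [r ^ (2 i) * (Z . V) ^ j] for displacement [Z] and heading [V]. The
    formula is justified by [expands_cross_moment]. *)
Fixpoint cross_moment (i j : nat) (s : R) : R :=
  if j is j'.+1 then
    s * cross_moment i j' s -
    wallis j' * lambda / (2 * i + j' + 2)%N%:R * radius_moment (i + j'./2).+1 s
  else radius_moment i s.

Lemma cross_momentS i j s : cross_moment i j.+1 s = s * cross_moment i j s -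
  wallis j * lambda / (2 * i + j + 2)%N%:R * radius_moment (i + j./2).+1 s.
Proof. by []. Qed.

(** The evolution equations of the cross moments: [r ^ 2] grows at rate
    [2 Z . V], [Z . V] at rate one, and at rate [lambda] the heading is
    replaced by a uniform one, which turns [(Z . V) ^ j] into its mean
    [wallis j * r ^ j], zero for odd [j]. *)
Lemma expands_cross_moment t i j : expands t (cross_moment i j)
  (fun s => (2 * i)%N%:R * cross_moment i.-1 j.+1 s
    + j%:R * cross_moment i j.-1 s
    + lambda * (wallis j * radius_moment (i + j./2) s - cross_moment i j s)).
Proof.
elim: j i => [|j ih] i.
  case: i => [|i].
    apply: expands_eq (expands_cst t 1) _ _ => x.
      by rewrite /= radius_moment0.
    by rewrite /= radius_moment0 muln0; ring.
  apply: expands_eq (expands_radius_moment t i) _ _ => // x.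
  rewrite cross_momentS [i.+1.-1]/= /= !addn0.
  have -> : (2 * i + 2 = 2 * i.+1)%N by lia.
  have -> : 2 * i.+1%:R = (2 * i.+1)%N%:R :> R by rewrite natrM.
  have : (2 * i.+1)%N%:R != 0 :> R by rewrite pnatr_eq0.
  by move: (_%:R) => n n0; field.
set D : R := (2 * i + j + 1)%N%:R.
have D0 : D != 0 by rewrite pnatr_eq0 addn1.
have F1 s : (2 * i)%N%:R * cross_moment i.-1 j.+2 s =
    (2 * i)%N%:R * (s * cross_moment i.-1 j.+1 s) -
    (2 * i)%N%:R * (wallis j.+1 * lambda / D * radius_moment (i + j.+1./2) s).
  case: i @D D0 {ih} => [|i] D D0; first by rewrite muln0 !mul0r subr0.
  rewrite cross_momentS mulrBr; congr (_ - _ * (_ / _%:R * _)).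
  by lia.
have F2 s : j%:R * (s * cross_moment i j.-1 s) = j%:R * cross_moment i j s +
    j.+1%:R * (wallis j.+1 * lambda / D * radius_moment (i + j.+1./2) s).
  case: j @D D0 {F1 ih} => [|j] D D0; first by rewrite /= !mul0r add0r mulr0.
  rewrite cross_momentS [j.+1.-1]/= mulrBr.
  have -> : (2 * i + j + 2 = 2 * i + j.+1 + 1)%N by lia.
  have -> : (i + j./2).+1 = (i + j.+2./2)%N by rewrite /= addnS.
  have W := @wallisSS R j.
  rewrite -/D; set f := radius_moment _ s; set v := wallis j.+2 in W *.
  have -> : j.+2%:R * (v * lambda / D * f) = j.+2%:R * v * (lambda / D * f) by ring.
  by rewrite W; ring.
have K s : wallis j * lambda / (2 * i + j + 2)%N%:R *
   (2 * (i + j./2).+1%:R * s * radius_moment (i + j./2) s) =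
   wallis j * lambda * s * radius_moment (i + j./2) s.
  have [oj|ej] := boolP (odd j); first by rewrite wallis_odd// !mul0r.
  have -> : (2 * i + j + 2)%N%:R = 2 * (i + j./2).+1%:R :> R.
    by rewrite -natrM; congr (_%:R); rewrite -[in LHS](even_halfK ej); lia.
  have n0 : (i + j./2).+1%:R != 0 :> R by rewrite pnatr_eq0.
  by move: n0; move: (_.+1%:R) => n n0; field.
apply: expands_eq (expandsD (expandsM (expands_id t) (ih i))
  (expandsZ (- (wallis j * lambda / (2 * i + j + 2)%N%:R))
  (expands_radius_moment t (i + j./2)))) _ _ => s.
  by rewrite cross_momentS mulNr.
rewrite F1 [j.+1.-1]/= [in RHS](cross_momentS i j).
have := K s; have := F2 s.
set C1 := cross_moment i.-1 j.+1 s; set C2 := cross_moment i j.-1 s.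
set C3 := cross_moment i j s; set f1 := radius_moment (i + j./2) s.
set f2 := radius_moment (i + j./2).+1 s; set f3 := radius_moment (i + j.+1./2) s.
set k := wallis j * lambda / _; set v := wallis j.+1.
move=> F2s Ks; rewrite /=.
have Ks' : - k * (2 * (i + j./2).+1%:R * s * f1 - lambda * f2) =
    - (wallis j * lambda * s * f1) + k * lambda * f2 by rewrite -Ks; ring.
rewrite Ks' mul1r.
have -> : s * ((2 * i)%N%:R * C1 + j%:R * C2 + lambda * (wallis j * f1 - C3)) =
   (2 * i)%N%:R * (s * C1) + j%:R * (s * C2) + s * (lambda * (wallis j * f1 - C3)).
  by ring.
rewrite F2s.
have DE : D = (2 * i)%N%:R + j.+1%:R by rewrite /D -natrD; congr (_%:R); lia.
have -> : lambda * (v * f3 - (s * C3 - k * f2)) =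
  D * (v * lambda / D * f3) - lambda * (s * C3 - k * f2) by field.
by set x := v * lambda / D * f3; rewrite DE -[j.+1%:R]natr1; ring.
Qed.

Lemma cross_moment_at0 i j : (0 < i + j)%N -> cross_moment i j 0 = 0.
Proof.
case: j => [|j]; first by rewrite addn0; case: i => // i _; exact: radius_moment_at0.
by rewrite cross_momentS mul0r radius_moment_at0 mulr0 subrr.
Qed.

End moment_functions.

(** * Stability of the Euler scheme *)

Section scheme_stability.
Context {R : realType}.
Local Notation wallis := (@wallis R).

Lemma wallis_itv n : 0 <= wallis n <= 1.
Proof.
elim/ltn_ind: n => -[|[|n]] ih; rewrite /= ?ler01 ?lexx//.
have /andP[w0 w1] := ih n (ltnW (ltnSn _)).
rewrite mulr_ge0 ?divr_ge0//= mulr_ile1 ?divr_ge0//.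
by rewrite ler_pdivrMr ?ltr0n// mul1r ler_nat.
Qed.

(** The linear recursion satisfied, up to quadratic errors, both by the moments
    of the discretised flight and by the sampled cross moments. For [i = 0] the
    coefficient [2 * i] silences the meaningless index [i.-1], and likewise for
    [j]. *)
Definition scheme_step (h q : R) (delta : nat -> nat -> nat -> R) i j l : R :=
  q * delta i j l + (1 - q) * (wallis j * delta (i + j./2)%N 0%N l) +
  h * ((2 * i)%N%:R * delta i.-1 j.+1 l + j%:R * delta i j.-1 l).

Definition scheme_error lambda t (K : nat -> nat -> R) i j (C : R) : Prop :=
  forall (delta : nat -> nat -> nat -> R) h q m, 0 < h -> m%:R * h <= t ->
    0 <= q -> q <= 1 -> 1 - q <= lambda * h ->
    (forall i j, delta i j 0%N = 0) ->
    (forall i j l, (l < m)%N ->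
      `|delta i j l.+1 - scheme_step h q delta i j l| <= K i j * h ^+ 2) ->
    forall l, (l <= m)%N -> `|delta i j l| <= C * h.

Lemma sum_local_errors (u : nat -> R) (D h t : R) m : 0 < h -> m%:R * h <= t ->
  0 <= D -> u 0%N = 0 ->
  (forall l, (l < m)%N -> `|u l.+1| <= `|u l| + D * h ^+ 2) ->
  forall l, (l <= m)%N -> `|u l| <= D * t * h.
Proof.
move=> h0 mt D0 u0 H l lm.
have {}H k : (k <= m)%N -> `|u k| <= k%:R * (D * h ^+ 2).
  elim: k => [|k ih] km; first by rewrite u0 normr0 mul0r.
  by rewrite (le_trans (H _ km))// -natr1 mulrDl mul1r lerD2r ih// ltnW.
rewrite (le_trans (H _ lm))//.
have -> : l%:R * (D * h ^+ 2) = D * (l%:R * h) * h by ring.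
rewrite ler_wpM2r ?(ltW h0)// ler_wpM2l// (le_trans _ mt)//.
by rewrite ler_wpM2r ?(ltW h0)// ler_nat.
Qed.

(** The recursion refers to moments of the same or lower weight [2 i + j] only. It
    is solved by induction on the weight, and within a weight from [j = 0], where the
    terms with [q] add up to the identity, to the other [j]. *)
Lemma scheme_stable lambda t (K : nat -> nat -> R) :
  0 <= lambda -> 0 <= t -> (forall i j, 0 <= K i j) ->
  forall i j, exists2 C, 0 <= C & scheme_error lambda t K i j C.
Proof.
move=> l0 t0 K0.
suff H w : forall i j, (2 * i + j <= w)%N ->
    exists2 C, 0 <= C & scheme_error lambda t K i j C.
  by move=> i j; exact: (H (2 * i + j)%N).
elim: w => [|w ih] => [i j|].
  rewrite leqn0 addn_eq0 muln_eq0/= => /andP[/eqP -> /eqP ->].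
  exists (K 0%N 0%N * t); first exact: mulr_ge0.
  move=> delta h q m h0 mt q0 q1 ql d0 dS.
  apply: (sum_local_errors h0 (mt)) => // l lm.
  have := dS 0%N 0%N l lm.
  rewrite /scheme_step muln0 !mul0r addr0 mulr0 addr0 addn0 mul1r.
  rewrite (_ : q * _ + _ = delta 0%N 0%N l); last by ring.
  move=> H; rewrite -[X in `|X|](subrK (delta 0%N 0%N l)).
  by rewrite (le_trans (ler_normD _ _))// addrC lerD2l.
have base i : (2 * i <= w.+1)%N ->
    exists2 C, 0 <= C & scheme_error lambda t K i 0 C.
  case: i => [|i] iw; first exact: ih.
  have [C1 C10 H1] : exists2 C, 0 <= C & scheme_error lambda t K i 1 C.
    by apply: ih; lia.
  exists ((K i.+1 0%N + (2 * i.+1)%N%:R * C1) * t).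
    by rewrite mulr_ge0// addr_ge0// mulr_ge0.
  move=> delta h q m h0 mt q0 q1 ql d0 dS.
  apply: (sum_local_errors h0 (mt)) => //.
    by rewrite addr_ge0// mulr_ge0.
  move=> l lm; have := dS i.+1 0%N l lm.
  have e1 := H1 delta h q m h0 mt q0 q1 ql d0 dS l (ltnW lm).
  rewrite /scheme_step mul0r addr0 addn0 mul1r.
  rewrite (_ : q * _ + _ + _ = delta i.+1 0%N l +
    h * ((2 * i.+1)%N%:R * delta i 1%N l)); last by rewrite /=; ring.
  move=> H; rewrite -[X in `|X|](subrK (delta i.+1 0%N l +
    h * ((2 * i.+1)%N%:R * delta i 1%N l))).
  rewrite (le_trans (ler_normD _ _))// mulrDl addrCA lerD//.
  rewrite (le_trans (ler_normD _ _))// lerD2l !normrM (ger0_norm (ltW h0)).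
  rewrite normr_nat expr2 mulrCA -!mulrA ler_wpM2l// mulrCA ler_wpM2l ?(ltW h0)//.
move=> i j ijw.
case: j ijw => [|j] ijw; first by apply: base; rewrite addn0 in ijw.
have [Cn Cn0 Hn] : exists2 C, 0 <= C & scheme_error lambda t K (i + j.+1./2) 0 C.
  by apply: base; have := odd_double_half j.+1; lia.
have [C2 C20 H2] : exists2 C, 0 <= C & scheme_error lambda t K i j C.
  by apply: ih; lia.
have [C1 C10 H1] : exists2 C, 0 <= C & forall delta h q m, 0 < h -> m%:R * h <= t ->
    0 <= q -> q <= 1 -> 1 - q <= lambda * h ->
    (forall i j, delta i j 0%N = 0) ->
    (forall i j l, (l < m)%N ->
      `|delta i j l.+1 - scheme_step h q delta i j l| <= K i j * h ^+ 2) ->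
    forall l, (l <= m)%N -> (2 * i)%N%:R * `|delta i.-1 j.+2 l| <= C * h.
  case: i ijw {Hn H2} => [|i] ijw.
    by exists 0 => // delta h q m *; rewrite mul0r mul0r.
  have [C C0 H] : exists2 C, 0 <= C & scheme_error lambda t K i j.+2 C.
    by apply: ih; lia.
  exists ((2 * i.+1)%N%:R * C); first exact: mulr_ge0.
  move=> delta h q m h0 mt q0 q1 ql d0 dS l lm; rewrite -mulrA ler_wpM2l//.
  exact: (H delta h q m h0 mt q0 q1 ql d0 dS l lm).
exists ((lambda * Cn + C1 + j.+1%:R * C2 + K i j.+1) * t).
  by rewrite mulr_ge0// !addr_ge0// mulr_ge0.
move=> delta h q m h0 mt q0 q1 ql d0 dS.
apply: (sum_local_errors h0 (mt)) => //.
  by rewrite !addr_ge0// mulr_ge0.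
move=> l lm; have := dS i j.+1 l lm.
have e1 := H1 delta h q m h0 mt q0 q1 ql d0 dS l (ltnW lm).
have e2 := H2 delta h q m h0 mt q0 q1 ql d0 dS l (ltnW lm).
have en := Hn delta h q m h0 mt q0 q1 ql d0 dS l (ltnW lm).
move=> H; rewrite -[X in `|X|](subrK (scheme_step h q delta i j.+1 l)).
rewrite (le_trans (ler_normD _ _))//.
have B1 : `|q * delta i j.+1 l| <= `|delta i j.+1 l|.
  by rewrite normrM (ger0_norm q0) ler_piMl.
have B2 : `|(1 - q) * (wallis j.+1 * delta (i + j.+1./2)%N 0%N l)| <=
    lambda * Cn * h ^+ 2.
  rewrite normrM ger0_norm ?subr_ge0//.
  have -> : lambda * Cn * h ^+ 2 = lambda * h * (1 * (Cn * h)) by ring.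
  rewrite ler_pM ?subr_ge0// normrM ler_pM//.
  by have /andP[w0 w1] := wallis_itv j.+1; rewrite ger0_norm.
have B3 : `|h * ((2 * i)%N%:R * delta i.-1 j.+2 l + j.+1%:R * delta i j l)| <=
    (C1 + j.+1%:R * C2) * h ^+ 2.
  rewrite normrM (ger0_norm (ltW h0)).
  have -> : (C1 + j.+1%:R * C2) * h ^+ 2 = h * (C1 * h + j.+1%:R * (C2 * h)) by ring.
  rewrite ler_wpM2l ?(ltW h0)// (le_trans (ler_normD _ _))// !normrM !normr_nat.
  by rewrite lerD// ler_wpM2l.
have B : `|scheme_step h q delta i j.+1 l| <= `|delta i j.+1 l| +
    lambda * Cn * h ^+ 2 + (C1 + j.+1%:R * C2) * h ^+ 2.
  rewrite /scheme_step (le_trans (ler_normD _ _))// lerD//.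
  by rewrite (le_trans (ler_normD _ _))// lerD.
by lra.
Qed.

(** Unlike the class [expands], this is uniform in [x] and [y] separately, as needed
    for the random position and its random velocity. *)
Lemma power_first_order n (B : R) : 0 <= B -> exists2 C, 0 <= C &
  forall x y h, `|x| <= B -> `|y| <= B -> 0 <= h -> h <= B ->
    `|(x + h * y) ^+ n - x ^+ n - h * (n%:R * x ^+ n.-1 * y)| <= C * h ^+ 2.
Proof.
move=> B0; elim: n => [|n [C C0 ih]].
  exists 0 => // x y h _ _ _ _.
  by rewrite !mul0r mulr0 subr0 subrr normr0.
exists (n%:R * B ^+ n.-1 * B ^+ 2 + (B + B * B) * C).
  by rewrite addr_ge0// ?mulr_ge0 ?exprn_ge0 ?addr_ge0 ?mulr_ge0.
move=> x y h xB yB h0 hB; have := ih x y h xB yB h0 hB.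
set E := _ - _ - _ => HE.
rewrite (_ : _ - _ - _ = n%:R * x ^+ n.-1 * y ^+ 2 * h ^+ 2 + (x + h * y) * E); last first.
  rewrite /E -[n.+1%:R]natr1 !exprS [n.+1.-1]/=.
  case: n {ih E HE} => [|n]; first by rewrite /= !expr0; ring.
  by rewrite [n.+1.-1]/= !exprS; ring.
rewrite (le_trans (ler_normD _ _))// [leRHS]mulrDl lerD//.
  rewrite !normrM !normrX normr_nat (ger0_norm h0).
  apply: ler_wpM2r; first exact: sqr_ge0.
  apply: ler_pM; rewrite ?mulr_ge0 ?exprn_ge0//.
    by rewrite ler_wpM2l// lerXn2r// nnegrE.
  exact: ler_pM.
rewrite normrM -mulrA ler_pM// (le_trans (ler_normD _ _))// lerD//.
by rewrite normrM (ger0_norm h0) ler_pM.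
Qed.

End scheme_stability.

(** * Functions of the past of the heading chain *)

Section adapted_functions.
Context {d} {T : measurableType d} {R : realType} (P : probability T R).
Variables (lambda : R) (N : R -> {RV P >-> nat}) (s : nat -> T -> R).
Variable theta : nat -> {RV P >-> R}.
Hypothesis poissonN : poisson_process lambda N s.
Hypothesis directions : iid_uniform_directions theta.
Hypothesis indep : independent_systems P
  (sigma_generated [set t : R | 0 <= t] (fun t => N t : T -> nat))
  (sigma_generated [set: nat] (fun j => theta j : T -> R)).
Hypothesis lambda_gt0 : 0 < lambda.
Variable h : R.
Hypothesis h_gt0 : 0 < h.

Local Notation q := (expR (- (lambda * h))).
Local Notation heading := (heading N theta h).
Local Notation heading_prod := (heading_prod N theta h).

(** Functions for which the chain of headings is Markov at grid time [l]; the
    test products are there to make the class stable under multiplication by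
    functions of earlier headings. *)
Definition past l (F : T -> R) : Prop :=
  bounded_measurable F /\
  forall psi phi, (forall i, bounded_measurable (psi i)) ->
    bounded_measurable phi ->
    \int[P]_w (F w * heading_prod psi l w * phi (heading l.+1 w)) =
    q * \int[P]_w (F w * heading_prod psi l w * phi (heading l w)) +
    (1 - q) * direction_mean phi * \int[P]_w (F w * heading_prod psi l w).

(** Closing [past] under multiplication in this way gives a class stable under
    products, hence containing all polynomials in earlier headings. *)
Definition adapted l (G : T -> R) : Prop :=
  forall F, past l F -> past l (fun w => F w * G w).

Lemma eq_past l F G : past l F -> F =1 G -> past l G.
Proof. by move=> + /funext <-. Qed.

Lemma past1 l : past l (fun=> 1).
Proof.
split; first exact: bounded_measurable_cst.
move=> psi phi bpsi bphi.
have := expect_next_heading poissonN directions indep lambda_gt0 h_gt0 l bpsi bphi.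
by congr (_ = _ * _ + _ * _); apply: eq_expect => w; rewrite mul1r.
Qed.

Lemma pastD l F G : past l F -> past l G -> past l (fun w => F w + G w).
Proof.
move=> [bF HF] [bG HG]; split; first exact: bounded_measurableD.
move=> psi phi bpsi bphi.
have bh k : bounded_measurable (fun w => phi (heading k w)).
  exact: bounded_heading.
have bp := bounded_heading_prod N theta h l bpsi.
have D g : bounded_measurable g ->
    \int[P]_w ((F w + G w) * g w) = \int[P]_w (F w * g w) + \int[P]_w (G w * g w).
  move=> bg; rewrite -expectD; [|exact: bounded_measurableM..].
  by apply: eq_expect => w; rewrite mulrDl.
under eq_expect do rewrite -mulrA.
rewrite D; last exact: bounded_measurableM.
under [X in q * X]eq_expect do rewrite -mulrA.
rewrite D; last exact: bounded_measurableM.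
rewrite D//.
have := HF _ _ bpsi bphi; have := HG _ _ bpsi bphi.
under eq_expect do rewrite -mulrA.
under [X in q * X]eq_expect do rewrite -mulrA.
move=> ->.
under eq_expect do rewrite -mulrA.
under [X in q * X]eq_expect do rewrite -mulrA.
by move=> ->; ring.
Qed.

Lemma pastZ l c F : past l F -> past l (fun w => c * F w).
Proof.
move=> [bF HF]; split; first exact: bounded_measurableZ.
move=> psi phi bpsi bphi.
have bh k : bounded_measurable (fun w => phi (heading k w)).
  exact: bounded_heading.
have bp := bounded_heading_prod N theta h l bpsi.
have bFp := bounded_measurableM bF bp.
have E g : \int[P]_w (c * F w * g w) = \int[P]_w (c * (F w * g w)).
  by apply: eq_expect => w; rewrite mulrA.
have E2 g g' : \int[P]_w (c * F w * g w * g' w) = \int[P]_w (c * (F w * g w * g' w)).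
  by apply: eq_expect => w; rewrite !mulrA.
rewrite !E2 E !expectZ ?HF//; first ring.
all: exact: bounded_measurableM.
Qed.

Lemma adapted_past l G : adapted l G -> past l G.
Proof. by move=> H; apply: eq_past (H _ (past1 l)) _ => w; rewrite mul1r. Qed.

Lemma eq_adapted l F G : adapted l F -> F =1 G -> adapted l G.
Proof. by move=> + /funext <-. Qed.

Lemma adapted_cst l c : adapted l (fun=> c).
Proof.
by move=> F pF; apply: eq_past (pastZ c pF) _ => w; rewrite mulrC.
Qed.

Lemma adaptedD l F G : adapted l F -> adapted l G ->
  adapted l (fun w => F w + G w).
Proof.
move=> HF HG E pE; apply: eq_past (pastD (HF _ pE) (HG _ pE)) _ => w.
by rewrite mulrDr.
Qed.

Lemma adaptedM l F G : adapted l F -> adapted l G ->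
  adapted l (fun w => F w * G w).
Proof.
by move=> HF HG E pE; apply: eq_past (HG _ (HF _ pE)) _ => w; rewrite mulrA.
Qed.

Lemma adaptedX l n F : adapted l F -> adapted l (fun w => F w ^+ n).
Proof.
move=> HF; elim: n => [|n ih]; first exact: adapted_cst.
by apply: eq_adapted (adaptedM HF ih) _ => w; rewrite exprS.
Qed.

Lemma adapted_sum l n (F : nat -> T -> R) :
  (forall i, (i < n)%N -> adapted l (F i)) ->
  adapted l (fun w => \sum_(i < n) F i w).
Proof.
elim: n => [|n ih] H.
  by apply: eq_adapted (@adapted_cst l 0) _ => w; rewrite big_ord0.
have Hn : adapted l (fun w => \sum_(i < n) F i w).
  by apply: ih => i ilt; apply: H; rewrite ltnS ltnW.
by apply: eq_adapted (adaptedD Hn (H n (leqnn _))) _ => w; rewrite big_ord_recr.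
Qed.

Lemma adapted_heading l i phi : (i <= l)%N -> bounded_measurable phi ->
  adapted l (fun w => phi (heading i w)).
Proof.
move=> il bphi F [bF HF]; split.
  apply: bounded_measurableM => //; exact: bounded_heading.
move=> psi phi' bpsi bphi'.
pose psi' j x := if j == i then psi j x * phi x else psi j x.
have bpsi' j : bounded_measurable (psi' j).
  rewrite /psi'; have [->|ji] := eqVneq j i; last exact: bpsi.
  exact: (bounded_measurableM (bpsi i) bphi).
have E w : F w * phi (heading i w) * heading_prod psi l w = F w * heading_prod psi' l w.
  by rewrite -mulrA [phi _ * _]mulrC heading_prodM.
rewrite (eq_expect P E).
have E1 k : \int[P]_w (F w * phi (heading i w) * heading_prod psi l w * phi' (heading k w))
    = \int[P]_w (F w * heading_prod psi' l w * phi' (heading k w)).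
  by apply: eq_expect => w; rewrite E.
by rewrite !E1 HF.
Qed.

(** The Markov property itself, with trivial test functions. *)
Lemma expect_past l F phi : past l F -> bounded_measurable phi ->
  \int[P]_w (F w * phi (heading l.+1 w)) =
  q * \int[P]_w (F w * phi (heading l w)) +
  (1 - q) * direction_mean phi * \int[P]_w F w.
Proof.
move=> [bF HF] bphi.
have := HF (fun _ _ => 1) phi (fun=> bounded_measurable_cst 1) bphi.
have E w : F w * heading_prod (fun _ _ => 1) l w = F w.
  by rewrite heading_prod1 mulr1.
rewrite (eq_expect P E) => H.
have E1 k : \int[P]_w (F w * phi (heading k w)) =
   \int[P]_w (F w * heading_prod (fun _ _ => 1) l w * phi (heading k w)).
  by apply: eq_expect => w; rewrite E.
by rewrite !E1.
Qed.

End adapted_functions.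

(** * The discretised flight and its moments *)

Section discretised_flight.
Context {d} {T : measurableType d} {R : realType} (P : probability T R).
Variables (lambda : R) (N : R -> {RV P >-> nat}) (s : nat -> T -> R).
Variable theta : nat -> {RV P >-> R}.
Hypothesis poissonN : poisson_process lambda N s.
Hypothesis directions : iid_uniform_directions theta.
Hypothesis indep : independent_systems P
  (sigma_generated [set t : R | 0 <= t] (fun t => N t : T -> nat))
  (sigma_generated [set: nat] (fun j => theta j : T -> R)).
Hypothesis lambda_gt0 : 0 < lambda.
Local Notation wallis := (@wallis R).

Section fixed_mesh.
Variable h : R.
Hypothesis h_gt0 : 0 < h.

Local Notation q := (expR (- (lambda * h))).
Local Notation heading := (heading N theta h).
Local Notation adapted := (adapted lambda N theta h).
Local Notation past := (past lambda N theta h).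

(** With [phi] a cosine or a sine, a coordinate of the displacement from grid time [M]
    that would result from freezing the heading during each mesh step. *)
Definition grid_sum (phi : R -> R) M l w : R :=
  h * \sum_(i < l) phi (heading (M + i)%N w).

Definition grid_radius2 M l w : R :=
  grid_sum cos M l w ^+ 2 + grid_sum sin M l w ^+ 2.

(** Scalar product of the position with the current heading. *)
Definition grid_radial M l w : R :=
  grid_sum cos M l w * cos (heading (M + l)%N w) +
  grid_sum sin M l w * sin (heading (M + l)%N w).

Lemma grid_sumS phi M l w : grid_sum phi M l.+1 w =
  grid_sum phi M l w + h * phi (heading (M + l)%N w).
Proof. by rewrite /grid_sum big_ord_recr/= mulrDr. Qed.

Lemma grid_radialS M l w :
  grid_sum cos M l.+1 w * cos (heading (M + l)%N w) +
  grid_sum sin M l.+1 w * sin (heading (M + l)%N w) = grid_radial M l w + h.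
Proof.
have := cos2Dsin2 (heading (M + l)%N w); rewrite !grid_sumS /grid_radial => E.
rewrite -[X in _ = _ + X]mulr1 -E; ring.
Qed.

Lemma grid_radius2S M l w : grid_radius2 M l.+1 w =
  grid_radius2 M l w + h * (2 * grid_radial M l w + h).
Proof.
have := cos2Dsin2 (heading (M + l)%N w).
rewrite /grid_radius2 /grid_radial !grid_sumS => E.
have -> : h * (2 * (grid_sum cos M l w * cos (heading (M + l)%N w) +
   grid_sum sin M l w * sin (heading (M + l)%N w)) + h) =
  2 * h * (grid_sum cos M l w * cos (heading (M + l)%N w) +
   grid_sum sin M l w * sin (heading (M + l)%N w)) + h ^+ 2 * 1 by ring.
by rewrite -[X in _ = _ + (_ + _ * X)]E; ring.
Qed.

Lemma grid_radial_sqr_le M l w : grid_radial M l w ^+ 2 <= grid_radius2 M l w.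
Proof.
set x := grid_sum cos M l w; set y := grid_sum sin M l w.
set c := cos (heading (M + l)%N w); set e := sin (heading (M + l)%N w).
have ce : c ^+ 2 + e ^+ 2 = 1 := cos2Dsin2 _.
rewrite /grid_radius2 -/x -/y.
have -> : x ^+ 2 + y ^+ 2 = (x ^+ 2 + y ^+ 2) * (c ^+ 2 + e ^+ 2) by rewrite ce mulr1.
have -> : (x ^+ 2 + y ^+ 2) * (c ^+ 2 + e ^+ 2) =
  grid_radial M l w ^+ 2 + (x * e - y * c) ^+ 2 by rewrite /grid_radial -/x -/y -/c -/e; ring.
by rewrite lerDl sqr_ge0.
Qed.

Lemma grid_bounds M l w : 0 <= grid_radius2 M l w <= (l%:R * h) ^+ 2 /\
  `|grid_radial M l w| <= l%:R * h.
Proof.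
have lh k : 0 <= k%:R * h by rewrite mulr_ge0// ltW.
have r0 : 0 <= grid_radius2 M l w by rewrite addr_ge0 ?sqr_ge0.
suff rl : grid_radius2 M l w <= (l%:R * h) ^+ 2.
  rewrite r0 rl; split=> //.
  rewrite -[leRHS]ger0_norm// -ler_sqr ?nnegrE// !real_normK ?num_real//.
  exact: le_trans (grid_radial_sqr_le M l w) rl.
elim: l {r0} => [|l ih].
  by rewrite /grid_radius2 /grid_sum !big_ord0 !mulr0 mul0r expr0n addr0.
rewrite grid_radius2S -[l.+1%:R]natr1.
have Ql : `|grid_radial M l w| <= l%:R * h.
  rewrite -[leRHS]ger0_norm// -ler_sqr ?nnegrE// !real_normK ?num_real//.
  exact: le_trans (grid_radial_sqr_le M l w) ih.
have Q' := le_trans (ler_norm _) Ql.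
have hQ := ler_wpM2l (ltW h_gt0) Q'.
have -> : ((l%:R + 1) * h) ^+ 2 = (l%:R * h) ^+ 2 + h * (2 * (l%:R * h) + h) by ring.
by rewrite lerD// ler_wpM2l ?(ltW h_gt0)// lerD2r ler_wpM2l.
Qed.

Lemma adapted_grid_sum phi M l k : bounded_measurable phi -> (l <= k.+1)%N ->
  adapted (M + k) (grid_sum phi M l).
Proof.
move=> bphi lk; apply: adaptedM; first exact: adapted_cst.
apply: (@adapted_sum _ _ _ _ _ _ _ _ _ _ (fun i w => phi (heading (M + i)%N w))).
move=> i il; apply: adapted_heading => //.
by rewrite leq_add2l -ltnS (leq_trans il).
Qed.

Lemma adapted_grid_radius2 M l k : (l <= k.+1)%N ->
  adapted (M + k) (grid_radius2 M l).
Proof.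
move=> lk; apply: adaptedD; apply: adaptedX; apply: adapted_grid_sum => //.
  exact: bounded_measurable_cos.
exact: bounded_measurable_sin.
Qed.

Lemma bounded_grid_sum phi M l : bounded_measurable phi ->
  bounded_measurable (grid_sum phi M l).
Proof.
move=> bphi; apply: bounded_measurableZ; apply: bounded_measurable_sum => i.
exact: bounded_heading.
Qed.

Lemma bounded_grid_radius2 M l : bounded_measurable (grid_radius2 M l).
Proof.
apply: bounded_measurableD; apply: bounded_measurableX; apply: bounded_grid_sum.
  exact: bounded_measurable_cos.
exact: bounded_measurable_sin.
Qed.

Lemma bounded_grid_radial M l : bounded_measurable (grid_radial M l).
Proof.
apply: bounded_measurableD; apply: bounded_measurableM.
- exact/bounded_grid_sum/bounded_measurable_cos.
- exact/bounded_heading/bounded_measurable_cos.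
- exact/bounded_grid_sum/bounded_measurable_sin.
- exact/bounded_heading/bounded_measurable_sin.
Qed.

(** Conditionally on the past, the next scalar product is unchanged with
    probability [q] and is otherwise averaged over a uniform direction. The second
    hypothesis lets the powers of the two coordinates, from the binomial formula, join
    the weight. *)
Lemma expect_radial_step (Psi : T -> R) M l j :
  past (M + l) Psi ->
  (forall k, past (M + l) (fun w => Psi w * (grid_sum cos M l.+1 w ^+ (j - k) *
     grid_sum sin M l.+1 w ^+ k))) ->
  \int[P]_w (Psi w * grid_radial M l.+1 w ^+ j) =
  q * \int[P]_w (Psi w * (grid_radial M l w + h) ^+ j) +
  (1 - q) * (wallis j * \int[P]_w (Psi w * grid_radius2 M l.+1 w ^+ j./2)).
Proof.
move=> pPsi pF.
pose F k w := Psi w * (grid_sum cos M l.+1 w ^+ (j - k) * grid_sum sin M l.+1 w ^+ k).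
pose phi k (t : R) := cos t ^+ (j - k) * sin t ^+ k.
have bphi k : bounded_measurable (phi k).
  apply: bounded_measurableM; apply: bounded_measurableX.
    exact: bounded_measurable_cos.
  exact: bounded_measurable_sin.
have bF k : bounded_measurable (F k) := (pF k).1.
have expand i w : Psi w * (grid_sum cos M l.+1 w * cos (heading i w) +
     grid_sum sin M l.+1 w * sin (heading i w)) ^+ j =
   \sum_(k < j.+1) 'C(j, k)%:R * (F k w * phi k (heading i w)).
  rewrite exprDn mulr_sumr; apply: eq_bigr => k _.
  by rewrite -mulr_natl /F /phi !exprMn; ring.
have bFphi i k : bounded_measurable (fun w => F k w * phi k (heading i w)).
  by apply: bounded_measurableM => //; exact: bounded_heading.
have Esum i : \int[P]_w (Psi w * (grid_sum cos M l.+1 w * cos (heading i w) +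
     grid_sum sin M l.+1 w * sin (heading i w)) ^+ j) =
   \sum_(k < j.+1) 'C(j, k)%:R * \int[P]_w (F k w * phi k (heading i w)).
  rewrite (eq_expect P (expand i)) expect_sum; last first.
    by move=> k; exact/bounded_measurableZ/bFphi.
  by apply: eq_bigr => k _; rewrite expectZ.
rewrite {1}/grid_radial Esum.
have -> : \int[P]_w (Psi w * (grid_radial M l w + h) ^+ j) =
    \sum_(k < j.+1) 'C(j, k)%:R * \int[P]_w (F k w * phi k (heading (M + l)%N w)).
  by rewrite -Esum; apply: eq_expect => w; rewrite grid_radialS.
have -> : wallis j * \int[P]_w (Psi w * grid_radius2 M l.+1 w ^+ j./2) =
    \sum_(k < j.+1) 'C(j, k)%:R * (direction_mean (phi k) * \int[P]_w F k w).
  rewrite -expectZ; last first.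
    apply: bounded_measurableM; first exact: pPsi.1.
    exact/bounded_measurableX/bounded_grid_radius2.
  transitivity (\int[P]_w (\sum_(k < j.+1) 'C(j, k)%:R * direction_mean (phi k) * F k w)).
    apply: eq_expect => w.
    rewrite mulrCA -(direction_mean_projection (grid_sum cos M l.+1 w)).
    rewrite (_ : (fun t => _) = (fun t => \sum_(k < j.+1) ('C(j, k)%:R *
       (grid_sum cos M l.+1 w ^+ (j - k) * grid_sum sin M l.+1 w ^+ k)) * phi k t)); last first.
      apply/funext => t; rewrite exprDn; apply: eq_bigr => k _.
      by rewrite -mulr_natl /phi !exprMn; ring.
    rewrite /direction_mean expect_sum; last first.
      by move=> k; apply: bounded_measurableZ; exact: bphi.
    rewrite mulr_sumr; apply: eq_bigr => k _; rewrite expectZ; last exact: bphi.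
    by rewrite /F; ring.
  rewrite expect_sum; last by move=> k; exact: bounded_measurableZ.
  by apply: eq_bigr => k _; rewrite expectZ// mulrA.
rewrite !mulr_sumr -big_split/=; apply: eq_bigr => k _.
rewrite addnS (expect_past (pF k) (bphi k)).
by ring.
Qed.

End fixed_mesh.
End discretised_flight.

Section local_errors.
Context {R : realType}.
Local Notation wallis := (@wallis R).

(** Consistency of the scheme: [1 - q] and [lambda * h] agree up to quadratic
    errors. *)
Lemma cross_moment_step (lambda t : R) i j : 0 < lambda ->
  exists2 K, 0 <= K & forall h l, 0 < h -> l.+1%:R * h <= t ->
    `|cross_moment lambda i j (l.+1%:R * h) -
      scheme_step h (expR (- (lambda * h)))
        (fun i j l => cross_moment lambda i j (l%:R * h)) i j l| <= K * h ^+ 2.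
Proof.
move=> l0.
have [C HC] := expands_cross_moment l0 t i j.
have [D HD] := expands_cross_moment l0 t (i + j./2) 0.
exists (`|C| + lambda ^+ 2 * (`|D| + `|C|)).
  by rewrite addr_ge0// mulr_ge0 ?sqr_ge0// addr_ge0.
move=> h l h0 lt; set x := l%:R * h.
have x0 : 0 <= x by rewrite mulr_ge0// ltW.
have xh : l.+1%:R * h = x + h by rewrite /x -natr1; ring.
have xht : x + h <= t by rewrite -xh.
have [c1 _ c3] := HC x h x0 (ltW h0) xht.
have [d1 _ _] := HD x h x0 (ltW h0) xht.
rewrite xh /scheme_step -/x.
set g' := _%:R * _ + _ + _ in c3.
set q := expR _.
set f := cross_moment lambda (i + j./2) 0 x in d1 *.
have /expRN_bounds/andP[q1 q2] : 0 <= lambda * h by rewrite mulr_ge0// ltW.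
rewrite -/q in q1 q2.
have -> : cross_moment lambda i j (x + h) - (q * cross_moment lambda i j x +
   (1 - q) * (wallis j * f) + h * ((2 * i)%N%:R * cross_moment lambda i.-1 j.+1 x +
   j%:R * cross_moment lambda i j.-1 x)) =
  (cross_moment lambda i j (x + h) - cross_moment lambda i j x - h * g') +
  (q - (1 - lambda * h)) * (wallis j * f - cross_moment lambda i j x).
  by rewrite /g' (_ : radius_moment _ _ _ = f)//; ring.
have CC := ler_norm C; have DD := ler_norm D.
have h2 := sqr_ge0 h.
rewrite (le_trans (ler_normD _ _))// [leRHS]mulrDl lerD//.
  by rewrite (le_trans c3)// ler_wpM2r.
rewrite normrM.
have -> : lambda ^+ 2 * (`|D| + `|C|) * h ^+ 2 = (lambda * h) ^+ 2 * (`|D| + `|C|) by ring.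
rewrite ler_pM//.
  by rewrite ger0_norm ?subr_ge0//; lra.
rewrite (le_trans (ler_normB _ _))// lerD//; last by rewrite (le_trans c1).
rewrite normrM; have /andP[w0 w1] := @wallis_itv R j; rewrite (ger0_norm w0).
by rewrite -[leRHS]mul1r ler_pM// (le_trans d1).
Qed.

(** Over a mesh step on which the heading stays, [r ^ 2] becomes
    [r ^ 2 + h * (2 * Q + h)] and the scalar product [Q] becomes [Q + h]. *)
Lemma radial_power_step (t : R) i j : 0 <= t -> exists2 C, 0 <= C &
  forall x Q h, 0 <= x -> x <= t ^+ 2 -> `|Q| <= t -> 0 <= h -> h <= t ->
   `|(x + h * (2 * Q + h)) ^+ i * (Q + h) ^+ j - (x ^+ i * Q ^+ j +
     h * ((2 * i)%N%:R * (x ^+ i.-1 * Q ^+ j.+1) + j%:R * (x ^+ i * Q ^+ j.-1)))|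
   <= C * h ^+ 2.
Proof.
move=> t0; pose B := t ^+ 2 + 3 * t + 1.
have t2 : 0 <= t ^+ 2 := sqr_ge0 t.
have B1 : 1 <= B by rewrite /B; lra.
have B0 : 0 <= B by lra.
have [C1 C10 H1] := power_first_order i B0.
have [C2 C20 H2] := power_first_order j B0.
have BX n : 0 <= B ^+ n by rewrite exprn_ge0.
exists (C1 * (B *+ 2) ^+ j + (B ^+ i + B * (i%:R * B ^+ i.-1 * B)) * C2 +
  (i%:R * B ^+ i.-1 * B) * (j%:R * B ^+ j.-1) + i%:R * B ^+ i.-1 * B ^+ j).
  by rewrite !addr_ge0// !mulr_ge0// ?addr_ge0 ?exprn_ge0 ?mulrn_wge0// !mulr_ge0.
move=> x Q h x0 xt Qt h0 ht.
have xB : `|x| <= B by rewrite ger0_norm// /B; lra.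
have QB : `|Q| <= B by rewrite /B; lra.
have yB : `|2 * Q + h| <= B.
  rewrite (le_trans (ler_normD _ _))// normrM (ger0_norm h0) ger0_norm// /B; lra.
have hB : h <= B by rewrite /B; lra.
have b1 := H1 _ _ _ xB yB h0 hB.
have b2 := H2 Q 1 h QB (_ : `|1| <= B) h0 hB.
rewrite normr1 in b2; have {}b2 := b2 B1.
rewrite !mulr1 in b2.
set X := (x + h * (2 * Q + h)) ^+ i in b1 *.
set Y := (Q + h) ^+ j in b2 *.
set E1 := X - _ - _ in b1; set E2 := Y - _ - _ in b2.
set A1 := i%:R * x ^+ i.-1 * (2 * Q + h) in E1 b1.
have A1B : `|A1| <= i%:R * B ^+ i.-1 * B.
  rewrite /A1 !normrM normr_nat normrX ler_pM// ?mulr_ge0 ?exprn_ge0//.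
  by rewrite ler_wpM2l// lerXn2r// nnegrE.
have xiB : `|x ^+ i| <= B ^+ i by rewrite normrX lerXn2r// nnegrE.
have xi1B : `|x ^+ i.-1| <= B ^+ i.-1 by rewrite normrX lerXn2r// nnegrE.
have QjB n : `|Q ^+ n| <= B ^+ n by rewrite normrX lerXn2r// nnegrE.
have YB : `|Y| <= (B *+ 2) ^+ j.
  rewrite /Y normrX lerXn2r ?nnegrE ?mulrn_wge0//.
  by rewrite (le_trans (ler_normD _ _))// mulr2n lerD// ger0_norm.
have -> : X * Y - (x ^+ i * Q ^+ j + h * ((2 * i)%N%:R * (x ^+ i.-1 * Q ^+ j.+1) +
    j%:R * (x ^+ i * Q ^+ j.-1))) =
  E1 * Y + (x ^+ i + h * A1) * E2 + h ^+ 2 * (A1 * (j%:R * Q ^+ j.-1)) +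
  h ^+ 2 * (i%:R * x ^+ i.-1 * Q ^+ j).
  by rewrite /E1 /E2 /A1 natrM exprS; ring.
have h2 : 0 <= h ^+ 2 := sqr_ge0 h.
clearbody E1 E2 A1 X Y.
rewrite (le_trans (ler_normD _ _))// [leRHS]mulrDl lerD//; last first.
  rewrite normrM (ger0_norm h2) mulrC ler_wpM2r// !normrM normr_nat.
  by rewrite ler_pM ?mulr_ge0// ler_wpM2l.
rewrite (le_trans (ler_normD _ _))// [leRHS]mulrDl lerD//; last first.
  rewrite normrM (ger0_norm h2) mulrC ler_wpM2r// normrM.
  rewrite ler_pM// normrM normr_nat ler_wpM2l//.
rewrite (le_trans (ler_normD _ _))// [leRHS]mulrDl lerD//.
  by rewrite normrM mulrAC ler_pM.
rewrite normrM -[leRHS]mulrA; apply: ler_pM => //.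
rewrite (le_trans (ler_normD _ _))// lerD//.
by rewrite normrM (ger0_norm h0) ler_pM.
Qed.

End local_errors.

Section grid_moments.
Context {d} {T : measurableType d} {R : realType} (P : probability T R).
Variables (lambda : R) (N : R -> {RV P >-> nat}) (s : nat -> T -> R).
Variable theta : nat -> {RV P >-> R}.
Hypothesis poissonN : poisson_process lambda N s.
Hypothesis directions : iid_uniform_directions theta.
Hypothesis indep : independent_systems P
  (sigma_generated [set t : R | 0 <= t] (fun t => N t : T -> nat))
  (sigma_generated [set: nat] (fun j => theta j : T -> R)).
Hypothesis lambda_gt0 : 0 < lambda.
Local Notation wallis := (@wallis R).
Local Notation q h := (expR (- (lambda * h))).
Local Notation radius2 := (grid_radius2 N theta).
Local Notation radial := (grid_radial N theta).

Definition weighted_moment (h : R) (Psi : T -> R) M i j l : R :=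
  \int[P]_w (Psi w * radius2 h M l w ^+ i * radial h M l w ^+ j).

Lemma bounded_moment h (Psi : T -> R) M i j l : bounded_measurable Psi ->
  bounded_measurable (fun w => Psi w * radius2 h M l w ^+ i * radial h M l w ^+ j).
Proof.
move=> bPsi; apply: bounded_measurableM; first apply: bounded_measurableM => //.
  exact/bounded_measurableX/bounded_grid_radius2.
exact/bounded_measurableX/bounded_grid_radial.
Qed.

(** The weight must be known at all mesh times of the step, in particular before it
    starts, so that it is untouched when the heading is redrawn. *)
Definition weight_ok (h : R) M m (Psi : T -> R) : Prop :=
  [/\ bounded_measurable Psi, forall w, `|Psi w| <= 1 &
      forall l, (l < m)%N -> adapted lambda N theta h (M + l) Psi].

(** By [expect_radial_step] for the weight [Psi * r ^ (2 i)], expanding its two terms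
    with [radial_power_step]. *)
Lemma weighted_moment_step t i j : 0 <= t -> exists2 K, 0 <= K &
  forall h M m Psi, 0 < h -> m%:R * h <= t -> weight_ok h M m Psi ->
  forall l, (l < m)%N ->
    `|weighted_moment h Psi M i j l.+1 -
      scheme_step h (q h) (weighted_moment h Psi M) i j l| <= K * h ^+ 2.
Proof.
move=> t0.
have t2 : 0 <= t ^+ 2 := sqr_ge0 t.
have [C1 C10 H1] := radial_power_step i j t0.
pose n := (i + j./2)%N.
have [C2 C20 H2] := radial_power_step n 0 t0.
pose D a b : R := (2 * a)%N%:R * ((t ^+ 2) ^+ a.-1 * t ^+ b.+1) + b%:R * ((t ^+ 2) ^+ a * t ^+ b.-1).
have D0 a b : 0 <= D a b by rewrite addr_ge0// mulr_ge0// mulr_ge0// exprn_ge0.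
exists (C1 + lambda * D i j + lambda * (D n 0%N + C2 * t)).
  by rewrite addr_ge0// ?addr_ge0// mulr_ge0 ?(ltW lambda_gt0)// addr_ge0// mulr_ge0.
move=> h M m Psi h0 mt [bPsi Psi1 aPsi] l lm.
set Q := radial h M l; set X := radius2 h M l.
have lh : l%:R * h <= t.
  by rewrite (le_trans _ mt)// ler_wpM2r ?(ltW h0)// ler_nat ltnW.
have lh0 : 0 <= l%:R * h by rewrite mulr_ge0// ltW.
have ht : h <= t.
  rewrite (le_trans _ mt)// ler_peMl ?(ltW h0)// ler1n.
  exact: leq_ltn_trans lm.
have bX w : 0 <= X w <= t ^+ 2.
  have [/andP[x0 x1] _] := grid_bounds N theta h0 M l w; rewrite x0/=.
  by rewrite (le_trans x1)// lerXn2r// nnegrE.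
have bQ w : `|Q w| <= t.
  by have [_ x1] := grid_bounds N theta h0 M l w; rewrite (le_trans x1).
pose G a b w := (2 * a)%N%:R * (X w ^+ a.-1 * Q w ^+ b.+1) +
  b%:R * (X w ^+ a * Q w ^+ b.-1).
have bmX : bounded_measurable X by exact: bounded_grid_radius2.
have bmQ : bounded_measurable Q by exact: bounded_grid_radial.
have bmG a b : bounded_measurable (G a b).
  by apply: bounded_measurableD; apply: bounded_measurableZ;
     apply: bounded_measurableM; exact: bounded_measurableX.
have GD a b w : `|G a b w| <= D a b.
  have /andP[x0 x1] := bX w.
  rewrite (le_trans (ler_normD _ _))// lerD// normrM normr_nat ler_wpM2l//;
    rewrite normrM !normrX (ger0_norm x0) ler_pM ?exprn_ge0//;
    rewrite lerXn2r ?nnegrE//.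
have EPsi (F : T -> R) B : bounded_measurable F -> (forall w, `|F w| <= B) ->
    `|\int[P]_w (Psi w * F w)| <= B.
  move=> bF FB; apply: expect_norm_le => [|w]; first exact: (bounded_measurableM bPsi bF).1.
  by rewrite normrM -[leRHS]mul1r ler_pM.
have EG a b : \int[P]_w (Psi w * G a b w) =
    (2 * a)%N%:R * weighted_moment h Psi M a.-1 b.+1 l +
    b%:R * weighted_moment h Psi M a b.-1 l.
  rewrite /weighted_moment -!expectZ; [|exact: bounded_moment..].
  rewrite -expectD; [|exact/bounded_measurableZ/bounded_moment..].
  by apply: eq_expect => w; rewrite /G /X /Q; ring.
have X'E w : radius2 h M l.+1 w = X w + h * (2 * Q w + h).
  exact: grid_radius2S.
have bmX' : bounded_measurable (radius2 h M l.+1) by exact: bounded_grid_radius2.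
have bmQh : bounded_measurable (fun w => Q w + h).
  by apply: bounded_measurableD => //; exact: bounded_measurable_cst.
have e1 a b C : (forall x Q h, 0 <= x -> x <= t ^+ 2 -> `|Q| <= t -> 0 <= h -> h <= t ->
   `|(x + h * (2 * Q + h)) ^+ a * (Q + h) ^+ b - (x ^+ a * Q ^+ b +
     h * ((2 * a)%N%:R * (x ^+ a.-1 * Q ^+ b.+1) + b%:R * (x ^+ a * Q ^+ b.-1)))|
   <= C * h ^+ 2) ->
   `|\int[P]_w (Psi w * (radius2 h M l.+1 w ^+ a * (Q w + h) ^+ b)) -
      (weighted_moment h Psi M a b l + h * \int[P]_w (Psi w * G a b w))| <= C * h ^+ 2.
  move=> H.
  have b1 : bounded_measurable (fun w => radius2 h M l.+1 w ^+ a * (Q w + h) ^+ b).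
    by apply: bounded_measurableM; exact: bounded_measurableX.
  have b2 : bounded_measurable (fun w => X w ^+ a * Q w ^+ b).
    by apply: bounded_measurableM; exact: bounded_measurableX.
  have b3 : bounded_measurable (fun w => h * G a b w) by exact: bounded_measurableZ.
  have -> : \int[P]_w (Psi w * (radius2 h M l.+1 w ^+ a * (Q w + h) ^+ b)) -
      (weighted_moment h Psi M a b l + h * \int[P]_w (Psi w * G a b w)) =
      \int[P]_w (Psi w * (radius2 h M l.+1 w ^+ a * (Q w + h) ^+ b -
        (X w ^+ a * Q w ^+ b + h * G a b w))).
    rewrite -expectZ; last exact: bounded_measurableM.
    rewrite -expectD; [|exact: bounded_moment|exact/bounded_measurableZ/bounded_measurableM].
    rewrite -expectB; [|exact: bounded_measurableM|].
      by apply: eq_expect => w; rewrite /X /Q; ring.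
    apply: bounded_measurableD; first exact: bounded_moment.
    exact/bounded_measurableZ/bounded_measurableM.
  apply: EPsi => [|w].
    by apply: bounded_measurableB => //; exact: bounded_measurableD.
  have /andP[x0 x1] := bX w.
  by rewrite X'E; apply: H => //; exact: ltW.
have E1 := e1 i j C1 H1.
have := e1 n 0%N C2 H2.
set A3 := \int[P]_w (Psi w * (radius2 h M l.+1 w ^+ n * (Q w + h) ^+ 0)) => E3.
have stepE : weighted_moment h Psi M i j l.+1 =
   q h * \int[P]_w (Psi w * (radius2 h M l.+1 w ^+ i * (Q w + h) ^+ j)) +
   (1 - q h) * (wallis j * A3).
  have aR : adapted lambda N theta h (M + l) (radius2 h M l.+1).
    exact: adapted_grid_radius2.
  have aPR := adaptedM (aPsi l lm) (adaptedX i aR).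
  rewrite /weighted_moment (@expect_radial_step _ _ _ P lambda N theta h
    (fun w => Psi w * radius2 h M l.+1 w ^+ i)).
  - congr (_ * _ + _ * (_ * _)); apply: eq_expect => w; first by rewrite mulrA.
    by rewrite -mulrA -exprD expr0 mulr1.
  - exact: (adapted_past poissonN directions indep lambda_gt0 h0 aPR).
  - move=> k; apply: (adapted_past poissonN directions indep lambda_gt0 h0).
    apply: adaptedM => //; apply: adaptedM; apply: adaptedX; apply: adapted_grid_sum => //.
      exact: bounded_measurable_cos.
    exact: bounded_measurable_sin.
rewrite stepE /scheme_step -EG -/n.
have /expRN_bounds/andP[q1 q2] : 0 <= lambda * h by rewrite mulr_ge0// ltW.
have qle1 : q h <= 1 by rewrite -expR0 ler_expR oppr_le0 mulr_ge0// ltW.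
have q0 : 0 <= q h := expR_ge0 _.
set Q0 := q h in q1 q2 qle1 q0 *.
set a0 := weighted_moment h Psi M i j l in E1 *.
set A1 := \int[P]_w _ in E1 *.
set an := weighted_moment h Psi M n 0%N l in E3 *.
have Dij : `|\int[P]_w (Psi w * G i j w)| <= D i j by exact: EPsi.
have Dn : `|\int[P]_w (Psi w * G n 0%N w)| <= D n 0%N by exact: EPsi.
set g := \int[P]_w (Psi w * G i j w) in E1 Dij *.
set gn := \int[P]_w (Psi w * G n 0%N w) in E3 Dn.
have A3n : `|A3 - an| <= (D n 0%N + C2 * t) * h.
  rewrite (_ : A3 - an = A3 - (an + h * gn) + h * gn); last by ring.
  rewrite (le_trans (ler_normD _ _))// mulrDl addrC lerD//.
    by rewrite normrM (ger0_norm (ltW h0)) mulrC ler_wpM2r// ltW.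
  rewrite (le_trans E3)// expr2 mulrA ler_wpM2r ?(ltW h0)// ler_wpM2l//.
have -> : Q0 * A1 + (1 - Q0) * (wallis j * A3) -
    (Q0 * a0 + (1 - Q0) * (wallis j * an) + h * g) =
  Q0 * (A1 - (a0 + h * g)) + (Q0 - 1) * (h * g) + (1 - Q0) * (wallis j * (A3 - an)).
  by ring.
have ql : 1 - Q0 <= lambda * h by lra.
rewrite (le_trans (ler_normD _ _))// [leRHS]mulrDl lerD//; last first.
  rewrite normrM ger0_norm ?subr_ge0//.
  have -> : lambda * (D n 0%N + C2 * t) * h ^+ 2 = (lambda * h) * ((D n 0%N + C2 * t) * h) by ring.
  apply: ler_pM => //; rewrite ?subr_ge0//.
  have /andP[w0 w1] := @wallis_itv R j.
  by rewrite normrM (ger0_norm w0) -[leRHS]mul1r ler_pM.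
rewrite (le_trans (ler_normD _ _))// [leRHS]mulrDl lerD//.
  by rewrite normrM (ger0_norm q0) -[leRHS]mul1r ler_pM.
have -> : lambda * D i j * h ^+ 2 = (lambda * h) * (h * D i j) by ring.
rewrite normrM distrC (@ger0_norm _ (1 - Q0)) ?subr_ge0//.
have hgD : `|h * g| <= h * D i j.
  by rewrite normrM (ger0_norm (ltW h0)) ler_wpM2l// ltW.
apply: ler_pM => //; rewrite ?subr_ge0//.
Qed.

(** By [scheme_stable] for the difference of the two sides, which vanishes at the
    start of the step. The limit factorizes: whatever happened before, in particular
    the current heading, does not matter. *)
Lemma weighted_moment_cvg t i j : 0 <= t -> exists2 C, 0 <= C &
  forall h M m Psi, 0 < h -> m%:R * h <= t -> weight_ok h M m Psi ->
  forall l, (l <= m)%N ->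
    `|weighted_moment h Psi M i j l -
      \int[P]_w Psi w * cross_moment lambda i j (l%:R * h)| <= C * h.
Proof.
move=> t0.
have /choice[K1 HK1] : forall ij : nat * nat, exists K : R, 0 <= K /\ forall h M m Psi, 0 < h -> m%:R * h <= t -> weight_ok h M m Psi ->
  forall l, (l < m)%N ->
    `|weighted_moment h Psi M ij.1 ij.2 l.+1 -
      scheme_step h (q h) (weighted_moment h Psi M) ij.1 ij.2 l| <= K * h ^+ 2.
  by move=> [a b]; have [K K0 H] := weighted_moment_step a b t0; exists K.
have /choice[K2 HK2] : forall ij : nat * nat, exists K : R, 0 <= K /\ forall h l, 0 < h -> l.+1%:R * h <= t ->
    `|cross_moment lambda ij.1 ij.2 (l.+1%:R * h) -
      scheme_step h (expR (- (lambda * h)))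
        (fun i j l => cross_moment lambda i j (l%:R * h)) ij.1 ij.2 l| <= K * h ^+ 2.
  by move=> [a b]; have [K K0 H] := cross_moment_step t a b lambda_gt0; exists K.
pose K a b := K1 (a, b) + K2 (a, b).
have K0 a b : 0 <= K a b by rewrite addr_ge0// ?(HK1 (a, b)).1 ?(HK2 (a, b)).1.
have [C C0 HC] := scheme_stable (ltW lambda_gt0) t0 K0 i j.
exists C => // h M m Psi h0 mt wok l lm.
have [bPsi Psi1 _] := wok.
pose e := \int[P]_w Psi w.
have e1 : `|e| <= 1 by apply: expect_norm_le => //; exact: bPsi.1.
pose delta a b k := weighted_moment h Psi M a b k - e * cross_moment lambda a b (k%:R * h).
have /expRN_bounds/andP[q1 q2] : 0 <= lambda * h by rewrite mulr_ge0// ltW.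
apply: (HC delta h (q h) m) => //.
- by rewrite -expR0 ler_expR oppr_le0 mulr_ge0// ltW.
- by lra.
- move=> a b; rewrite /delta /weighted_moment mul0r.
  have rE w : radius2 h M 0 w = 0.
    by rewrite /grid_radius2 /grid_sum !big_ord0 mulr0 expr0n/= addr0.
  have QE w : radial h M 0 w = 0.
    by rewrite /grid_radial /grid_sum !big_ord0 !mulr0 !mul0r addr0.
  have [ab|ab] := posnP (a + b)%N.
    move: ab => /eqP; rewrite addn_eq0 => /andP[/eqP -> /eqP ->].
    rewrite /= radius_moment0 mulr1; apply/eqP; rewrite subr_eq0; apply/eqP.
    by apply: eq_expect => w; rewrite !expr0 !mulr1.
  rewrite cross_moment_at0// mulr0 subr0 -[RHS](expect_cst P).
  apply: eq_expect => w; rewrite rE QE !expr0n.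
  by case: a b ab => [|a] [|b] // _; rewrite /= ?mulr0 ?mul0r.
move=> a b k km.
have kt : k.+1%:R * h <= t by rewrite (le_trans _ mt)// ler_wpM2r ?(ltW h0)// ler_nat.
have s1 := (HK1 (a, b)).2 h M m Psi h0 mt wok k km.
have s2 := (HK2 (a, b)).2 h k h0 kt.
rewrite /= in s1 s2.
rewrite (_ : _ - _ = (weighted_moment h Psi M a b k.+1 -
    scheme_step h (q h) (weighted_moment h Psi M) a b k) -
  e * (cross_moment lambda a b (k.+1%:R * h) - scheme_step h (q h)
     (fun i j l => cross_moment lambda i j (l%:R * h)) a b k)); last first.
  by rewrite /delta /scheme_step; ring.
rewrite (le_trans (ler_normB _ _))// /K mulrDl lerD// normrM.
by rewrite -[leRHS]mul1r ler_pM.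
Qed.

End grid_moments.

(** * From the discretised flight to the flight *)

Lemma cvg_dist_le {R : realType} (u v : nat -> R) (l C : R) :
  (forall n, `|u n - l| <= C * v n) -> v n @[n --> \oo] --> 0 ->
  u n @[n --> \oo] --> l.
Proof.
move=> H v0; have Cv0 : C * v n @[n --> \oo] --> 0.
  by rewrite -(mulr0 C); exact: cvgMr.
have lo : l - C * v n @[n --> \oo] --> l.
  by rewrite -[X in _ --> X]subr0; apply: cvgB; [exact: cvg_cst|].
have hi : l + C * v n @[n --> \oo] --> l.
  by rewrite -[X in _ --> X]addr0; apply: cvgD; [exact: cvg_cst|].
apply: squeeze_cvgr lo hi; apply: nearW => n.
by have := H n; rewrite ler_norml => /andP[h1 h2]; apply/andP; split; lra.
Qed.

Section flight_paths.
Context {d} {T : measurableType d} {R : realType} (P : probability T R).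
Variables (lambda : R) (N : R -> {RV P >-> nat}) (s : nat -> T -> R).
Variable theta : nat -> {RV P >-> R}.
Hypothesis poissonN : poisson_process lambda N s.

(** The flight at unit speed, projected by [phi] (a cosine or a sine). *)
Definition path_sum (phi : R -> R) (t : R) (w : T) : R :=
  \sum_(j < (N t w).+1) leg_duration N s t j w * phi (theta j w).

Lemma flight_xE c t w : flight_x 0 c N s theta t w = c * path_sum cos t w.
Proof. by rewrite /flight_x add0r. Qed.

Lemma flight_yE c t w : flight_y 0 c N s theta t w = c * path_sum sin t w.
Proof. by rewrite /flight_y add0r. Qed.

(** Position at time [t] of a path that keeps heading [theta k] after the
    [k]-th event. *)
Let branch phi k t w : R :=
  \sum_(j < k) (s j.+1 w - s j w) * phi (theta j w) + (t - s k w) * phi (theta k w).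

Let path_sum_branch phi t w : path_sum phi t w = branch phi (N t w) t w.
Proof.
rewrite /path_sum big_ord_recr/= /leg_duration ltnn; congr (_ + _).
by apply: eq_bigr => j _; rewrite ltn_ord.
Qed.

Lemma path_sum_same phi u v w : N u w = N v w ->
  path_sum phi v w - path_sum phi u w = (v - u) * phi (theta (N u w) w).
Proof. by move=> Nuv; rewrite !path_sum_branch Nuv /branch; ring. Qed.

Let event_time_mono w i j : (i <= j)%N -> s i w <= s j w.
Proof.
move: i j; apply/nondecreasing_seqP => k.
exact/ltW/(event_time_lt poissonN).
Qed.

(** A unit-speed path; by induction on the number of events between the two
    times. *)
Lemma path_sum_lipschitz phi u v w : (forall x, `|phi x| <= 1) ->
  0 <= u -> u <= v -> `|path_sum phi v w - path_sum phi u w| <= v - u.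
Proof.
move=> phi1 u0 uv; have v0 := le_trans u0 uv; rewrite !path_sum_branch.
have Nuv := event_count_mono poissonN w u0 uv.
have [/(_ erefl)/andP[su us] _] := event_countP poissonN (N u w) w u0.
have [/(_ erefl)/andP[sv vs] _] := event_countP poissonN (N v w) w v0.
move: Nuv sv; move: (N v w) {vs} => n; move: (N u w) su us => k su us kn.
rewrite -(subnKC kn); move: (n - k)%N => {kn n} e.
elim: e v uv {v0} => [|e ih] v uv sv.
  rewrite addn0 (_ : _ - _ = (v - u) * phi (theta k w)); last by rewrite /branch; ring.
  by rewrite normrM ger0_norm ?subr_ge0// ler_piMr ?subr_ge0.
set b := s (k + e).+1 w.
have ub : u <= b.
  by rewrite (le_trans (ltW us))// event_time_mono// ltnS leq_addr.
have bv : b <= v by rewrite /b -addnS.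
have H := ih b ub (event_time_mono w (leqnSn _)).
rewrite addnS (_ : branch phi (k + e).+1 v w - branch phi k u w =
  (v - b) * phi (theta (k + e).+1 w) + (branch phi (k + e) b w - branch phi k u w)); last first.
  by rewrite /branch big_ord_recr/= -/b; ring.
rewrite (le_trans (ler_normD _ _))// (_ : v - u = (v - b) + (b - u)); last by ring.
by rewrite lerD// normrM ger0_norm ?subr_ge0// ler_piMr ?subr_ge0.
Qed.

(** Freezing the heading is exact on a mesh step without event, and costs at most
    [2 h] on one with events. *)
Lemma grid_sum_error phi h M m w : (forall x, `|phi x| <= 1) -> 0 < h ->
  `|path_sum phi ((M + m)%N%:R * h) w - path_sum phi (M%:R * h) w -
    grid_sum N theta h phi M m w| <=
  2 * h * (N ((M + m)%N%:R * h) w - N (M%:R * h) w)%N%:R.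
Proof.
move=> phi1 h0; have g0 k := grid_ge0 h0 k.
have mono k l : (k <= l)%N -> (N (k%:R * h) w <= N (l%:R * h) w)%N.
  by move=> kl; apply: (event_count_mono poissonN) => //; exact: (grid_le h0).
elim: m => [|m ih].
  by rewrite addn0 subrr subnn mulr0 /grid_sum big_ord0 mulr0 subr0 normr0.
rewrite grid_sumS addnS; set i := (M + m)%N in ih *.
rewrite (_ : _ - _ - _ = (path_sum phi (i%:R * h) w - path_sum phi (M%:R * h) w -
    grid_sum N theta h phi M m w) + (path_sum phi (i.+1%:R * h) w -
    path_sum phi (i%:R * h) w - h * phi (heading N theta h i w))); last by ring.
have Ni1 := mono i i.+1 (leqnSn i); have NM := mono M i (leq_addr m M).
rewrite (_ : (N (i.+1%:R * h) w - N (M%:R * h) w)%N =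
    ((N (i%:R * h) w - N (M%:R * h) w) + (N (i.+1%:R * h) w - N (i%:R * h) w))%N);
  last by rewrite addnC addnBA// subnK.
rewrite natrD mulrDr (le_trans (ler_normD _ _))// lerD//.
have hi : i%:R * h <= i.+1%:R * h by apply: (grid_le h0).
have hiE : i.+1%:R * h - i%:R * h = h by rewrite -natr1; ring.
have [Ni|Ni] := eqVneq (N (i%:R * h) w) (N (i.+1%:R * h) w).
  by rewrite path_sum_same// hiE /heading subrr normr0 mulr_ge0// mulr_ge0 ?ltW.
apply: (@le_trans _ _ (2 * h)).
  rewrite (le_trans (ler_normB _ _))// (_ : 2 * h = h + h); last by ring.
  rewrite lerD//.
    by rewrite (le_trans (path_sum_lipschitz w phi1 (g0 i) hi))// hiE.
  by rewrite normrM (ger0_norm (ltW h0)) ler_piMr// ltW.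
rewrite ler_peMr ?mulr_ge0 ?(ltW h0)// ler1n subn_gt0 ltn_neqAle Ni mono//.
Qed.

Section observation_step.
Variable D : R.
Hypothesis D_gt0 : 0 < D.

Local Notation mesh m := (D / m.+1%:R).

Definition step_sum phi k w : R :=
  path_sum phi (k.+1%:R * D) w - path_sum phi (k%:R * D) w.

(** At unit speed, so that its largest possible value is [D ^ 2]. *)
Definition step_radius2 k w : R := step_sum cos k w ^+ 2 + step_sum sin k w ^+ 2.

Lemma mesh_gt0 m : 0 < mesh m.
Proof. by rewrite divr_gt0// ltr0n. Qed.

Lemma meshE k m : (k * m.+1)%N%:R * mesh m = k%:R * D.
Proof.
rewrite natrM; have : m.+1%:R != 0 :> R by rewrite pnatr_eq0.
by move: (m.+1%:R) => n n0; field.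
Qed.

Lemma mesh_total m : m.+1%:R * mesh m = D.
Proof. by rewrite mulrC divfK// pnatr_eq0. Qed.

Lemma mesh_cvg0 : mesh m @[m --> \oo] --> 0.
Proof.
by rewrite -(mulr0 D); apply: cvgMr; exact: cvg_harmonic.
Qed.

Lemma grid_sum_cvg phi k w : (forall x, `|phi x| <= 1) ->
  grid_sum N theta (mesh m) phi (k * m.+1) m.+1 w @[m --> \oo] --> step_sum phi k w.
Proof.
move=> phi1; apply: (@cvg_dist_le _ _ (fun m => mesh m) _
  (2 * (N (k.+1%:R * D) w - N (k%:R * D) w)%N%:R)); last exact: mesh_cvg0.
move=> m; have := grid_sum_error (k * m.+1) m.+1 w phi1 (mesh_gt0 m).
have -> : (k * m.+1 + m.+1 = k.+1 * m.+1)%N by rewrite mulSn addnC.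
rewrite !meshE distrC => /le_trans; apply.
by rewrite mulrAC.
Qed.

Lemma step_radius2_cvg k w :
  grid_radius2 N theta (mesh m) (k * m.+1) m.+1 w @[m --> \oo] --> step_radius2 k w.
Proof.
have c1 (x : R) : `|cos x| <= 1 by rewrite ler_norml cos_geN1 cos_le1.
have s1 (x : R) : `|sin x| <= 1 by rewrite ler_norml sin_geN1 sin_le1.
have := @grid_sum_cvg cos k w c1; have := @grid_sum_cvg sin k w s1 => hs hc.
by apply: cvgD; apply: cvgM.
Qed.

Lemma grid_radius2_itv k m w :
  0 <= grid_radius2 N theta (mesh m) (k * m.+1) m.+1 w <= D ^+ 2.
Proof.
have [] := grid_bounds N theta (mesh_gt0 m) (k * m.+1) m.+1 w.
by rewrite mesh_total.
Qed.

Lemma step_radius2_itv k w : 0 <= step_radius2 k w <= D ^+ 2.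
Proof.
have cv := @step_radius2_cvg k w.
rewrite -(cvg_lim _ cv)//; apply/andP; split.
  apply: limr_ge; first exact: cvgP cv.
  by apply: nearW => m; have /andP[] := grid_radius2_itv k m w.
apply: limr_le; first exact: cvgP cv.
by apply: nearW => m; have /andP[] := grid_radius2_itv k m w.
Qed.

Lemma bounded_step_radius2 k : bounded_measurable (step_radius2 k).
Proof.
split; last first.
  by exists (D ^+ 2) => w; have /andP[r0 rD] := step_radius2_itv k w; rewrite ger0_norm.
apply: (@measurable_fun_cvg _ _ _ setT
  (fun m => grid_radius2 N theta (mesh m) (k * m.+1) m.+1)) => [m|w _].
  exact: (bounded_grid_radius2 N theta (mesh m) (k * m.+1) m.+1).1.
exact: step_radius2_cvg.
Qed.

Lemma step_radius2_no_event k w : increment N D k w = 0%N ->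
  step_radius2 k w = D ^+ 2.
Proof.
move=> K0; have Nk : N (k%:R * D) w = N (k.+1%:R * D) w.
  by have := increment_addE poissonN D_gt0 k w; rewrite K0 addn0.
rewrite /step_radius2 /step_sum !path_sum_same//.
have -> : k.+1%:R * D - k%:R * D = D by rewrite -natr1; ring.
by rewrite !exprMn -mulrDr cos2Dsin2 mulr1.
Qed.

Hypothesis directions : iid_uniform_directions theta.
Hypothesis indep : independent_systems P
  (sigma_generated [set t : R | 0 <= t] (fun t => N t : T -> nat))
  (sigma_generated [set: nat] (fun j => theta j : T -> R)).
Hypothesis lambda_gt0 : 0 < lambda.

(** The limit of [weighted_moment_cvg] as the mesh becomes fine, with a power of
    the displacement of an earlier step as weight; dividing by [D ^ 2] keeps the
    weight below one. The case [a = 0] gives the moments of a single step. *)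
Lemma step_moments a b k k' : (a = 0%N \/ (k < k')%N) ->
  \int[P]_w ((step_radius2 k w / D ^+ 2) ^+ a * step_radius2 k' w ^+ b) =
  \int[P]_w (step_radius2 k w / D ^+ 2) ^+ a * radius_moment lambda b D.
Proof.
move=> akk'; have D2 : 0 < D ^+ 2 by rewrite exprn_gt0.
pose r k m w := grid_radius2 N theta (mesh m) (k * m.+1) m.+1 w.
have br k0 m : bounded_measurable (r k0 m) by exact: bounded_grid_radius2.
pose Psi m w := (r k m w / D ^+ 2) ^+ a.
have r01 k0 m w : 0 <= r k0 m w / D ^+ 2 <= 1.
  have /andP[r0 rD] := grid_radius2_itv k0 m w.
  by rewrite divr_ge0 ?(ltW D2)//= ler_pdivrMr// mul1r.
have Psi01 m w : 0 <= Psi m w <= 1.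
  by have /andP[r0 r1] := r01 k m w; rewrite exprn_ge0//= exprn_ile1.
have bPsi m : bounded_measurable (Psi m).
  apply: bounded_measurableX; apply: bounded_measurableM => //.
  exact: bounded_measurable_cst.
have Psi1 m w : `|Psi m w| <= 1.
  by have /andP[p0 p1] := Psi01 m w; rewrite ger0_norm.
have cvr k0 w : r k0 m w @[m --> \oo] --> step_radius2 k0 w by exact: step_radius2_cvg.
have cvX (u : nat -> R) (l : R) n : u m @[m --> \oo] --> l ->
    u m ^+ n @[m --> \oo] --> l ^+ n.
  move=> ul; elim: n => [|n ih]; first exact: cvg_cst.
  by rewrite exprS; under eq_fun do rewrite exprS; exact: cvgM.
have cvPsi w : Psi m w @[m --> \oo] --> (step_radius2 k w / D ^+ 2) ^+ a.
  by apply: cvX; apply: cvgM => //; exact: cvg_cst.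
have [_ [_ lim1]] := expect_cvg P (fun m => (bPsi m).1) Psi1 cvPsi.
have bF m : bounded_measurable (fun w => Psi m w * r k' m w ^+ b).
  by apply: bounded_measurableM => //; exact: bounded_measurableX.
have F1 m w : `|Psi m w * r k' m w ^+ b| <= (D ^+ 2) ^+ b.
  have /andP[r0 rD] : 0 <= r k' m w <= D ^+ 2 by exact: grid_radius2_itv.
  rewrite normrM [X in _ * X]normrX (ger0_norm r0) -[leRHS]mul1r ler_pM ?exprn_ge0//.
  by rewrite lerXn2r ?nnegrE// ltW.
have cvF w : Psi m w * r k' m w ^+ b @[m --> \oo] -->
    (step_radius2 k w / D ^+ 2) ^+ a * step_radius2 k' w ^+ b.
  by apply: cvgM => //; exact: cvX.
have [_ [_ lim2]] := expect_cvg P (fun m => (bF m).1) F1 cvF.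
have [C C0 HC] := weighted_moment_cvg poissonN directions indep lambda_gt0 b 0%N (ltW D_gt0).
have mE := mesh_total.
have close m : `|\int[P]_w (Psi m w * r k' m w ^+ b) -
    \int[P]_w Psi m w * radius_moment lambda b D| <= C * mesh m.
  have wok : weight_ok lambda N theta (mesh m) (k' * m.+1) m.+1 (Psi m).
    split=> // l lm; case: akk' => [a0|kk'].
      have -> : Psi m = fun=> 1 by apply/funext => w; rewrite /Psi a0 expr0.
      exact: adapted_cst.
    apply: adaptedX; apply: adaptedM; last exact: adapted_cst.
    have -> : (k' * m.+1 + l = k * m.+1 + ((k' - k) * m.+1 + l))%N.
      by rewrite addnA -mulnDl subnKC// ltnW.
    apply: adapted_grid_radius2.
    rewrite ltnS (leq_trans _ (leq_addr _ _))//.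
    by rewrite (leq_trans (leqnSn m))// leq_pmull// subn_gt0.
  have mD : m.+1%:R * mesh m <= D by rewrite mE.
  have := HC (mesh m) (k' * m.+1)%N m.+1 (Psi m) (mesh_gt0 m) mD wok m.+1 (leqnn _).
  rewrite mE /weighted_moment /=; congr (`|_ - _| <= _).
  by apply: eq_expect => w; rewrite expr0 mulr1.
have lim3 : \int[P]_w (Psi m w * r k' m w ^+ b) -
    \int[P]_w Psi m w * radius_moment lambda b D @[m --> \oo] --> 0.
  apply: (@cvg_dist_le _ _ (fun m => mesh m) _ C); last exact: mesh_cvg0.
  by move=> m; rewrite subr0; exact: close.
have lim4 : \int[P]_w (Psi m w * r k' m w ^+ b) -
    \int[P]_w Psi m w * radius_moment lambda b D @[m --> \oo] -->
    \int[P]_w ((step_radius2 k w / D ^+ 2) ^+ a * step_radius2 k' w ^+ b) -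
    \int[P]_w (step_radius2 k w / D ^+ 2) ^+ a * radius_moment lambda b D.
  by apply: cvgB => //; apply: cvgM => //; exact: cvg_cst.
by apply/eqP; rewrite -subr_eq0; apply/eqP; exact: cvg_unique lim4 lim3.
Qed.

End observation_step.
End flight_paths.

(** * Polynomials in the squared displacement *)

Section moment_functional.
Context {R : realType}.

(** The Riesz functional of a moment sequence. *)
Definition moment_lin (u : nat -> R) (p : {poly R}) : R :=
  \sum_(i < size p) p`_i * u i.

Lemma moment_linE u (p : {poly R}) n : (size p <= n)%N ->
  moment_lin u p = \sum_(i < n) p`_i * u i.
Proof.
move=> pn; rewrite /moment_lin (big_ord_widen n (fun i => p`_i * u i))//.
rewrite big_mkcond/=; apply: eq_bigr => i _; case: ltnP => // ip.
by rewrite nth_default// mul0r.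
Qed.

Lemma moment_linD u (p q : {poly R}) : moment_lin u (p + q) = moment_lin u p + moment_lin u q.
Proof.
pose n := maxn (size p) (size q).
rewrite (moment_linE u (size_polyD p q)) -/n.
rewrite (moment_linE (n := n) u (leq_maxl _ _)) (moment_linE (n := n) u (leq_maxr _ _)).
by rewrite -big_split/=; apply: eq_bigr => i _; rewrite coefD mulrDl.
Qed.

Lemma moment_linZ u c (p : {poly R}) : moment_lin u (c *: p) = c * moment_lin u p.
Proof.
rewrite (moment_linE u (size_scale_leq c p)) /moment_lin mulr_sumr.
by apply: eq_bigr => i _; rewrite coefZ mulrA.
Qed.

Lemma moment_lin_sum u (I : Type) (r : seq I) (F : I -> {poly R}) :
  moment_lin u (\sum_(i <- r) F i) = \sum_(i <- r) moment_lin u (F i).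
Proof.
elim: r => [|i r ih].
  by rewrite !big_nil /moment_lin size_poly0 big_ord0.
by rewrite !big_cons moment_linD ih.
Qed.

Lemma moment_linXn u k : moment_lin u 'X^k = u k.
Proof.
rewrite /moment_lin size_polyXn big_ord_recr/= coefXn eqxx mul1r big1 ?add0r// => i _.
by rewrite coefXn (ltn_eqF (ltn_ord i)) mul0r.
Qed.

Variable lambda : R.

Lemma radius_moment_lin i t : radius_moment lambda i t =
  moment_lin (fun k => norm_moment lambda k t) (((t ^+ 2)%:P - 'X) ^+ i).
Proof.
have -> : ((t ^+ 2)%:P - 'X) ^+ i = \sum_(k < i.+1)
    ('C(i, k)%:R * (-1) ^+ k * t ^+ (2 * (i - k))) *: 'X^k :> {poly R}.
  rewrite exprBn; apply: eq_bigr => k _.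
  rewrite -mulr_natl -!mul_polyC -rmorphXn/= !rmorphM/= !rmorphXn/= rmorphN1 rmorph_nat.
  by rewrite -exprM mulnC; ring.
rewrite moment_lin_sum; apply: eq_bigr => k _.
by rewrite moment_linZ moment_linXn mulrA.
Qed.

(** Passing from [r ^ 2] to [R ^ 2 = t ^ 2 - r ^ 2] is a substitution in the
    polynomial. *)
Lemma moment_lin_reflect (p : {poly R}) t :
  moment_lin (fun i => radius_moment lambda i t) (p \Po ((t ^+ 2)%:P - 'X)) =
  moment_lin (fun k => norm_moment lambda k t) p.
Proof.
set q := _ - 'X; set v := fun k => norm_moment lambda k t.
have H r : moment_lin (fun i => radius_moment lambda i t) r = moment_lin v (r \Po q).
  rewrite comp_polyE moment_lin_sum; apply: eq_bigr => i _.
  by rewrite moment_linZ radius_moment_lin.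
rewrite H -comp_polyA (_ : q \Po q = 'X) ?comp_polyXr//.
by rewrite /q comp_polyB comp_polyC comp_polyX opprB addrC subrK.
Qed.

Lemma expands_moment_lin t (p : {poly R}) : 0 < lambda ->
  expands t (fun s => moment_lin (fun k => norm_moment lambda k s) p)
    (fun s => lambda * (p.[s ^+ 2] - moment_lin (fun k => norm_moment lambda k s) p)).
Proof.
move=> l0; apply: expands_eq (expands_sum (n := size p)
  (fun k _ => expandsZ p`_k (expands_norm_moment l0 t k))) _ _ => // x.
rewrite horner_coef /moment_lin -sumrB mulr_sumr; apply: eq_bigr => i _.
by rewrite exprM; ring.
Qed.

(** With the integrating factor [exp (lambda s)], the mean of [p (R ^ 2)] is
    the primitive of a known function; estimates of [p] on [0, t ^ 2] thus become
    estimates of its mean, although no law with these moments is constructed. *)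
Lemma expands_moment_exp t (p : {poly R}) : 0 < lambda -> 0 <= t ->
  expands t (fun s => expR (lambda * s) *
      moment_lin (fun k => norm_moment lambda k s) p)
    (fun s => lambda * expR (lambda * s) * p.[s ^+ 2]).
Proof.
move=> l0 t0; apply: expands_eq (expandsM (expands_expR (ltW l0) t0)
  (expands_moment_lin t p l0)) _ _ => // x.
ring.
Qed.

Lemma moment_lin_at0 (p : {poly R}) :
  moment_lin (fun k => norm_moment lambda k 0) p = p.[0].
Proof.
rewrite /moment_lin horner_coef; apply: eq_bigr => i _.
by rewrite norm_moment_at0 expr0n.
Qed.

(** Compare the primitives of [expands_moment_exp] for [p] and for the function
    [sqrt], for which the primitive gives [lapse_moment lambda 1]. *)
Lemma moment_lin_sqrt (p : {poly R}) t (e : R) : 0 < lambda -> 0 <= t ->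
  (forall y, 0 <= y -> y <= t ^+ 2 -> `|Num.sqrt y - p.[y]| <= e) ->
  `|moment_lin (fun k => norm_moment lambda k t) p - lapse_moment lambda 1 t| <=
  e * (1 + t * (lambda * expR (lambda * t))).
Proof.
move=> l0 t0 H.
pose g s := expR (lambda * s) *
  (moment_lin (fun k => norm_moment lambda k s) p - lapse_moment lambda 1 s).
pose g' s := lambda * expR (lambda * s) * (p.[s ^+ 2] - s).
have Hg : expands t g g'.
  apply: expands_eq (expandsD (expands_moment_exp p l0 t0)
    (expandsZ (-1) (expandsM (expands_expR (ltW l0) t0) (expands_lapse_moment l0 t 1)))) _ _ => x.
    by rewrite /g; ring.
  by rewrite /g'; ring.
have e0 : 0 <= e by apply: le_trans (normr_ge0 _) (H 0 (lexx _) (sqr_ge0 _)).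
have g'b x : 0 <= x <= t -> `|g' x| <= lambda * expR (lambda * t) * e.
  move=> /andP[x0 xt]; rewrite /g' !normrM (ger0_norm (ltW l0)) (ger0_norm (expR_ge0 _)).
  have x2 : x ^+ 2 <= t ^+ 2 by rewrite lerXn2r// nnegrE.
  have := H (x ^+ 2) (sqr_ge0 _) x2; rewrite sqrtr_sqr (ger0_norm x0) distrC => Hx.
  have E0 : 0 <= lambda * expR (lambda * x) by rewrite mulr_ge0 ?expR_ge0 ?ltW.
  have Et : lambda * expR (lambda * x) <= lambda * expR (lambda * t).
    by rewrite ler_wpM2l ?(ltW l0)// ler_expR ler_wpM2l ?(ltW l0).
  exact: ler_pM.
have g0 : g 0 = p.[0].
  by rewrite /g moment_lin_at0 /= !mulr0 oppr0 expR0 subrr mulr0 expr1 subr0 subr0 mul1r.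
have p0 : `|p.[0]| <= e.
  by have := H 0 (lexx _) (sqr_ge0 _); rewrite sqrtr0 sub0r normrN.
have up := expands_increment_le (lexx 0) t0 Hg
  (fun x hx => le_trans (ler_norm _) (g'b x hx)).
have gt : `|g t| <= e * (1 + t * (lambda * expR (lambda * t))).
  move: p0; rewrite !ler_norml => /andP[p1 p2].
  have dn' : -1 * g t <= -1 * g 0 + (t - 0) * (lambda * expR (lambda * t) * e).
    apply: (expands_increment_le (lexx 0) t0 (expandsZ (-1) Hg)) => x hx.
    rewrite mulN1r.
    by rewrite (le_trans (ler_norm _))// normrN; exact: g'b.
  by rewrite g0 in up dn'; apply/andP; split; lra.
have E1 : 1 <= expR (lambda * t) by rewrite -expR0 ler_expR (mulr_ge0 (ltW l0) t0).
apply: le_trans gt; rewrite /g normrM ger0_norm ?expR_ge0// ler_peMl//.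
Qed.

(** An explicit substitute for the Weierstrass approximation theorem. *)
Fixpoint sqrt_poly (n : nat) : {poly R} :=
  if n is n'.+1 then sqrt_poly n' + 2^-1 *: ('X - sqrt_poly n' ^+ 2) else 0.

(** With [r = sqrt x] and [P] the current value, the error [r - P] is multiplied by
    [1 - (r + P) / 2] at each step. *)
Lemma sqrt_poly_error n (x : R) : 0 <= x -> x <= 1 ->
  0 <= Num.sqrt x - (sqrt_poly n).[x] <= Num.sqrt x * (1 - Num.sqrt x / 2) ^+ n.
Proof.
move=> x0 x1; set r := Num.sqrt x.
have r0 : 0 <= r := sqrtr_ge0 x.
have r1 : r <= 1 by rewrite -sqrtr1 ler_sqrt.
have rr : r ^+ 2 = x by rewrite sqr_sqrtr.
elim: n => [|n /andP[e0 e1]]; first by rewrite /= horner0 subr0 expr0 mulr1 r0 lexx.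
set P := (sqrt_poly n).[x] in e0 e1 *.
have -> : (sqrt_poly n.+1).[x] = P + 2^-1 * (x - P ^+ 2).
  by rewrite /= !hornerE.
have -> : r - (P + 2^-1 * (x - P ^+ 2)) = (r - P) * (1 - (r + P) / 2).
  by rewrite -rr; field.
have P0 : P <= r by lra.
have r2 : 0 <= 1 - r / 2 by lra.
have Pge0 : 0 <= P.
  have : r * (1 - r / 2) ^+ n <= r.
    by rewrite ler_piMr// exprn_ile1//; lra.
  lra.
apply/andP; split; first by rewrite mulr_ge0//; lra.
by rewrite exprSr mulrA; apply: ler_pM => //; lra.
Qed.

Lemma sqrt_poly_error_le n (x : R) : 0 <= x -> x <= 1 ->
  `|Num.sqrt x - (sqrt_poly n).[x]| <= 2 * n.+1%:R^-1.
Proof.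
move=> x0 x1; have /andP[e0 e1] := sqrt_poly_error n x0 x1.
rewrite ger0_norm// (le_trans e1)//; set r := Num.sqrt x.
have r0 : 0 <= r := sqrtr_ge0 x.
have r1 : r <= 1 by rewrite -sqrtr1 ler_sqrt.
have n0 : (0 : R) < n.+1%:R by rewrite ltr0n.
have bern k : 1 + k%:R * (r / 2) <= (1 + r / 2) ^+ k.
  elim: k => [|k ih]; first by rewrite mul0r addr0 expr0.
  have r20 : 0 <= 1 + r / 2 by lra.
  rewrite exprS; apply: le_trans (ler_wpM2l r20 ih).
  have -> : (1 + r / 2) * (1 + k%:R * (r / 2)) =
    1 + k.+1%:R * (r / 2) + k%:R * (r / 2) ^+ 2 by rewrite -[k.+1%:R]natr1; ring.
  by rewrite lerDl mulr_ge0 ?sqr_ge0.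
have r2 : 0 <= (1 - r / 2) ^+ n by rewrite exprn_ge0//; lra.
have H : (1 - r / 2) ^+ n * (1 + n%:R * (r / 2)) <= 1.
  apply: le_trans (ler_wpM2l r2 (bern n)) _.
  rewrite -exprMn exprn_ile1//.
    by rewrite mulr_ge0//; lra.
  have -> : (1 - r / 2) * (1 + r / 2) = 1 - (r / 2) ^+ 2 by ring.
  by rewrite gerBl sqr_ge0.
rewrite ler_pdivlMr// -[n.+1%:R]natr1.
set y := (1 - r / 2) ^+ n in r2 H *.
have H2 : r * y <= 1 * y by exact: ler_wpM2r.
rewrite (_ : r * y * (n%:R + 1) = 2 * (y * (1 + n%:R * (r / 2))) + r * y - 2 * y).
  by lra.
by field.
Qed.

End moment_functional.

(** * The Lorentz norm of one step *)

Section law_of_one_step.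
Context {d} {T : measurableType d} {R : realType} (P : probability T R).
Variables (lambda : R) (N : R -> {RV P >-> nat}) (s : nat -> T -> R).
Variable theta : nat -> {RV P >-> R}.
Hypothesis poissonN : poisson_process lambda N s.
Hypothesis directions : iid_uniform_directions theta.
Hypothesis indep : independent_systems P
  (sigma_generated [set t : R | 0 <= t] (fun t => N t : T -> nat))
  (sigma_generated [set: nat] (fun j => theta j : T -> R)).
Hypothesis lambda_gt0 : 0 < lambda.
Variable D : R.
Hypothesis D_gt0 : 0 < D.

Local Notation radius2 := (step_radius2 N s theta D).
Local Notation mean_of p := (moment_lin (fun k => norm_moment lambda k D) p).

Let radius2_itv k w : 0 <= radius2 k w <= D ^+ 2.
Proof. exact: (step_radius2_itv theta poissonN D_gt0). Qed.

Let bounded_radius2 k : bounded_measurable (radius2 k).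
Proof. exact: (bounded_step_radius2 theta poissonN D_gt0). Qed.

(** The Lorentz norm of the displacement in space and time over one step. *)
Definition step_norm k w : R := Num.sqrt (D ^+ 2 - radius2 k w).

Lemma step_norm_itv k w : 0 <= step_norm k w <= D.
Proof.
have /andP[r0 rD] := radius2_itv k w.
rewrite sqrtr_ge0/= -[leRHS]ger0_norm ?(ltW D_gt0)// -sqrtr_sqr.
by rewrite ler_sqrt ?sqr_ge0// gerBl.
Qed.

Lemma bounded_step_norm k : bounded_measurable (step_norm k).
Proof.
split; last first.
  by exists D => w; have /andP[n0 nD] := step_norm_itv k w; rewrite ger0_norm.
apply: (@measurableT_comp _ _ _ _ _ _ (@Num.sqrt R)).
  apply: continuous_measurable_fun; exact: sqrt_continuous.
exact: (bounded_measurableB (bounded_measurable_cst (D ^+ 2)) (bounded_radius2 k)).1.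
Qed.

Lemma bounded_poly_radius2 (p : {poly R}) k :
  bounded_measurable (fun w => p.[radius2 k w]).
Proof.
under eq_fun do rewrite horner_coef.
apply: bounded_measurable_sum => i; apply: bounded_measurableZ.
exact: bounded_measurableX.
Qed.

(** Bilinearity reduces this to powers, where it is [step_moments]. *)
Lemma expect_poly_radius2_pair (p q : {poly R}) k k' : (k < k')%N ->
  \int[P]_w (p.[radius2 k w] * q.[radius2 k' w]) =
  \int[P]_w p.[radius2 k w] * moment_lin (fun i => radius_moment lambda i D) q.
Proof.
move=> kk'; have D2 : D ^+ 2 != 0 by rewrite expf_neq0// lt0r_neq0.
have bX i k0 : bounded_measurable (fun w => radius2 k0 w ^+ i).
  exact: bounded_measurableX.
have M a b : \int[P]_w (radius2 k w ^+ a * radius2 k' w ^+ b) =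
    \int[P]_w (radius2 k w ^+ a) * radius_moment lambda b D.
  have bY : bounded_measurable (fun w => (radius2 k w / D ^+ 2) ^+ a).
    apply: bounded_measurableX; apply: bounded_measurableM => //.
    exact: bounded_measurable_cst.
  have E w : radius2 k w ^+ a = (D ^+ 2) ^+ a * (radius2 k w / D ^+ 2) ^+ a.
    by rewrite -exprMn mulrC divfK.
  rewrite (eq_expect P E) expectZ// -mulrA.
  rewrite -(step_moments poissonN D_gt0 directions indep lambda_gt0 b (or_intror kk')).
  rewrite -expectZ; last exact: bounded_measurableM.
  by apply: eq_expect => w; rewrite E mulrA.
have M2 a : \int[P]_w (radius2 k w ^+ a * q.[radius2 k' w]) =
    \int[P]_w (radius2 k w ^+ a) * moment_lin (fun i => radius_moment lambda i D) q.
  transitivity (\int[P]_w (\sum_(b < size q) q`_b * (radius2 k w ^+ a * radius2 k' w ^+ b))).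
    apply: eq_expect => w; rewrite horner_coef mulr_sumr; apply: eq_bigr => b _.
    by ring.
  rewrite expect_sum; last first.
    by move=> b; apply: bounded_measurableZ; exact: bounded_measurableM.
  rewrite /moment_lin mulr_sumr; apply: eq_bigr => b _.
  by rewrite expectZ ?M; [ring|exact: bounded_measurableM].
transitivity (\int[P]_w (\sum_(a < size p) p`_a * (radius2 k w ^+ a * q.[radius2 k' w]))).
  apply: eq_expect => w; rewrite [in LHS]horner_coef mulr_suml; apply: eq_bigr => a _.
  by rewrite mulrA.
have bq := bounded_poly_radius2 q k'.
rewrite expect_sum; last first.
  by move=> a; apply: bounded_measurableZ; exact: bounded_measurableM.
have -> : \int[P]_w p.[radius2 k w] = \sum_(a < size p) p`_a * \int[P]_w (radius2 k w ^+ a).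
  transitivity (\int[P]_w (\sum_(a < size p) p`_a * radius2 k w ^+ a)).
    by apply: eq_expect => w; rewrite horner_coef.
  rewrite expect_sum; last by move=> a; exact: bounded_measurableZ.
  by apply: eq_bigr => a _; rewrite expectZ.
rewrite mulr_suml; apply: eq_bigr => a _.
by rewrite expectZ ?M2 ?mulrA//; exact: bounded_measurableM.
Qed.

Lemma expect_poly_radius2 (q : {poly R}) k :
  \int[P]_w q.[radius2 k w] = moment_lin (fun i => radius_moment lambda i D) q.
Proof.
transitivity (\int[P]_w (\sum_(b < size q) q`_b * radius2 k w ^+ b)).
  by apply: eq_expect => w; rewrite horner_coef.
rewrite expect_sum; last first.
  by move=> b; apply: bounded_measurableZ; exact: bounded_measurableX.
apply: eq_bigr => b _; rewrite expectZ; last exact: bounded_measurableX.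
have := step_moments poissonN D_gt0 directions indep lambda_gt0 b
  (or_introl (erefl 0%N) : 0%N = 0%N \/ (k < k)%N).
under eq_expect do rewrite expr0 mul1r.
move=> ->; congr (_ * _).
have -> : \int[P]_w (radius2 k w / D ^+ 2) ^+ 0 = 1 by rewrite -[RHS](expect_cst P).
by rewrite mul1r.
Qed.

Let reflect (p : {poly R}) : {poly R} := p \Po ((D ^+ 2)%:P - 'X).

Let reflectE p x : (reflect p).[x] = p.[D ^+ 2 - x].
Proof. by rewrite horner_comp !hornerE. Qed.

Definition scaled_sqrt_poly n : {poly R} :=
  D *: (sqrt_poly n \Po ((D ^+ 2)^-1 *: 'X)).

Lemma scaled_sqrt_poly_error n y : 0 <= y -> y <= D ^+ 2 ->
  `|Num.sqrt y - (scaled_sqrt_poly n).[y]| <= (2 * D) * n.+1%:R^-1.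
Proof.
move=> y0 yD; have D2 : 0 < D ^+ 2 by rewrite exprn_gt0.
have x0 : 0 <= y / D ^+ 2 by rewrite divr_ge0// ltW.
have x1 : y / D ^+ 2 <= 1 by rewrite ler_pdivrMr// mul1r.
have := sqrt_poly_error_le n x0 x1.
rewrite /scaled_sqrt_poly !hornerE horner_comp !hornerE.
rewrite [(D ^+ 2)^-1 * y]mulrC => H.
have -> : Num.sqrt y = D * Num.sqrt (y / D ^+ 2).
  have DE : Num.sqrt (D ^+ 2) = D by rewrite sqrtr_sqr ger0_norm// ltW.
  have -> : y = D ^+ 2 * (y / D ^+ 2) by field; exact: lt0r_neq0.
  rewrite sqrtrM ?sqr_ge0// DE; congr (_ * Num.sqrt _).
  by field; exact: lt0r_neq0.
rewrite -mulrBr normrM (ger0_norm (ltW D_gt0)) [2 * D]mulrC -mulrA.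
by rewrite ler_wpM2l// ltW.
Qed.

Let approx n k w := (reflect (scaled_sqrt_poly n)).[radius2 k w].

Let approx_error n k w : `|step_norm k w - approx n k w| <= (2 * D) * n.+1%:R^-1.
Proof.
rewrite /approx reflectE; have /andP[r0 rD] := radius2_itv k w.
by apply: scaled_sqrt_poly_error; [rewrite subr_ge0|rewrite gerBl].
Qed.

Let approx_cvg k w : approx n k w @[n --> \oo] --> step_norm k w.
Proof.
apply: (@cvg_dist_le _ _ (fun n => n.+1%:R^-1) _ (2 * D)); last exact: cvg_harmonic.
by move=> n; rewrite distrC; exact: approx_error.
Qed.

Let approx_bound n k w : `|approx n k w| <= 3 * D.
Proof.
have e := approx_error n k w; have /andP[n0 nD] := step_norm_itv k w.
have n1 : 2 * D * n.+1%:R^-1 <= 2 * D.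
  by rewrite ler_piMr ?mulr_ge0 ?(ltW D_gt0)// invf_le1 ?ltr0n// ler1n.
have := le_trans e n1; rewrite !ler_norml => /andP[e1 e2].
by apply/andP; split; lra.
Qed.

Let bounded_approx n k : bounded_measurable (approx n k).
Proof. exact: bounded_poly_radius2. Qed.

(** Approximate the square root by polynomials, of which the means are known. *)
Lemma expect_step_norm k : \int[P]_w step_norm k w = lapse_moment lambda 1 D.
Proof.
have [_ [_ lim1]] := expect_cvg P (fun n => (bounded_approx n k).1)
  (fun n => approx_bound n k) (fun w => @approx_cvg k w).
have lim2 : \int[P]_w approx n k w @[n --> \oo] --> lapse_moment lambda 1 D.
  apply: (@cvg_dist_le _ _ (fun n => n.+1%:R^-1) _
    (2 * D * (1 + D * (lambda * expR (lambda * D))))); last exact: cvg_harmonic.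
  move=> n; rewrite expect_poly_radius2 moment_lin_reflect.
  rewrite mulrAC; apply: moment_lin_sqrt => //; first exact: ltW.
  by move=> y; exact: scaled_sqrt_poly_error.
exact: cvg_unique lim1 lim2.
Qed.

Lemma expect_step_norm_pair k k' : k != k' ->
  \int[P]_w (step_norm k w * step_norm k' w) = lapse_moment lambda 1 D ^+ 2.
Proof.
wlog kk' : k k' / (k < k')%N => [H|_].
  rewrite neq_ltn => /orP[] kk'; first by apply: H; rewrite ?(ltn_eqF kk').
  rewrite -(H k' k)// ?(ltn_eqF kk')//.
  by apply: eq_expect => w; rewrite mulrC.
have bF n : bounded_measurable (fun w => approx n k w * approx n k' w).
  exact: bounded_measurableM.
have FB n w : `|approx n k w * approx n k' w| <= (3 * D) * (3 * D).
  by rewrite normrM ler_pM.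
have Fcv w : approx n k w * approx n k' w @[n --> \oo] --> step_norm k w * step_norm k' w.
  by apply: cvgM; exact: approx_cvg.
have [_ [_ lim1]] := expect_cvg P (fun n => (bF n).1) FB Fcv.
have cv k0 := (expect_cvg P (fun n => (bounded_approx n k0).1)
  (fun n => approx_bound n k0) (fun w => @approx_cvg k0 w)).2.2.
have lim2 : \int[P]_w (approx n k w * approx n k' w) @[n --> \oo] -->
    \int[P]_w step_norm k w * \int[P]_w step_norm k' w.
  under eq_fun do rewrite expect_poly_radius2_pair// -(expect_poly_radius2 _ k').
  by apply: cvgM; exact: cv.
by rewrite (cvg_unique _ lim1 lim2)// !expect_step_norm.
Qed.

(** The set where [r = D] contains the event of no event, of probability
    [exp (- lambda * D)], so it is enough to bound its probability by this number.
    It is the limit of the means of [(r / D) ^ (2 n)], and [expands_moment_exp]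
    writes such a mean, up to the factor [exp (lambda * D)], as one plus the integral of
    [lambda * exp (lambda * s) * (1 - (s / D) ^ 2) ^ n] over [0, D]. The integral tends to
    zero; it is cut at a small [delta]. *)
Lemma full_step_no_event k :
  P [set w | radius2 k w = D ^+ 2 /\ increment N D k w <> 0%N] = 0%E.
Proof.
have D2 : 0 < D ^+ 2 by rewrite exprn_gt0.
pose x w := radius2 k w / D ^+ 2.
have x01 w : 0 <= x w <= 1.
  have /andP[r0 rD] := radius2_itv k w.
  by rewrite divr_ge0 ?(ltW D2)//= ler_pdivrMr// mul1r.
have bx : bounded_measurable x.
  by apply: bounded_measurableM => //; exact: bounded_measurable_cst.
pose p n : {poly R} := (1 - (D ^+ 2)^-1 *: 'X) ^+ n.
have Ex n : \int[P]_w (x w ^+ n) = mean_of (p n).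
  rewrite -moment_lin_reflect -(expect_poly_radius2 _ k).
  apply: eq_expect => w; rewrite -/(reflect _) reflectE /p horner_exp !hornerE.
  by congr (_ ^+ n); rewrite /x; field; exact: lt0r_neq0.
pose E := expR (lambda * D).
have E0 : 0 < E := expR_gt0 _.
have lE0 : 0 <= lambda * E by rewrite mulr_ge0// ltW.
have bound n delta : 0 <= delta -> delta <= D ->
    E * mean_of (p n) <= 1 + delta * (lambda * E) +
      D * (lambda * E) * (1 - delta ^+ 2 / D ^+ 2) ^+ n.
  move=> d0 dD.
  have pE y : (p n).[y] = (1 - y / D ^+ 2) ^+ n.
    by rewrite /p horner_exp !hornerE [(D ^+ 2)^-1 * y]mulrC.
  have u01 u : 0 <= u -> u <= D -> 0 <= 1 - u ^+ 2 / D ^+ 2 <= 1.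
    move=> u0 uD; rewrite subr_ge0 ler_pdivrMr// mul1r gerBl.
    by rewrite lerXn2r ?nnegrE ?(ltW D_gt0)//= divr_ge0 ?sqr_ge0.
  have eE u : 0 <= u -> u <= D -> lambda * expR (lambda * u) <= lambda * E.
    by move=> u0 uD; rewrite ler_wpM2l ?(ltW lambda_gt0)// ler_expR ler_wpM2l ?(ltW lambda_gt0).
  have e0 u : 0 <= lambda * expR (lambda * u).
    by rewrite mulr_ge0 ?expR_ge0 ?ltW.
  have H t t0 := expands_moment_exp (t := t) (p n) lambda_gt0 t0.
  have up1 : expR (lambda * delta) * moment_lin (fun k => norm_moment lambda k delta) (p n)
      <= 1 + delta * (lambda * E).
    have := expands_increment_le (e := lambda * E) (lexx 0) d0 (H delta d0) _.
    rewrite moment_lin_at0 pE mul0r subr0 expr1n mulr1 mulr0 expR0 subr0; apply.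
    move=> u /andP[u0 ud]; have uD := le_trans ud dD.
    have /andP[v0 v1] := u01 u u0 uD.
    rewrite pE -[leRHS]mulr1; apply: ler_pM => //; [exact: exprn_ge0|exact: eE|].
    exact: exprn_ile1.
  have := expands_increment_le (e := lambda * E * (1 - delta ^+ 2 / D ^+ 2) ^+ n)
    d0 dD (H D (ltW D_gt0)) _.
  move=> /(_ _)/le_trans; apply.
    move=> u /andP[du uD]; have u0 := le_trans d0 du.
    have /andP[v0 v1] := u01 u u0 uD.
    have /andP[w0 w1] := u01 delta d0 dD.
    rewrite pE; apply: ler_pM => //; [exact: exprn_ge0|exact: eE|].
    rewrite lerXn2r ?nnegrE// lerD2l lerN2 ler_pM2r ?invr_gt0//.
    by rewrite lerXn2r ?nnegrE.
  rewrite lerD// -[leRHS]mulrA.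
  have /andP[w0 w1] := u01 delta d0 dD.
  rewrite ler_wpM2r//; last by rewrite gerBl.
  by rewrite mulr_ge0// exprn_ge0.
pose S := [set w | radius2 k w = D ^+ 2].
have mS : measurable S.
  rewrite (_ : S = radius2 k @^-1` [set D ^+ 2])// -[_ @^-1` _]setTI.
  exact: (bounded_radius2 k).1.
have xcv w : x w ^+ n @[n --> \oo] --> (\1_S w : R).
  rewrite indicE; have [wS|wS] := boolP (w \in S).
    have -> : x w = 1 by rewrite /x (set_mem wS) divff// lt0r_neq0.
    by under eq_fun do rewrite expr1n; exact: cvg_cst.
  apply: cvg_expr; have /andP[x0 x1] := x01 w.
  rewrite ger0_norm// lt_neqAle x1 andbT; apply: contra wS => /eqP xw1.
  by apply/mem_set; rewrite /S/=; apply: (divIf (lt0r_neq0 D2)); rewrite -/(x w) xw1 divff// lt0r_neq0.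
have x1 n w : `|x w ^+ n| <= 1.
  by have /andP[x0 xl1] := x01 w; rewrite ger0_norm ?exprn_ge0// exprn_ile1.
have [_ [_ lim1]] := expect_cvg P (fun n => (bounded_measurableX n bx).1) x1 xcv.
rewrite expect_indic// in lim1.
have PS delta : 0 < delta -> delta <= D -> E * fine (P S) <= 1 + delta * (lambda * E).
  move=> d0 dD.
  have limL : E * \int[P]_w x w ^+ n @[n --> \oo] --> E * fine (P S) by exact: cvgMr.
  have limR : 1 + delta * (lambda * E) + D * (lambda * E) *
      (1 - delta ^+ 2 / D ^+ 2) ^+ n @[n --> \oo] --> 1 + delta * (lambda * E).
    rewrite -[X in _ --> X]addr0; apply: cvgD; first exact: cvg_cst.
    rewrite -(mulr0 (D * (lambda * E))); apply: cvgMr; apply: cvg_expr.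
    have dd : 0 < delta ^+ 2 / D ^+ 2 by rewrite divr_gt0// exprn_gt0.
    have d1 : delta ^+ 2 / D ^+ 2 <= 1.
      by rewrite ler_pdivrMr// mul1r lerXn2r ?nnegrE// ltW.
    by rewrite ger0_norm; lra.
  rewrite -(cvg_lim _ limL)// -(cvg_lim _ limR)//; apply: ler_lim.
  - exact: cvgP limL.
  - exact: cvgP limR.
  - by apply: nearW => n; rewrite Ex; apply: bound => //; exact: ltW.
have PS1 : E * fine (P S) <= 1.
  rewrite leNgt; apply/negP => H1.
  pose e := E * fine (P S) - 1.
  have e0 : 0 < e by rewrite subr_gt0.
  pose delta := Num.min D (e / (2 * (lambda * E + 1))).
  have l1 : 0 < 2 * (lambda * E + 1) by lra.
  have dl : 0 < delta by rewrite lt_min D_gt0/= divr_gt0.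
  have dD : delta <= D by rewrite ge_min lexx.
  have := PS delta dl dD.
  have de : delta * (2 * (lambda * E + 1)) <= e.
    by rewrite -ler_pdivlMr// ge_min lexx orbT.
  have m0 : 0 <= delta * (lambda * E) by rewrite mulr_ge0// ltW.
  have -> : 1 + delta * (lambda * E) = 1 + delta * (2 * (lambda * E + 1)) -
    (delta * (lambda * E) + 2 * delta) by ring.
  by rewrite /e in de; lra.
pose Z := [set w | increment N D k w = 0%N].
have ZS : Z `<=` S.
  by move=> w; exact: (step_radius2_no_event theta poissonN D_gt0).
have mZ : measurable Z.
  rewrite (_ : Z = increment N D k @^-1` [set 0%N])// -[_ @^-1` _]setTI.
  exact: (measurable_increment N D k).
have -> : [set w | radius2 k w = D ^+ 2 /\ increment N D k w <> 0%N] = S `\` Z by [].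
have PZ : P Z = (E^-1)%:E.
  rewrite (increment_prob poissonN D_gt0)// (pmf0 lambda_gt0 D_gt0).
  by rewrite expRN.
have PSE : P S = (fine (P S))%:E by rewrite fineK// fin_num_measure.
apply/eqP; rewrite eq_le measure_ge0 andbT.
have PSoo : (P S < +oo)%E by rewrite PSE ltry.
have PD : P (S `\` Z) = (P S - P Z)%E.
  by have := measureD mS mZ PSoo; rewrite setIidr.
rewrite PD PZ PSE -EFinB lee_fin subr_le0.
by rewrite -[leRHS]mul1r ler_pdivlMr// mulrC.
Qed.

End law_of_one_step.

(** * The normal density and Stein's equation *)

Section normal.
Context {R : realType}.
Variable sigma : R.
Hypothesis sigma_gt0 : 0 < sigma.
Notation mu := (@lebesgue_measure R).
Let p : R -> R := normal_pdf 0 sigma.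
Let v := sigma ^+ 2.

Let sigma_neq0 : sigma != 0. Proof. by rewrite gt_eqF. Qed.
Let v_gt0 : 0 < v. Proof. by rewrite exprn_gt0. Qed.

(** The normal law is defined by its values on sets; its Radon-Nikodym derivative is
    almost everywhere the density. *)
Lemma integral_normal_prob (f : R -> \bar R) :
  (normal_prob 0 sigma).-integrable setT f ->
  (\int[normal_prob 0 sigma]_x f x =
   \int[mu]_x (f x * (normal_pdf 0 sigma x)%:E))%E.
Proof.
move=> fi; have mf := measurable_int _ fi.
rewrite -(Radon_Nikodym_change_of_variables (normal_prob_dominates 0 sigma))//=.
apply: ae_eq_integral => //.
- apply: emeasurable_funM => //; apply: (measurable_int mu).
  by apply: Radon_Nikodym_integrable; exact: normal_prob_dominates.
- apply: emeasurable_funM => //=; apply/measurable_EFinP.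
  exact: measurable_normal_pdf.
- apply: ae_eqe_mul2l => /=.
  rewrite Radon_NikodymE//=; first exact: normal_prob_dominates.
  move=> dom; case: cid => /= h [h1 h2 h3].
  apply: integral_ae_eq => //=.
  + by apply/measurable_EFinP; exact: measurable_normal_pdf.
  + by move=> E _ mE; rewrite -h3.
Qed.

Lemma normal_pdf_gt0 x : 0 < p x.
Proof.
rewrite /p normal_pdfE// mulr_gt0 ?normal_peak_gt0//.
by rewrite /normal_fun expR_gt0.
Qed.

Lemma is_derive_normal_pdf (x : R) : is_derive x (1 : R) p (- (x / v) * p x).
Proof.
have pE : p = fun x => normal_peak sigma * expR (- (2 * v)^-1 * x ^+ 2).
  apply/funext => y; rewrite /p normal_pdfE// /normal_fun subr0 /v.
  congr (_ * expR _); rewrite -mulr_natl.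
  have s2 : sigma ^+ 2 != 0 by rewrite expf_neq0.
  by field.
rewrite pE; apply: is_derive_eq; rewrite /= !scaler1 /GRing.scale/=.
have v0 : v != 0 by rewrite gt_eqF.
by field.
Qed.

Lemma normal_pdf_even x : p (- x) = p x.
Proof. by rewrite /p normal_pdfE// /normal_fun !subr0 sqrrN. Qed.

Lemma normal_pdf_cvg0 : p x @[x --> +oo%R] --> (0 : R).
Proof.
(* e^y >= 1 + y gives p x <= peak / (1 + x^2/(2v)) <= 2 v peak / x *)
pose K := normal_peak sigma * (2 * v).
have K_ge0 : 0 <= K by rewrite mulr_ge0 ?normal_peak_ge0// mulr_ge0// ltW.
apply/cvgrPdist_lt => e e0; near=> x.
have x1 : 1 <= x by near: x; exact: nbhs_pinfty_ge.
have x0 : 0 < x by exact: lt_le_trans x1.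
have xK : K / e < x by near: x; apply: nbhs_pinfty_gt; rewrite num_real.
rewrite sub0r normrN ger0_norm ?ltW ?normal_pdf_gt0//.
rewrite /p normal_pdfE// /normal_fun subr0 mulNr expRN.
set y := x ^+ 2 / _.
have yE : y = x ^+ 2 / (2 * v). by rewrite /y /v -[in LHS]mulr_natl.
have y_gt0 : 0 < y by rewrite yE divr_gt0 ?exprn_gt0 ?mulr_gt0.
apply: (@le_lt_trans _ _ (normal_peak sigma * y^-1)).
  rewrite ler_wpM2l ?normal_peak_ge0// lef_pV2 ?posrE ?expR_gt0//.
  by apply: le_trans (expR_ge1Dx y); lra.
rewrite yE invf_div mulrA ltr_pdivrMr ?exprn_gt0//.
rewrite -/K; apply: (@lt_le_trans _ _ (e * x)).
  by rewrite -ltr_pdivrMl// mulrC.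
by rewrite ler_pM2l// expr2 ler_peMr//; lra.
Unshelve. all: by end_near. Qed.

Lemma normal_pdf_continuous : continuous p.
Proof. exact: continuous_normal_pdf. Qed.

Lemma normal_pdf_integrable D : measurable D -> mu.-integrable D (EFin \o p).
Proof.
by move=> mD; apply: (integrableS measurableT) => //; exact: integrable_normal_pdf.
Qed.

(** On the half-line [y / v >= x / v], and [- p] is a primitive of
    [(y / v) * p y]. *)
Lemma normal_mills x : 0 < x ->
  ((x / v)%:E * \int[mu]_(y in `[x, +oo[) (p y)%:E <= (p x)%:E)%E.
Proof.
move=> x0.
have -> : ((p x)%:E = \int[mu]_(y in `[x, +oo[) ((y / v) * p y)%:E)%E.
  rewrite (@ge0_continuous_FTC2y _ _ (fun y => - p y) x 0).
  - by rewrite -EFinB opprK add0r.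
  - by move=> y xy; rewrite mulr_ge0 ?ltW ?normal_pdf_gt0 ?divr_gt0//; lra.
  - apply: continuous_subspaceT => y; apply: cvgM; last exact: normal_pdf_continuous.
    by apply: cvgMl; exact: cvg_id.
  - by rewrite -oppr0; apply: cvgN; exact: normal_pdf_cvg0.
  - by move=> y _; apply: derivableN; case: (is_derive_normal_pdf y).
  - apply: cvgN; apply: cvg_at_right_filter; exact: normal_pdf_continuous.
  - move=> y _; have H := is_deriveN (is_derive_normal_pdf y).
    by rewrite derive1E (@derive_val _ _ _ _ _ _ _ H) mulNr opprK.
rewrite -ge0_integralZl//=.
- apply: ge0_le_integral => //=.
  + by move=> y _; rewrite lee_fin mulr_ge0 ?ltW ?normal_pdf_gt0 ?divr_gt0.
  + apply/measurable_EFinP/measurable_funTS; apply: measurable_funM => //.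
    exact: measurable_normal_pdf.
  + apply/measurable_EFinP/measurable_funTS; apply: measurable_funM => //.
      by apply: measurable_funM => //; exact: measurable_cst.
    exact: measurable_normal_pdf.
  + move=> y; rewrite in_itv/= andbT => xy.
    by rewrite lee_fin (ler_pM2r (normal_pdf_gt0 _)) ler_pM2r ?invr_gt0.
- by apply/measurable_EFinP/measurable_funTS; exact: measurable_normal_pdf.
- by move=> y _; rewrite lee_fin ltW ?normal_pdf_gt0.
- by rewrite lee_fin divr_ge0// ltW.
Qed.

Lemma normal_mills_left x : x < 0 ->
  ((- x / v)%:E * \int[mu]_(y in `]-oo, x]) (p y)%:E <= (p x)%:E)%E.
Proof.
move=> x0; have := @normal_mills (- x); rewrite oppr_gt0 => /(_ x0).
rewrite normal_pdf_even; congr (_ * _ <= _)%E.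
rewrite -[x in RHS]opprK ge0_integration_by_substitutionNy.
- by apply: eq_integral => y _; rewrite /= normal_pdf_even.
- by apply: continuous_subspaceT; exact: normal_pdf_continuous.
- by move=> y _; rewrite ltW ?normal_pdf_gt0.
Qed.

End normal.

Section stein.
Context {R : realType}.
Variables (sigma B : R) (h : R -> R).
Hypothesis sigma_gt0 : 0 < sigma.
Hypothesis h_continuous : continuous h.
Hypothesis h_bounded : forall x, `|h x| <= B.
Notation mu := (@lebesgue_measure R).
Let p : R -> R := normal_pdf 0 sigma.
Let v := sigma ^+ 2.
Hypothesis h_centered : \int[mu]_x (h x * p x) = 0.

Let v_gt0 : 0 < v. Proof. by rewrite exprn_gt0. Qed.
Let p_gt0 x : 0 < p x. Proof. exact: normal_pdf_gt0. Qed.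
Let B_ge0 : 0 <= B. Proof. by apply: le_trans (h_bounded 0). Qed.

Let hp_integrable D : measurable D -> mu.-integrable D (EFin \o (fun x => h x * p x)).
Proof.
move=> mD; apply: (integrableS measurableT) => //.
apply: (@le_integrable _ _ _ mu _ measurableT _ (fun x => (B * p x)%:E)) => //.
- apply/measurable_EFinP; apply: measurable_funM.
    exact: continuous_measurable_fun.
  exact: measurable_normal_pdf.
- move=> x _; rewrite /= lee_fin !normrM (ger0_norm B_ge0).
  by rewrite ler_wpM2r.
- rewrite (_ : (fun x => _) = (fun x => B%:E * (p x)%:E)%E); last first.
    by apply/funext => x; rewrite EFinM.
  by apply: integrableZl => //; exact: integrable_normal_pdf.
Qed.

Let primitive (x : R) : R := \int[mu]_(t in `]-oo, x]) (h t * p t).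

Let is_derive_primitive (x : R) : is_derive x (1 : R) primitive (h x * p x).
Proof.
have := @continuous_FTC1 R (fun t => h t * p t) -oo%O x (x + 1).
rewrite ltrDl ltr01 => /(_ isT) /=.
move=> /(_ (hp_integrable (measurable_itv _))) /=.
move=> /(_ (ltNyr x)) dI.
have [] := dI; last by rewrite derive1E => dv <-; exact: DeriveDef.
by apply: cvgM; [exact: h_continuous | exact: normal_pdf_continuous].
Qed.

Let norm_primitive_le D : measurable D ->
  ((`|\int[mu]_(t in D) (h t * p t)|)%:E <= B%:E * \int[mu]_(t in D) (p t)%:E)%E.
Proof.
move=> mD; apply: (@le_trans _ _ (\int[mu]_(t in D) `|(h t * p t)%:E|)%E).
  have hi := hp_integrable mD.
  rewrite /Rintegral -abse_EFin fineK ?integrable_fin_num//.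
  by apply: le_abse_integral => //; exact: measurable_int hi.
rewrite -ge0_integralZl//=; first last.
- by move=> t _; rewrite lee_fin ltW.
- by apply/measurable_EFinP/measurable_funTS; exact: measurable_normal_pdf.
apply: ge0_le_integral => //.
- have /integrableP[mhp _] := hp_integrable mD.
  exact: (measurableT_comp (@abse_measurable R setT) mhp).
- apply/measurable_EFinP/measurable_funTS; apply: measurable_funM => //.
  exact: measurable_normal_pdf.
- by move=> t _; rewrite -EFinM lee_fin normrM (gtr0_norm (p_gt0 t)) ler_pM2r.
Qed.

(** For [x > 0] the primitive is rewritten as minus the integral over the right
    tail, using that [h] is centered; on either side Mills' inequality applies. *)
Let primitive_le (x : R) : `|x * primitive x| <= B * v * p x.
Proof.
have tail D y : measurable D -> 0 < y ->
    ((y / v)%:E * \int[mu]_(t in D) (p t)%:E <= (p x)%:E)%E ->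
    `|y * \int[mu]_(t in D) (h t * p t)| <= B * v * p x.
  move=> mD y0 H.
  have := norm_primitive_le mD; set I := Rintegral _ _ _.
  have Jfin := integrable_fin_num mD (normal_pdf_integrable sigma mD).
  rewrite /= in Jfin; move: H; rewrite -(fineK Jfin) -!EFinM !lee_fin => H1 H2.
  rewrite normrM gtr0_norm//; apply: le_trans (ler_wpM2l (ltW y0) H2) _.
  have -> : y * (B * fine (\int[mu]_(t in D) (p t)%:E)) =
    B * v * (y / v * fine (\int[mu]_(t in D) (p t)%:E)).
    have v0 : v != 0 by rewrite gt_eqF.
    by field.
  by rewrite ler_wpM2l// mulr_ge0// ltW.
have [x0|x0|->] := ltrgtP x 0.
- rewrite -normrN -mulNr; apply: tail => //; first by rewrite oppr_gt0.
  exact: normal_mills_left.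
- have -> : primitive x = - \int[mu]_(t in `]x, +oo[) (h t * p t).
    apply/eqP; rewrite -subr_eq0 opprK -h_centered; apply/eqP.
    have hi := hp_integrable measurableT.
    rewrite -(itv_setU_setT false x) in hi *.
    rewrite Rintegral_setU//=.
    by apply/disj_setPLR => y /=; rewrite !in_itv/= andbT => yx; apply/negP; rewrite -leNgt.
  rewrite mulrN normrN.
  apply: tail => //.
  apply: le_trans (normal_mills sigma_gt0 x0).
  apply: lee_wpmul2l; first by rewrite lee_fin divr_ge0// ltW.
  apply: ge0_subset_integral => //.
  - by apply/measurable_EFinP/measurable_funTS; exact: measurable_normal_pdf.
  - by move=> t _; rewrite lee_fin ltW.
  - by move=> y /=; rewrite !in_itv/= !andbT => /ltW.
- by rewrite mul0r normr0 !mulr_ge0// ltW.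
Qed.

(** The bounded solution is [G = primitive / (v * p)]. Both its boundedness away
    from zero and that of its derivative come from the bound on [x * G x] given by
    [primitive_le]; near zero [G] is bounded by continuity. *)
Lemma stein_equation_centered : exists G G' : R -> R,
  [/\ forall x : R, is_derive x (1 : R) G (G' x), continuous G',
      exists M, forall x, `|G x| <= M, exists M, forall x, `|G' x| <= M &
      forall x, h x = v * G' x - x * G x].
Proof.
pose G x := primitive x / (v * p x).
have vp_neq0 x : v * p x != 0 by rewrite gt_eqF// mulr_gt0.
pose G' x := h x / v + x * G x / v.
have G'E x : is_derive x (1 : R) G (G' x).
  have dp := is_derive_normal_pdf sigma_gt0 x; have dI := is_derive_primitive x.
  have -> : G = (fun y => v^-1 * (primitive y * (p y)^-1)).
    by apply/funext => y; rewrite /G invfM mulrCA.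
  have dV := is_deriveV (lt0r_neq0 (p_gt0 x)) dp.
  apply: is_derive_eq.
  rewrite /G' /G /GRing.scale/= -/p -/v.
  have v0 : v != 0 by rewrite gt_eqF.
  have p0 : p x != 0 by rewrite gt_eqF.
  by field; rewrite p0 v0.
have xG x : `|x * G x| <= B.
  rewrite /G mulrA normf_div (gtr0_norm (mulr_gt0 v_gt0 (p_gt0 x))).
  by rewrite ler_pdivrMr ?mulr_gt0// mulrA primitive_le.
have G'_le x : `|G' x| <= 2 * B / v.
  rewrite /G' -mulrDl normrM (gtr0_norm (_ : 0 < v^-1)) ?invr_gt0//.
  rewrite ler_pM2r ?invr_gt0//; apply: le_trans (ler_normD _ _) _.
  by rewrite mulr_natl mulr2n lerD.
have G_continuous : continuous G.
  move=> x; apply: differentiable_continuous; apply/derivable1_diffP.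
  by have := G'E x; case.
exists G, G'; split => //.
- move=> x; apply: cvgD; first by apply: cvgMl; exact: h_continuous.
  by apply: cvgMl; exact: (cvgM cvg_id (G_continuous x)).
- have [M HM] : exists M, forall x, x \in `[(-1), 1] -> `|G x| <= M.
    have H := @EVT_max R (fun x => `|G x|) (-1) 1.
    have [||c _ Hc] := H; first by lra.
      by apply: continuous_subspaceT => x; apply: cvg_norm; exact: G_continuous.
    by exists `|G c|.
  exists (Num.max M B) => x; have [/HM xM|] := boolP (x \in `[(-1), 1]).
    by rewrite le_max xM.
  rewrite in_itv/= -ler_norml -ltNge => x1.
  rewrite le_max; apply/orP; right; apply: (le_trans _ (xG x)).
  by rewrite [leRHS]normrM; apply: ler_peMl => //; exact: ltW.
- by exists (2 * B / v).
- move=> x; rewrite /G'.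
  have v0 : v != 0 by rewrite gt_eqF.
  by field.
Qed.

End stein.

Section stein_normal.
Context {R : realType}.
Notation mu := (@lebesgue_measure R).

Lemma stein_equation (lambda B : R) (f : R -> R) :
  0 < lambda -> continuous f -> (forall x, `|f x| <= B) ->
  exists (m : R) (G G' : R -> R),
  [/\ (\int[normal_prob 0 (Num.sqrt lambda)]_x (f x)%:E = m%:E)%E,
      forall x : R, is_derive x (1 : R) G (G' x), continuous G',
      (exists M, forall x, `|G x| <= M) /\ (exists M, forall x, `|G' x| <= M) &
      forall x, f x - m = lambda * G' x - x * G x].
Proof.
move=> lambda0 fc fB; set sigma := Num.sqrt lambda.
have sigma0 : 0 < sigma by rewrite sqrtr_gt0.
have bf : @bounded_measurable _ (measurableTypeR R) R f.
  by split; [exact: continuous_measurable_fun|exists B].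
have fi := bounded_measurable_integrable (normal_prob 0 sigma) bf.
pose m := \int[normal_prob 0 sigma]_x f x.
have mE : (\int[normal_prob 0 sigma]_x (f x)%:E = m%:E)%E.
  by rewrite /m /Rintegral fineK//; exact: integrable_fin_num fi.
have hB x : `|f x - m| <= 2 * B.
  apply: le_trans (ler_normB _ _) _; rewrite mulr_natl mulr2n lerD//.
  exact: (expect_norm_le (normal_prob 0 sigma) bf.1 fB).
have hc : continuous (fun x => f x - m).
  by move=> x; apply: cvgB; [exact: fc|exact: cvg_cst].
have h0 : \int[mu]_x ((f x - m) * normal_pdf 0 sigma x) = 0.
  rewrite /Rintegral.
  have -> : (\int[mu]_x ((f x - m) * normal_pdf 0 sigma x)%:E =
      \int[normal_prob 0 sigma]_x (f x - m)%:E)%E.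
    rewrite integral_normal_prob//.
    apply: (@bounded_measurable_integrable _ _ _ (normal_prob 0 sigma) (fun x => f x - m)).
    by split; [exact: continuous_measurable_fun|exists (2 * B)].
  rewrite -/(Rintegral _ _ _) expectB//; last exact: bounded_measurable_cst.
  by rewrite expect_cst subrr.
have [G [G' [dG cG' [M bG] bG' GE]]] := stein_equation_centered sigma0 hc hB h0.
exists m, G, G'; split => //; first by split => //; exists M.
by move=> x; rewrite GE /sigma sqr_sqrtr// ltW.
Qed.

End stein_normal.

(** * Integrals of functions of a Poisson variable *)

Section countable_values.
Context {d} {T : measurableType d} {R : realType} (P : probability T R).
Implicit Types (X Y : T -> nat) (phi psi : nat -> R).

Let measurable_level X k : measurable_fun setT X -> measurable [set w | X w = k].
Proof.
move=> mX; have := mX measurableT [set k] I; rewrite setTI.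
by congr measurable; apply/seteqP; split => w /=.
Qed.

Lemma ge0_integral_levels X (D : set T) (f : T -> \bar R) :
  measurable_fun setT X -> measurable D -> measurable_fun D f ->
  (forall w, 0 <= f w)%E ->
  (\int[P]_(w in D) f w = \sum_(k <oo) \int[P]_(w in D `&` [set w | X w = k]) f w)%E.
Proof.
move=> mX mD mf f0.
have DE : D = \bigcup_k (D `&` [set w | X w = k]).
  by apply/seteqP; split => [w Dw|w [k _ []//]]; exists (X w).
rewrite {1}DE ge0_integral_bigcup//.
- by move=> k; apply: measurableI => //; exact: measurable_level.
- by rewrite -DE.
- by apply/trivIsetP => i j _ _ ij; apply/seteqP; split => // w [[_ /= wi] [_ /= wj]];
    move: ij; rewrite -wi -wj eqxx.
Qed.

Lemma ge0_integral_level X (D : set T) psi : measurable_fun setT X ->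
  measurable D -> (forall k, 0 <= psi k) ->
  (\int[P]_(w in D) (psi (X w))%:E =
   \sum_(k <oo) (psi k)%:E * P (D `&` [set w | X w = k]))%E.
Proof.
move=> mX mD psi0; rewrite (ge0_integral_levels mX mD)//; last first.
- by move=> w; rewrite lee_fin.
- by apply/measurable_EFinP/measurable_funTS; exact: measurable_fun_nat.
apply: eq_eseriesr => k _.
have mk : measurable (D `&` [set w | X w = k]).
  by apply: measurableI => //; exact: measurable_level.
rewrite -integral_cst//; apply: eq_integral => w.
by rewrite inE => -[_ /= ->].
Qed.

(** Independence of two integer variables for unbounded functions, by summing over
    their values. *)
Lemma ge0_integral_mul_of_levels X Y phi psi : measurable_fun setT X ->
  measurable_fun setT Y -> (forall k, 0 <= phi k) -> (forall k, 0 <= psi k) ->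
  (\int[P]_w (psi (Y w))%:E < +oo)%E ->
  (forall k l, P ([set w | X w = k] `&` [set w | Y w = l]) =
    P [set w | X w = k] * P [set w | Y w = l])%E ->
  (\int[P]_w (phi (X w) * psi (Y w))%:E =
   (\int[P]_w (phi (X w))%:E) * (\int[P]_w (psi (Y w))%:E))%E.
Proof.
move=> mX mY phi0 psi0 psi_lty XY.
have mphi := measurable_fun_nat phi mX.
have mpsi := measurable_fun_nat psi mY.
have psi_ge0 : (0 <= \int[P]_w (psi (Y w))%:E)%E.
  by apply: integral_ge0 => w _; rewrite lee_fin.
rewrite (ge0_integral_levels mX measurableT) => [||w]; first last.
- by rewrite lee_fin mulr_ge0.
- by apply/measurable_EFinP; exact: measurable_funM.
rewrite (ge0_integral_level mX measurableT phi0).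
have psi_fin : (\int[P]_w (psi (Y w))%:E)%E \is a fin_num by rewrite ge0_fin_numE.
rewrite [RHS]muleC -(fineK psi_fin) -nneseriesZl; last first.
  by move=> k _; rewrite mule_ge0// lee_fin.
apply: eq_eseriesr => k _; rewrite setTI.
have mk := measurable_level k mX.
transitivity (\int[P]_(w in [set w | X w = k]) ((phi k)%:E * (psi (Y w))%:E))%E.
  by apply: eq_integral => w; rewrite inE /= => ->; rewrite EFinM.
rewrite ge0_integralZl//; last 3 first.
- by apply/measurable_EFinP/measurable_funTS.
- by move=> w _; rewrite lee_fin.
- by rewrite lee_fin.
rewrite fineK// muleCA; congr (_ * _)%E.
have Pfin : P [set w | X w = k] \is a fin_num by exact: fin_num_measure.
rewrite (ge0_integral_level mY mk psi0) (ge0_integral_level mY measurableT psi0).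
rewrite muleC -(fineK Pfin) -nneseriesZl; last by move=> l _; rewrite mule_ge0// lee_fin.
by apply: eq_eseriesr => l _; rewrite fineK// XY setTI muleCA.
Qed.

(** Reindexing the exponential series; this characterises the Poisson law and
    is Stein's identity for it. *)
Lemma ge0_poisson_identity (rate : R) X psi : 0 < rate ->
  measurable_fun setT X -> (forall k, 0 <= psi k) ->
  (forall k, P [set w | X w = k] = (poisson_pmf rate k)%:E) ->
  (\int[P]_w ((X w)%:R * psi (X w))%:E =
   rate%:E * \int[P]_w (psi (X w).+1)%:E)%E.
Proof.
move=> rate0 mX psi0 law.
rewrite (@ge0_integral_level X setT (fun k => k%:R * psi k))//; last first.
  by move=> k; rewrite mulr_ge0.
rewrite (@ge0_integral_level X setT (fun k => psi k.+1))//.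
have pos k : (0 <= (k%:R * psi k)%:E * P (setT `&` [set w | X w = k]))%E.
  by rewrite mule_ge0// lee_fin mulr_ge0.
rewrite nneseries_recl// mul0r mul0e add0e.
rewrite -(nneseries_addn 1) => [|k]; last exact: pos.
rewrite -nneseriesZl; last by move=> k _; rewrite mule_ge0// lee_fin.
apply: eq_eseriesr => k _; rewrite addn1 !setTI !law -!EFinM; congr EFin.
rewrite /poisson_pmf rate0 factS natrM exprS.
have k0 : (k`!%:R : R) != 0 by rewrite pnatr_eq0 -lt0n fact_gt0.
have k1 : (k.+1%:R : R) != 0 by rewrite pnatr_eq0.
by field; rewrite k0 addrC natr1.
Qed.

End countable_values.

(** * The Poisson central limit theorem *)

Section uniform_continuity.
Context {R : realType}.

(** Only [x] is confined to the compact interval, so [y] may leave it. *)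
Lemma uniformly_continuous_itv (g : R -> R) (M e : R) : continuous g -> 0 < e ->
  exists2 r : R, 0 < r & forall x y, `|x| <= M -> `|x - y| < r -> `|g x - g y| < e.
Proof.
move=> cg e0.
have /compact_near_coveringP cK : compact `[- M, M]%classic by exact: segment_compact.
have := cK R (0^'+) (fun r x => forall y, `|x - y| < r -> `|g x - g y| < e) _.
case.
  move=> x _; have /cvgrPdist_lt /(_ (e / 2)) := cg x.
  rewrite divr_gt0// => /(_ isT) /nbhs_ballP[r /= r0 xr].
  exists (ball x (r / 2), [set s | s < r / 2]) => /=.
    split; first by apply: nbhsx_ballx; rewrite divr_gt0.
    by apply: nbhs_right_lt; rewrite divr_gt0.
  move=> [x' s] /= [xx' sr] y x'y.
  have gx z : `|x - z| < r -> `|g x - g z| < e / 2 by exact: xr.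
  have -> : g x' - g y = (g x - g y) - (g x - g x') by lra.
  rewrite (le_lt_trans (ler_normB _ _))// [e]splitr ltrD//; apply: gx; last first.
    by rewrite (lt_trans xx')// ltr_pdivrMr// ltr_pMr// ltr1n.
  have -> : x - y = (x - x') + (x' - y) by lra.
  rewrite (le_lt_trans (ler_normD _ _))// [r]splitr ltrD//.
  exact: lt_trans x'y sr.
move=> r /= r0 H.
exists (r / 2); first by rewrite divr_gt0.
move=> x y xM xy; apply: (H (r / 2)) => //=.
- by rewrite /ball_ /= sub0r normrN gtr0_norm ?divr_gt0// ltr_pdivrMr// ltr_pMr// ltr1n.
- by rewrite divr_gt0.
- by rewrite in_itv/= -ler_norml.
Qed.

End uniform_continuity.

Section poisson_moments.
Context {d} {T : measurableType d} {R : realType} (P : probability T R).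
Variables (rate : R) (X : T -> nat).
Hypothesis rate_gt0 : 0 < rate.
Hypothesis mX : measurable_fun setT X.
Hypothesis law : forall k, P [set w | X w = k] = (poisson_pmf rate k)%:E.

Let identity psi := @ge0_poisson_identity _ _ _ P rate X psi rate_gt0 mX.

Lemma ge0_integrable_expect (f : T -> R) (m : R) : measurable_fun setT f ->
  (forall w, 0 <= f w) -> (\int[P]_w (f w)%:E = m%:E)%E ->
  P.-integrable setT (EFin \o f) /\ \int[P]_w f w = m.
Proof.
move=> mf f0 fm; split; last by rewrite /Rintegral fm.
apply/integrableP; split; first exact/measurable_EFinP.
by under eq_integral do rewrite /= ger0_norm//; rewrite fm ltry.
Qed.

Lemma poisson_mean : P.-integrable setT (EFin \o (fun w => (X w)%:R)) /\
  \int[P]_w (X w)%:R = rate.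
Proof.
apply: ge0_integrable_expect => //; first exact: measurable_fun_nat.
have := identity (fun=> ler01) law; under eq_integral do rewrite mulr1.
by rewrite integral_cst//= probability_setT mule1 mule1.
Qed.

Lemma poisson_factorial_moment :
  P.-integrable setT (EFin \o (fun w => (X w)%:R * (X w).-1%:R)) /\
  \int[P]_w ((X w)%:R * (X w).-1%:R) = rate ^+ 2.
Proof.
apply: ge0_integrable_expect => //.
- by apply: (measurable_fun_nat (fun k => k%:R * k.-1%:R : R)).
- have /= -> := identity (psi := fun k => k.-1%:R) (fun k => ler0n R k.-1) law.
  have [i e] := poisson_mean.
  suff -> : (\int[P]_w (X w)%:R%:E = rate%:E)%E by rewrite expr2 EFinM.
  by rewrite -e /Rintegral fineK//; exact: integrable_fin_num i.
Qed.

Lemma poisson_variance :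
  P.-integrable setT (EFin \o (fun w => ((X w)%:R - rate) ^+ 2)) /\
  \int[P]_w ((X w)%:R - rate) ^+ 2 = rate.
Proof.
have [i1 e1] := poisson_mean; have [i2 e2] := poisson_factorial_moment.
have E w : ((X w)%:R - rate) ^+ 2 =
    (X w)%:R * (X w).-1%:R + ((1 - 2 * rate) * (X w)%:R + rate ^+ 2).
  by case: (X w) => [|k] /=; rewrite ?mulrS; ring.
have -> : (fun w => ((X w)%:R - rate) ^+ 2) = (fun w =>
    (X w)%:R * (X w).-1%:R + ((1 - 2 * rate) * (X w)%:R + rate ^+ 2)).
  exact/funext.
have ic : P.-integrable setT (EFin \o (fun=> rate ^+ 2)).
  by apply: bounded_measurable_integrable; exact: bounded_measurable_cst.
have i3 : P.-integrable setT (EFin \o (fun w => (1 - 2 * rate) * (X w)%:R)).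
  exact: (integrableZl measurableT (1 - 2 * rate) i1).
have i4 : P.-integrable setT (EFin \o (fun w => (1 - 2 * rate) * (X w)%:R + rate ^+ 2)).
  exact: (integrableD measurableT i3 ic).
split; first exact: (integrableD measurableT i2 i4).
rewrite RintegralD// RintegralD// RintegralZl// e1 e2 expect_cst; ring.
Qed.

(** Adding a constant makes [psi] nonnegative. *)
Lemma poisson_identity psi : (exists M, forall k, `|psi k| <= M) ->
  P.-integrable setT (EFin \o (fun w => (X w)%:R * psi (X w))) /\
  \int[P]_w ((X w)%:R * psi (X w)) = rate * \int[P]_w psi (X w).+1.
Proof.
move=> [M psiM]; have [i1 e1] := poisson_mean.
have psi0 k : 0 <= psi k + M.
  by have := psiM k; rewrite ler_norml -lerBlDr sub0r => /andP[].
have bS : bounded_measurable (fun w => psi (X w).+1).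
  by split; [exact: (measurable_fun_nat (fun k => psi k.+1))|exists M].
have bSM : bounded_measurable (fun w => psi (X w).+1 + M).
  by apply: bounded_measurableD => //; exact: bounded_measurable_cst.
have [i2 e2] : P.-integrable setT (EFin \o (fun w => (X w)%:R * (psi (X w) + M))) /\
  \int[P]_w ((X w)%:R * (psi (X w) + M)) = rate * \int[P]_w (psi (X w).+1 + M).
  apply: ge0_integrable_expect.
  - exact: (measurable_fun_nat (fun k => k%:R * (psi k + M))).
  - by move=> w; rewrite mulr_ge0.
  - have /= -> := identity (psi := fun k => psi k + M) psi0 law; rewrite EFinM /Rintegral fineK//.
    exact: (integrable_fin_num measurableT (bounded_measurable_integrable P bSM)).
have i3 : P.-integrable setT (EFin \o (fun w => M * (X w)%:R)).
  exact: (integrableZl measurableT M i1).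
have -> : (fun w => (X w)%:R * psi (X w)) =
    (fun w => (X w)%:R * (psi (X w) + M) - M * (X w)%:R).
  by apply/funext => w; ring.
split; first exact: (integrableB measurableT i2 i3).
rewrite RintegralB// e2 RintegralZl// e1 expectD//; last exact: bounded_measurable_cst.
by rewrite expect_cst; ring.
Qed.

(** [X.-1] differs from [X - 1] by the indicator of [X = 0]. *)
Lemma poisson_excess_mean :
  P.-integrable setT (EFin \o (fun w => (X w).-1%:R)) /\
  \int[P]_w (X w).-1%:R = rate - (1 - expR (- rate)).
Proof.
have [i1 e1] := poisson_mean.
have m0 : measurable [set w | X w = 0%N].
  have := @mX measurableT [set 0%N] I; rewrite setTI.
  by congr measurable; apply/seteqP; split => w.
have b0 : bounded_measurable (fun w => \1_[set w | X w = 0%N] w : R).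
  exact: bounded_measurable_indic.
have E w : (X w).-1%:R = (X w)%:R + (\1_[set w | X w = 0%N] w - 1) :> R.
  rewrite indicE; case: (eqVneq (X w) 0%N) => [w0|w0].
    by rewrite mem_set// w0 subrr addr0.
  rewrite memNset; last by apply/eqP.
  by move: w0; case: (X w) => // k _; rewrite -(natr1 k) /=; ring.
have b1 : bounded_measurable (fun w => \1_[set w | X w = 0%N] w - 1 : R).
  by apply: bounded_measurableB => //; exact: bounded_measurable_cst.
have i2 := bounded_measurable_integrable P b1.
have -> : (fun w => (X w).-1%:R) = (fun w => (X w)%:R + (\1_[set w | X w = 0%N] w - 1) : R).
  exact/funext.
split; first exact: (integrableD measurableT i1 i2).
rewrite RintegralD// e1 expectB//; last exact: bounded_measurable_cst.
rewrite expect_cst expect_indic// law /= /poisson_pmf rate_gt0 expr0 fact0 invr1.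
by ring.
Qed.

Lemma poisson_excess_square :
  P.-integrable setT (EFin \o (fun w => (X w).-1%:R ^+ 2)) /\
  \int[P]_w (X w).-1%:R ^+ 2 <= rate ^+ 2.
Proof.
have [i2 e2] := poisson_factorial_moment.
have le w : (X w).-1%:R ^+ 2 <= (X w)%:R * (X w).-1%:R :> R.
  by rewrite expr2 ler_wpM2r// ler_nat leq_pred.
have i3 : P.-integrable setT (EFin \o (fun w => (X w).-1%:R ^+ 2)).
  apply: (le_integrable measurableT _ _ i2).
    by apply/measurable_EFinP; exact: (measurable_fun_nat (fun k => k.-1%:R ^+ 2 : R)).
  by move=> w _ /=; rewrite lee_fin !ger0_norm ?sqr_ge0 ?mulr_ge0.
by split => //; rewrite -e2; apply: le_Rintegral.
Qed.

End poisson_moments.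

Section poisson_clt.
Context {d} {T : measurableType d} {R : realType} (P : probability T R).
Variable lambda : R.
Hypothesis lambda_gt0 : 0 < lambda.

Definition standardized (t : R) (k : nat) : R := (k%:R - lambda * t) / Num.sqrt t.

Lemma standardized_variance (t : R) (X : T -> nat) : 0 < t ->
  measurable_fun setT X ->
  (forall k, P [set w | X w = k] = (poisson_pmf (lambda * t) k)%:E) ->
  P.-integrable setT (EFin \o (fun w => standardized t (X w) ^+ 2)) /\
  \int[P]_w standardized t (X w) ^+ 2 = lambda.
Proof.
move=> t0 mX law; have mu0 : 0 < lambda * t by rewrite mulr_gt0.
have [i e] := poisson_variance mu0 mX law.
have -> : (fun w => standardized t (X w) ^+ 2) =
    (fun w => t^-1 * ((X w)%:R - lambda * t) ^+ 2).
  by apply/funext => w; rewrite /standardized exprMn exprVn sqr_sqrtr ?ltW// mulrC.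
split; first exact: (integrableZl measurableT t^-1 i).
by rewrite RintegralZl// e; field; rewrite gt_eqF.
Qed.

Section stein_bound.
Variables (f G G' : R -> R) (B K m M e r : R).
Hypothesis f_continuous : continuous f.
Hypothesis f_bounded : forall x, `|f x| <= B.
Hypothesis dG : forall x : R, is_derive x (1 : R) G (G' x).
Hypothesis G'_continuous : continuous G'.
Hypothesis G_bounded : exists C, forall x, `|G x| <= C.
Hypothesis G'_bounded : forall x, `|G' x| <= K.
Hypothesis stein : forall x, f x - m = lambda * G' x - x * G x.
Hypothesis M_gt0 : 0 < M.
Hypothesis e_ge0 : 0 <= e.
Hypothesis modulus : forall x y, `|x| <= M -> `|x - y| < r -> `|G' x - G' y| < e.

Let G_continuous : continuous G.
Proof.
move=> x; apply: differentiable_continuous; apply/derivable1_diffP.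
by case: (dG x).
Qed.

Let K_ge0 : 0 <= K. Proof. by apply: le_trans (G'_bounded 0). Qed.

(** By the mean value theorem the difference quotient of [G] is a value of [G'] at
    distance less than [h] from [x]. For large [x] the trivial bound [2 * K] is enough, because
    the right-hand side then exceeds it. *)
Lemma stein_quotient (x h : R) : 0 < h -> h < r ->
  `|G' x - (G (x + h) - G x) / h| <= e + 2 * K / M ^+ 2 * x ^+ 2.
Proof.
move=> h0 hr; have xh : x < x + h by rewrite ltrDl.
have [|y] := MVT xh (fun z _ => dG z).
  by apply: continuous_subspaceT => z; exact: G_continuous.
rewrite in_itv/= => /andP[xy yxh] ->.
rewrite [x + h - x]addrAC subrr add0r mulfK ?gt_eqF//.
have [xM|xM] := leP `|x| M.
  rewrite -[leLHS]addr0 lerD//; last first.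
    by rewrite mulr_ge0 ?sqr_ge0// divr_ge0 ?sqr_ge0// mulr_ge0.
  apply/ltW/modulus => //; rewrite ltr0_norm ?subr_lt0// opprB.
  by apply: lt_trans hr; lra.
rewrite -[leLHS]add0r lerD//.
apply: (@le_trans _ _ (2 * K)).
  by rewrite mulr_natl mulr2n (le_trans (ler_normB _ _))// lerD.
have x2 : 1 <= M ^- 2 * x ^+ 2.
  rewrite mulrC ler_pdivlMr ?exprn_gt0// mul1r -(real_normK (num_real x)).
  by rewrite ler_pXn2r ?nnegrE ?normr_ge0 ?ltW.
by rewrite -mulrA ler_peMr ?mulr_ge0.
Qed.

(** Inserting the standardized count [W] in Stein's equation for [f] and using the
    Poisson identity, [E (f W) - m] is [lambda] times the mean of the difference of [G'] and
    its difference quotient at [W]. *)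
Lemma stein_bound (t : R) (X : T -> nat) : 0 < t -> (Num.sqrt t)^-1 < r ->
  measurable_fun setT X ->
  (forall k, P [set w | X w = k] = (poisson_pmf (lambda * t) k)%:E) ->
  `|\int[P]_w f (standardized t (X w)) - m| <=
    lambda * (e + 2 * K / M ^+ 2 * lambda).
Proof.
move=> t0 hr mX law; have mu0 : 0 < lambda * t by rewrite mulr_gt0.
have st0 : 0 < Num.sqrt t by rewrite sqrtr_gt0.
set h := (Num.sqrt t)^-1 in hr *.
have h0 : 0 < h by rewrite invr_gt0.
have hn : h != 0 by rewrite gt_eqF.
have h2 : h ^+ 2 * t = 1 by rewrite exprVn sqr_sqrtr ?ltW// mulVf// gt_eqF.
pose x k := standardized t k.
have xS k : x k.+1 = x k + h by rewrite /x /standardized -natr1 /h; ring.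
have [C GC] := G_bounded.
have bm (g : R -> R) c : continuous g -> (forall y, `|g y| <= c) ->
    bounded_measurable (fun w => g (x (X w))).
  by move=> cg gc; split; [exact: (measurable_fun_nat (g \o x))|exists c].
have bf := bm f B f_continuous f_bounded.
have bG := bm G C G_continuous GC.
have bG' := bm G' K G'_continuous G'_bounded.
have bGS : bounded_measurable (fun w => G (x (X w) + h)).
  split; [exact: (measurable_fun_nat (fun k => G (x k + h)))|by exists C].
have [ixG xG] := poisson_identity mu0 mX law (psi := fun k => G (x k))
  (ex_intro _ C (fun k => GC (x k))).
have {xG} xG : \int[P]_w ((X w)%:R * G (x (X w))) =
    lambda * t * \int[P]_w G (x (X w) + h).
  by rewrite xG; congr (_ * _); apply: eq_expect => w; rewrite xS.
have WG : P.-integrable setT (EFin \o (fun w => x (X w) * G (x (X w)))) /\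
    \int[P]_w (x (X w) * G (x (X w))) =
    lambda * \int[P]_w ((G (x (X w) + h) - G (x (X w))) / h).
  have i1 := integrableZl measurableT h ixG.
  have i2 := bounded_measurable_integrable P (bounded_measurableZ (h * (lambda * t)) bG).
  have -> : (fun w => x (X w) * G (x (X w))) = (fun w =>
      h * ((X w)%:R * G (x (X w))) - h * (lambda * t) * G (x (X w))).
    by apply/funext => w; rewrite /x /standardized -/h; ring.
  split; first exact: (integrableB measurableT i1 i2).
  rewrite RintegralB// RintegralZl// xG expectZ//.
  have -> : \int[P]_w ((G (x (X w) + h) - G (x (X w))) / h) =
      h^-1 * (\int[P]_w G (x (X w) + h) - \int[P]_w G (x (X w))).
    rewrite -expectB// -expectZ; last exact: bounded_measurableB.
    by apply: eq_expect => w; rewrite mulrC.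
  have -> : h^-1 = h * t by apply: (mulfI hn); rewrite mulfV// mulrA -expr2.
  by ring.
have bq : bounded_measurable (fun w => (G (x (X w) + h) - G (x (X w))) / h).
  rewrite (_ : (fun w => _) = (fun w => h^-1 * (G (x (X w) + h) - G (x (X w))))).
    by apply: bounded_measurableZ; exact: bounded_measurableB.
  by apply/funext => w; rewrite mulrC.
have -> : \int[P]_w f (x (X w)) - m =
    lambda * \int[P]_w (G' (x (X w)) - (G (x (X w) + h) - G (x (X w))) / h).
  rewrite [in RHS]expectB// mulrBr -WG.2 -expectZ//.
  rewrite -RintegralB//; last 2 first.
  - exact: (bounded_measurable_integrable P (bounded_measurableZ lambda bG')).
  - exact: WG.1.
  rewrite -[X in _ - X = _](expect_cst P m) -expectB//; last exact: bounded_measurable_cst.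
  by apply: eq_expect => w; rewrite stein.
rewrite normrM (gtr0_norm lambda_gt0) ler_pM2l//.
have bd := bounded_measurableB bG' bq.
have [iW eW] := standardized_variance t0 mX law.
have iZ := integrableZl measurableT (2 * K / M ^+ 2) iW.
have ie := bounded_measurable_integrable P (bounded_measurable_cst (T:=T) e).
apply: le_trans (le_normr_Rintegral _ _) _ => //.
  exact: bounded_measurable_integrable.
rewrite -[X in _ + _ * X]eW -RintegralZl// -{1}(expect_cst P e) -RintegralD//.
apply: le_Rintegral => //.
- have := bounded_measurable_integrable P bd; exact: integrable_norm.
- exact: (integrableD measurableT ie iZ).
- by move=> w _; apply: stein_quotient.
Qed.

End stein_bound.

(** In [stein_bound] choose first [M] large, then the mesh [1 / sqrt t] below the
    modulus of continuity of [G'] on [[- M, M]]. *)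
Lemma poisson_central_limit (t : nat -> R) (X : nat -> T -> nat) (f : R -> R) :
  t n @[n --> \oo] --> +oo ->
  (forall n, measurable_fun setT (X n)) ->
  (\forall n \near \oo, forall k,
     P [set w | X n w = k] = (poisson_pmf (lambda * t n) k)%:E) ->
  continuous f -> (exists B, forall x, `|f x| <= B) ->
  exists m : R, (\int[normal_prob 0 (Num.sqrt lambda)]_x (f x)%:E = m%:E)%E /\
    \int[P]_w f (standardized (t n) (X n w)) @[n --> \oo] --> m.
Proof.
move=> ty mX law fc [B fB].
have [m [G [G' [mE dG cG' [bG [K bG']] st]]]] := stein_equation lambda_gt0 fc fB.
exists m; split => //; apply/cvgrPdist_le => e e0.
have K0 : 0 <= K by apply: le_trans (bG' 0).
pose e1 := e / (2 * lambda).
have e1_gt0 : 0 < e1 by rewrite divr_gt0// mulr_gt0.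
have c0 : 0 <= 2 * K * lambda / e1.
  by rewrite divr_ge0 ?(ltW e1_gt0)// mulr_ge0 ?(ltW lambda_gt0)// mulr_ge0.
pose M := Num.sqrt ((2 * K * lambda) / e1 + 1).
have M2 : M ^+ 2 = (2 * K * lambda) / e1 + 1.
  by rewrite sqr_sqrtr// addr_ge0.
have M0 : 0 < M.
  by rewrite sqrtr_gt0 ltr_wpDl.
have [r r0 Hr] := uniformly_continuous_itv M cG' e1_gt0.
near=> n.
rewrite distrC.
have tn : r ^- 2 < t n by near: n; move/cvgryPgt : ty; apply.
have tn0 : 0 < t n by apply: lt_trans tn; rewrite invr_gt0 exprn_gt0.
have hr : (Num.sqrt (t n))^-1 < r.
  rewrite -[ltRHS]invrK ltf_pV2 ?posrE ?sqrtr_gt0 ?invr_gt0//.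
  by rewrite -(ltr_pXn2r (n := 2)) ?nnegrE ?sqrtr_ge0 ?invr_ge0 ?ltW// sqr_sqrtr ?(ltW tn0)// exprVn.
have lawn : forall k, P [set w | X n w = k] = (poisson_pmf (lambda * t n) k)%:E.
  by near: n.
apply: le_trans (@stein_bound f G G' B K m M e1 r fc fB dG cG' bG bG' st M0
  (ltW e1_gt0) Hr (t n) (X n) tn0 hr (mX n) lawn) _.
have -> : e = lambda * (e1 + e1).
  by rewrite /e1; field; rewrite gt_eqF.
rewrite ler_pM2l// lerD2l mulrAC ler_pdivrMr ?exprn_gt0// M2 mulrDr mulr1.
by rewrite [e1 * _]mulrC divfK ?gt_eqF// lerDl ltW.
Unshelve. all: by end_near. Qed.

End poisson_clt.

(** * Sums of uncorrelated variables *)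

Section means.
Context {d} {T : measurableType d} {R : realType} (P : probability T R).
Implicit Types (f g : T -> R) (m : R).

(** Joining integrability and value lets the two be derived together, by the same
    linear combination. *)
Definition has_mean f m := P.-integrable setT (EFin \o f) /\ \int[P]_w f w = m.

Lemma has_mean_eq f g m m' : f =1 g -> m = m' -> has_mean f m -> has_mean g m'.
Proof. by move=> /funext -> ->. Qed.

Lemma has_meanD f g m m' : has_mean f m -> has_mean g m' ->
  has_mean (fun w => f w + g w) (m + m').
Proof.
move=> [fi <-] [gi <-]; split; first exact: (integrableD measurableT fi gi).
by rewrite RintegralD.
Qed.

Lemma has_meanZ c f m : has_mean f m -> has_mean (fun w => c * f w) (c * m).
Proof.
move=> [fi <-]; split; first exact: (integrableZl measurableT c fi).
by rewrite RintegralZl.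
Qed.

Lemma bounded_has_mean f : bounded_measurable f -> has_mean f (\int[P]_w f w).
Proof. by move=> bf; split => //; exact: bounded_measurable_integrable. Qed.

Lemma has_mean_cst c : has_mean (fun=> c) c.
Proof.
rewrite -[X in has_mean _ X](expect_cst P c).
exact: (bounded_has_mean (bounded_measurable_cst c)).
Qed.

Lemma has_mean_le f g m m' : has_mean f m -> has_mean g m' ->
  (forall w, f w <= g w) -> m <= m'.
Proof. by move=> [fi <-] [gi <-] fg; apply: le_Rintegral. Qed.

Section uncorrelated.
Variables (x : nat -> T -> R) (mean v : R).
Hypothesis x_mean : forall i, has_mean (x i) mean.
Hypothesis x_mul : forall i j, i != j ->
  has_mean (fun w => x i w * x j w) (mean ^+ 2).
Hypothesis x_square : forall i,
  exists2 u, has_mean (fun w => x i w * x i w) u & u <= v.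

Let S n w := \sum_(i < n) x i w - n%:R * mean.

Let SS n w : S n.+1 w = S n w + (x n w - mean).
Proof. by rewrite /S big_ord_recr/= -natr1; ring. Qed.

Let S0 w : S 0 w = 0. Proof. by rewrite /S big_ord0 mul0r subr0. Qed.

Let S_mean n : has_mean (S n) 0.
Proof.
elim: n => [|n ih].
  by apply: (has_mean_eq _ erefl (has_mean_cst 0)) => w; rewrite S0.
apply: (has_mean_eq _ _ (has_meanD ih (has_meanD (x_mean n) (has_mean_cst (- mean))))).
  by move=> w; rewrite SS.
by rewrite subrr addr0.
Qed.

Let Sx_mean n j : (n <= j)%N -> has_mean (fun w => S n w * x j w) 0.
Proof.
elim: n => [|n ih] nj.
  by apply: (has_mean_eq _ erefl (has_mean_cst 0)) => w; rewrite S0 mul0r.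
have nj' : n != j by rewrite ltn_eqF.
apply: (has_mean_eq _ _ (has_meanD (ih (ltnW nj))
  (has_meanD (x_mul nj') (has_meanZ (- mean) (x_mean j))))).
  by move=> w; rewrite SS; ring.
by ring.
Qed.

(** The means of the cross products [S n * x n] vanish, so variances add. *)
Lemma uncorrelated_sum_variance n :
  exists2 u, has_mean (fun w => (\sum_(i < n) x i w - n%:R * mean) ^+ 2) u & u <= n%:R * v.
Proof.
elim: n => [|n [u Hu uv]].
  exists 0; last by rewrite mul0r.
  by apply: (has_mean_eq _ erefl (has_mean_cst 0)) => w; rewrite -/(S 0 w) S0 expr0n.
have [u' Hu' u'v] := x_square n.
exists (u + (u' - mean ^+ 2)).
  apply: (has_mean_eq _ _ (has_meanD Hu (has_meanD (has_meanZ 2 (Sx_mean (leqnn n)))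
    (has_meanD (has_meanZ (- (2 * mean)) (S_mean n))
    (has_meanD Hu' (has_meanD (has_meanZ (- (2 * mean)) (x_mean n))
    (has_mean_cst (mean ^+ 2)))))))).
    by move=> w; rewrite -/(S n.+1 w) -/(S n w) SS; ring.
  by ring.
rewrite -natr1 mulrDl mul1r lerD// lerBlDr (le_trans u'v)// lerDl sqr_ge0//.
Qed.

End uncorrelated.
End means.

(** * The error of the estimator *)

Section increment_pairs.
Context {d} {T : measurableType d} {R : realType} (P : probability T R).
Variables (lambda : R) (N : R -> {RV P >-> nat}) (s : nat -> T -> R).
Hypothesis poissonN : poisson_process lambda N s.
Hypothesis lambda_gt0 : 0 < lambda.
Variable h : R.
Hypothesis h_gt0 : 0 < h.

(** Mutual independence of the whole family of increments, restricted to a pair. *)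
Lemma increment_pair i j k l : i != j ->
  (P ([set w | increment N h i w = k] `&` [set w | increment N h j w = l]) =
   P [set w | increment N h i w = k] * P [set w | increment N h j w = l])%E.
Proof.
move=> ij.
have := @independent_increments _ _ _ _ _ _ _ poissonN (fun k => k%:R * h).
move=> /(_ (grid_ge0 h_gt0 0) (fun k => grid_le h_gt0 (leqnSn k))) H.
pose A m := if m == i then [set k] else [set l].
have := H [:: i; j] A.
rewrite /= inE ij => /(_ isT (fun=> I)).
rewrite !big_cons !big_nil setIT mule1 /A eqxx eq_sym (negbTE ij).
exact.
Qed.

Lemma sum_increments n w :
  (\sum_(i < n) increment N h i w)%N = N (n%:R * h) w.
Proof.
elim: n => [|n ih]; first by rewrite big_ord0 mul0r (event_count0 poissonN).
by rewrite big_ord_recr/= ih (increment_addE poissonN).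
Qed.

Let rate_gt0 : 0 < lambda * h. Proof. exact: mulr_gt0. Qed.

Let law i k := increment_prob poissonN h_gt0 i k.

Let mK i := measurable_increment N h i.

(** The number of events beyond the first in an observation interval, events
    that the discrete observation cannot see, has mean square of order h^2, so
    the sum over n intervals has standard deviation of order h * sqrt n. *)
Lemma hidden_events_variance n :
  exists2 u, has_mean P (fun w => (\sum_(i < n) (increment N h i w).-1%:R
      - n%:R * (lambda * h - (1 - expR (- (lambda * h))))) ^+ 2) u &
    u <= n%:R * (lambda * h) ^+ 2.
Proof.
set mean := lambda * h - _.
have Hx i : has_mean P (fun w => (increment N h i w).-1%:R) mean.
  exact: (poisson_excess_mean rate_gt0 (mK i) (law i)).
apply: (@uncorrelated_sum_variance _ _ _ P (fun i w => (increment N h i w).-1%:R)) => // [i j ij|i].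
  have int_x m : (\int[P]_w ((increment N h m w).-1%:R)%:E = mean%:E)%E.
    by have [fi <-] := Hx m; rewrite /Rintegral fineK//; exact: integrable_fin_num fi.
  apply: ge0_integrable_expect => //.
  - by apply: measurable_funM; apply: (measurable_fun_nat (fun k => k.-1%:R : R)).
  - rewrite (@ge0_integral_mul_of_levels _ _ _ P _ _ (fun k => k.-1%:R) (fun k => k.-1%:R))//.
    + by rewrite !int_x expr2 EFinM.
    + by rewrite int_x ltry.
    + by move=> k l; exact: increment_pair.
have [fi le] := poisson_excess_square rate_gt0 (mK i) (law i).
exists (\int[P]_w (increment N h i w).-1%:R ^+ 2) => //.
Qed.

End increment_pairs.

Section observed_steps.
Context {d} {T : measurableType d} {R : realType} (P : probability T R).
Variables (lambda : R) (N : R -> {RV P >-> nat}) (s : nat -> T -> R).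
Variable theta : nat -> {RV P >-> R}.
Hypothesis poissonN : poisson_process lambda N s.
Hypothesis directions : iid_uniform_directions theta.
Hypothesis indep : independent_systems P
  (sigma_generated [set t : R | 0 <= t] (fun t => N t : T -> nat))
  (sigma_generated [set: nat] (fun j => theta j : T -> R)).
Hypothesis lambda_gt0 : 0 < lambda.
Variables (D c : R).
Hypothesis D_gt0 : 0 < D.
Hypothesis c_gt0 : 0 < c.

Notation radius2 := (step_radius2 N s theta D).
Notation C := (step_norm N s theta D).
Notation K := (increment N D).
Let X := flight_x 0 c N s theta.
Let Y := flight_y 0 c N s theta.

Let bC k : bounded_measurable (C k).
Proof. exact: (bounded_step_norm theta poissonN). Qed.

(** This is the mean of [(K - 1)_+] divided by [lambda], see
    [poisson_excess_mean]: the coincidence that makes the estimator asymptotically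
    unbiased at the rate [sqrt T]. *)
Lemma lapse_moment1 : lapse_moment lambda 1 D = (lambda * D - (1 - expR (- (lambda * D)))) / lambda.
Proof.
by rewrite /lapse_moment /=; field; rewrite gt_eqF.
Qed.

Lemma step_norm_variance n :
  exists2 u, has_mean P (fun w => (\sum_(k < n) C k w
      - n%:R * lapse_moment lambda 1 D) ^+ 2) u & u <= n%:R * D ^+ 2.
Proof.
apply: (@uncorrelated_sum_variance _ _ _ P C) => [k|k l kl|k].
- rewrite -(expect_step_norm poissonN directions indep lambda_gt0 D_gt0 k).
  exact: bounded_has_mean.
- rewrite -(expect_step_norm_pair poissonN directions indep lambda_gt0 D_gt0 kl).
  by apply: bounded_has_mean; exact: bounded_measurableM.
- exists (\int[P]_w (C k w * C k w)).
    by apply: bounded_has_mean; exact: bounded_measurableM.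
  apply: (has_mean_le (bounded_has_mean P (bounded_measurableM (bC k) (bC k)))
    (has_mean_cst P (D ^+ 2))) => w.
  have /andP[C0 CD] := step_norm_itv theta poissonN D_gt0 k w.
  by rewrite expr2 ler_pM.
Qed.

Lemma defectE k w : defect c D X Y k.+1 w = c ^+ 2 * (D ^+ 2 - radius2 k w).
Proof.
by rewrite /defect /X /Y !flight_xE !flight_yE /step_radius2 /step_sum /=; ring.
Qed.

Lemma sqrt_defect k w : Num.sqrt (defect c D X Y k.+1 w) = c * C k w.
Proof.
by rewrite defectE sqrtrM ?sqr_ge0// sqrtr_sqr gtr0_norm.
Qed.

Lemma defect_gt0 k w : (0 < defect c D X Y k.+1 w) = (radius2 k w < D ^+ 2).
Proof. by rewrite defectE pmulr_rgt0 ?exprn_gt0// subr_gt0. Qed.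

Lemma n_plusE n w : n_plus c D X Y n w = (\sum_(k < n) (radius2 k w < D ^+ 2)%R)%N.
Proof.
rewrite /n_plus big_add1/= big_mkord big_mkcond/=; apply: eq_bigr => k _.
by rewrite defect_gt0; case: ifP.
Qed.

(** The speed cancels. Dropping the condition in the sum is harmless, as
    the square root of a number that is not positive is zero. *)
Lemma pseudo_mleE n w : pseudo_mle c D X Y n w =
  (n_plus c D X Y n w)%:R / (n%:R * D - \sum_(k < n) C k w).
Proof.
rewrite /pseudo_mle.
have -> : \sum_(1 <= i < n.+1 | 0 < defect c D X Y i w) Num.sqrt (defect c D X Y i w) =
    c * \sum_(k < n) C k w.
  rewrite big_add1/= big_mkord big_mkcond/= mulr_sumr; apply: eq_bigr => k _.
  case: ifPn => [_|]; first exact: sqrt_defect.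
  by rewrite -leNgt -sqrt_defect => /ler0_sqrtr ->.
by rewrite -[c * n%:R * D]mulrA -mulrBr invfM mulrACA mulfV ?gt_eqF// mul1r.
Qed.

Lemma measurable_pseudo_mle n : measurable_fun setT (pseudo_mle c D X Y n).
Proof.
rewrite (funext (pseudo_mleE n)); under eq_fun do rewrite n_plusE.
apply: measurable_funM.
  under eq_fun do rewrite natr_sum.
  apply: measurable_sum => k.
  apply: (@measurableT_comp _ _ _ _ _ _ (fun b : bool => (nat_of_bool b)%:R : R)) => //.
  apply: measurable_fun_ltr => //.
  exact: (bounded_step_radius2 theta poissonN D_gt0 k).1.
have inv w : (n%:R * D - \sum_(k < n) C k w)^-1 =
    (n%:R * D - \sum_(k < n) C k w) `^ (-1).
  rewrite powR_inv1// subr_ge0 mulr_natl -[X in _ *+ X]card_ord -sumr_const.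
  apply: ler_sum => k _.
  by have /andP[] := step_norm_itv theta poissonN D_gt0 k w.
rewrite (funext inv).
apply: (measurableT_comp (measurable_powR _)); apply: measurable_funB => //.
by apply: measurable_sum => k; exact: (bC k).1.
Qed.

(** Some step contains an event and still has the maximal displacement, so that
    its change of direction cannot be seen. On the complement [n_plus] counts the steps
    with events. *)
Definition missed_change : set T :=
  \bigcup_k [set w | radius2 k w = D ^+ 2 /\ K k w <> 0%N].

Let measurable_missed_step k :
  measurable [set w | radius2 k w = D ^+ 2 /\ K k w <> 0%N].
Proof.
apply: measurableI.
  have mr := (bounded_step_radius2 theta poissonN D_gt0 k).1.
  by have := @mr measurableT [set D ^+ 2] (measurable_set1 _); rewrite setTI.
have mK := @measurable_increment _ _ _ P N D k measurableT (~` [set 0%N]) I.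
by rewrite setTI in mK; apply: mK.
Qed.

Lemma measurable_missed_change : measurable missed_change.
Proof. by apply: bigcup_measurable => k _; exact: measurable_missed_step. Qed.

Lemma missed_change_prob0 : P missed_change = 0%E.
Proof.
apply: measure_negligible; first exact: measurable_missed_change.
apply: negligible_bigcup => k; apply/negligibleP; first exact: measurable_missed_step.
exact: (full_step_no_event poissonN directions indep lambda_gt0 D_gt0).
Qed.

Lemma n_plus_seen n w : ~ missed_change w ->
  (n_plus c D X Y n w)%:R = (N (n%:R * D) w)%:R - \sum_(k < n) (K k w).-1%:R :> R.
Proof.
move=> Zw; rewrite n_plusE -(sum_increments poissonN D_gt0) !natr_sum -sumrB.
apply: eq_bigr => k _.
case: (eqVneq (K k w) 0%N) => [K0|K0].
  by rewrite (step_radius2_no_event theta poissonN D_gt0 K0) ltxx K0 subrr.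
have -> : (radius2 k w < D ^+ 2) = true.
  have /andP[_ rD] := step_radius2_itv theta poissonN D_gt0 k w.
  rewrite lt_neqAle rD andbT; apply/eqP => rE; apply: Zw; exists k => //.
  by split => //; apply/eqP.
by move: K0; case: (K k w) => // m _; rewrite -natr1 /=; ring.
Qed.

(** The fraction of the observation time that the estimator subtracts in its
    denominator. *)
Definition lost_time n w : R := (\sum_(k < n) C k w) / (n%:R * D).

Definition noise n w : R := (lambda * (\sum_(k < n) C k w - n%:R * lapse_moment lambda 1 D)
  - (\sum_(k < n) (K k w).-1%:R - n%:R * (lambda * D - (1 - expR (- (lambda * D))))))
  / Num.sqrt (n%:R * D).

(** The two centerings cancel because an interval of length D misses as many
    events on average as lambda times its average lost time. *)
Lemma pseudo_mle_error n w : (0 < n)%N -> ~ missed_change w -> lost_time n w < 1 ->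
  Num.sqrt (n%:R * D) * (pseudo_mle c D X Y n w - lambda) =
  (standardized lambda (n%:R * D) (N (n%:R * D) w) + noise n w) / (1 - lost_time n w).
Proof.
move=> n0 Zw k1; rewrite pseudo_mleE n_plus_seen// /standardized /noise.
have t0 : 0 < n%:R * D by rewrite mulr_gt0// ltr0n.
have tE : n%:R * D = Num.sqrt (n%:R * D) ^+ 2 by rewrite sqr_sqrtr// ltW.
have tA : n%:R * D - \sum_(k < n) C k w != 0.
  move: k1; rewrite /lost_time ltr_pdivrMr// mul1r => k1.
  by rewrite subr_eq0 gt_eqF.
rewrite lapse_moment1 /lost_time; move: tA.
set A := \sum_(k < n) C k w; set B := \sum_(k < n) _.
set q := Num.sqrt _ in tE *; set M := (N _ w)%:R; set E := expR _.
have q0 : q != 0 by rewrite gt_eqF// sqrtr_gt0.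
have l0 : lambda != 0 by rewrite gt_eqF.
have -> : (M - lambda * (n%:R * D)) / q +
    (lambda * (A - n%:R * ((lambda * D - (1 - E)) / lambda)) -
     (B - n%:R * (lambda * D - (1 - E)))) / q =
    (M - B - lambda * (n%:R * D - A)) / q.
  by field; rewrite q0 l0.
rewrite tE => tA.
by field; rewrite q0.
Qed.

Lemma lost_time_ge0 n w : 0 <= lost_time n w.
Proof.
rewrite divr_ge0 ?mulr_ge0 ?(ltW D_gt0)// sumr_ge0// => k _.
by have /andP[] := step_norm_itv theta poissonN D_gt0 k w.
Qed.

Lemma lost_time_mean n : (0 < n)%N ->
  exists2 u, has_mean P (lost_time n) u & u <= lambda * D.
Proof.
move=> n0; have t0 : 0 < n%:R * D by rewrite mulr_gt0// ltr0n.
have bS : bounded_measurable (fun w => \sum_(k < n) C k w).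
  by apply: bounded_measurable_sum => k.
have HS : has_mean P (fun w => \sum_(k < n) C k w) (n%:R * lapse_moment lambda 1 D).
  apply: (has_mean_eq _ _ (bounded_has_mean P bS)) => //.
  rewrite expect_sum// (eq_bigr (fun=> lapse_moment lambda 1 D)) => [|k _].
    by rewrite sumr_const card_ord mulr_natl.
  exact: (expect_step_norm poissonN directions indep).
exists (lapse_moment lambda 1 D / D).
  apply: (has_mean_eq _ _ (has_meanZ (n%:R * D)^-1 HS)).
    by move=> w; rewrite /lost_time mulrC.
  have n0' : n%:R != 0 :> R by rewrite pnatr_eq0 -lt0n.
  by field; rewrite n0' gt_eqF.
rewrite lapse_moment1 !ler_pdivrMr//.
set x := lambda * D; have x0 : 0 <= x by rewrite mulr_ge0// ltW.
have -> : x * D * lambda = x ^+ 2 by rewrite /x; ring.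
by have /andP[_] := expRN_bounds x0; lra.
Qed.

Lemma noise_mean_square n : (0 < n)%N ->
  exists u, exists2 noise2, has_mean P noise2 u &
    u <= 4 * lambda ^+ 2 * D /\ forall w, noise n w ^+ 2 <= noise2 w.
Proof.
move=> n0; have t0 : 0 < n%:R * D by rewrite mulr_gt0// ltr0n.
have [u Hu ule] := step_norm_variance n.
have [v Hv vle] := hidden_events_variance poissonN lambda_gt0 D_gt0 n.
exists (2 / (n%:R * D) * (lambda ^+ 2 * u + v)).
eexists; first exact: (has_meanZ _ (has_meanD (has_meanZ (lambda ^+ 2) Hu) Hv)).
split=> [|w].
  rewrite mulrAC ler_pdivrMr//.
  apply: (@le_trans _ _ (2 * (lambda ^+ 2 * (n%:R * D ^+ 2) + n%:R * (lambda * D) ^+ 2))).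
    by rewrite ler_pM2l// lerD// ler_pM2l// exprn_gt0.
  by rewrite le_eqVlt; apply/orP; left; apply/eqP; ring.
rewrite /noise expr_div_n sqr_sqrtr ?(ltW t0)//.
set A := _ - n%:R * lapse_moment _ _ _; set B := _ - n%:R * (_ - _).
rewrite [leRHS]mulrAC ler_pM2r ?invr_gt0// -subr_ge0.
have -> : 2 * (lambda ^+ 2 * A ^+ 2 + B ^+ 2) - (lambda * A - B) ^+ 2 =
  (lambda * A + B) ^+ 2 by ring.
exact: sqr_ge0.
Qed.

End observed_steps.

(** * Convergence of the estimator *)

Lemma measurable_norm_gt {d} {T : measurableType d} {R : realType} (delta : R)
    (V : T -> R) : measurable_fun setT V -> measurable [set w | delta < `|V w|].
Proof.
move=> mV; have mN : measurable_fun setT (fun w => `|V w|) by exact: measurableT_comp.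
have := measurable_fun_ltr (measurable_cst delta) mN measurableT (Y := [set true]) I.
by rewrite setTI.
Qed.

Section perturbation.
Context {d} {T : measurableType d} {R : realType} (P : probability T R).
Variables (U W kappa e e2 : T -> R) (Z : set T) (a b c : R).
Hypothesis mU : measurable_fun setT U.
Hypothesis mW : measurable_fun setT W.
Hypothesis mZ : measurable Z.
Hypothesis Z0 : P Z = 0%E.
Hypothesis kappa_ge0 : forall w, 0 <= kappa w.
Hypothesis e_le : forall w, e w ^+ 2 <= e2 w.
Hypothesis UE : forall w, ~ Z w -> kappa w < 1 ->
  U w = (W w + e w) / (1 - kappa w).
Hypothesis kappa_mean : has_mean P kappa a.
Hypothesis W_mean : has_mean P (fun w => W w ^+ 2) b.
Hypothesis e2_mean : has_mean P e2 c.

Let Z_mean : has_mean P (\1_Z : T -> R) 0.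
Proof.
have := bounded_has_mean P (bounded_measurable_indic mZ : bounded_measurable (\1_Z : T -> R)).
by rewrite expect_indic// Z0.
Qed.

Let e2_ge0 w : 0 <= e2 w. Proof. by apply: le_trans (e_le w); exact: sqr_ge0. Qed.

Let mul_inv_ge1 (x y : R) : 0 < y -> y <= x -> 1 <= y^-1 * x.
Proof. by move=> y0 yx; rewrite -ler_pdivrMl ?invr_gt0// invrK mulr1. Qed.

(** Outside [Z] and an event on which [W], [kappa] or [e] is large, [U] is within [r] of
    [W]. The probability of that event is bounded by Chebyshev's and Markov's
    inequalities, here applied under the integral sign. *)
Lemma perturbation_expect (f : R -> R) (B M r eps eta : R) :
  continuous f -> (forall x, `|f x| <= B) ->
  0 < M -> 0 <= eps -> (forall x y, `|x| <= M -> `|x - y| < r -> `|f x - f y| < eps) ->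
  0 < eta -> eta <= 1 / 2 -> 2 * eta * (1 + M) < r ->
  `|\int[P]_w f (U w) - \int[P]_w f (W w)| <=
    eps + 2 * B * ((M ^+ 2)^-1 * b + (eta^-1 * a + (eta ^+ 2)^-1 * c)).
Proof.
move=> fc fB M0 eps0 modulus eta0 eta2 etar.
have B0 : 0 <= B by apply: le_trans (fB 0).
have M2 : 0 < M ^+ 2 by rewrite exprn_gt0.
have eta_2 : 0 < eta ^+ 2 by rewrite exprn_gt0.
have bf (V : T -> R) : measurable_fun setT V -> bounded_measurable (fun w => f (V w)).
  move=> mV; split; last by exists B.
  by apply: (measurableT_comp _ mV); exact: continuous_measurable_fun.
have bd := bounded_measurableB (bf _ mU) (bf _ mW).
rewrite -expectB; [|exact: bf|exact: bf].
apply: le_trans (le_normr_Rintegral _ _) _ => //.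
  exact: bounded_measurable_integrable.
have H1 : has_mean P (fun w => `|f (U w) - f (W w)|) (\int[P]_w `|f (U w) - f (W w)|).
  by split => //; have := bounded_measurable_integrable P bd; exact: integrable_norm.
have H2 := has_meanD (has_mean_cst P eps) (has_meanZ (2 * B)
  (has_meanD (has_meanD (has_meanZ (M ^+ 2)^-1 W_mean) (has_meanD (has_meanZ eta^-1 kappa_mean)
    (has_meanZ (eta ^+ 2)^-1 e2_mean))) Z_mean)).
rewrite addr0 in H2.
apply: (has_mean_le H1 H2) => w.
have i1 : 0 <= (M ^+ 2)^-1 * W w ^+ 2 by rewrite mulr_ge0 ?sqr_ge0// invr_ge0 ltW.
have i2 : 0 <= eta^-1 * kappa w by rewrite mulr_ge0// invr_ge0 ltW.
have i3 : 0 <= (eta ^+ 2)^-1 * e2 w by rewrite mulr_ge0// invr_ge0 ltW.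
have i4 : 0 <= \1_Z w :> R by rewrite indicE ler0n.
set bad := _ + _ + \1_Z w.
have bad0 : 0 <= bad by rewrite /bad !addr_ge0.
have large : 1 <= bad -> `|f (U w) - f (W w)| <= eps + 2 * B * bad.
  move=> bad1; rewrite -[leLHS]add0r lerD//.
  apply: (@le_trans _ _ (2 * B)); last by rewrite ler_peMr// mulr_ge0.
  by rewrite mulr_natl mulr2n (le_trans (ler_normB _ _))// lerD.
have [WM|WM] := leP M `|W w|.
  apply: large; rewrite /bad; have : 1 <= (M ^+ 2)^-1 * W w ^+ 2; last by lra.
  apply: mul_inv_ge1 => //; rewrite -[leRHS]real_normK ?num_real//.
  by rewrite ler_pXn2r ?nnegrE ?normr_ge0 ?(ltW M0).
have [km|km] := leP eta (kappa w).
  by apply: large; rewrite /bad; have := mul_inv_ge1 eta0 km; lra.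
have [em|em] := leP eta `|e w|.
  apply: large; rewrite /bad; have : 1 <= (eta ^+ 2)^-1 * e2 w; last by lra.
  apply: mul_inv_ge1 => //; apply: le_trans (e_le w).
  by rewrite -[leRHS]real_normK ?num_real// ler_pXn2r ?nnegrE ?normr_ge0 ?(ltW eta0).
have [Zw|Zw] := pselect (Z w).
  by apply: large; rewrite /bad [\1_Z w]indicE mem_set//=; lra.
rewrite -[leLHS]addr0 lerD// ?mulr_ge0//.
rewrite distrC; apply/ltW/modulus; first exact: ltW.
have k0 := kappa_ge0 w.
have k1 : 0 < 1 - kappa w by lra.
rewrite UE//; last by lra.
have -> : W w - (W w + e w) / (1 - kappa w) = - ((W w * kappa w + e w) / (1 - kappa w)).
  by field; rewrite gt_eqF.
rewrite normrN normrM normfV (gtr0_norm k1) ltr_pdivrMr//.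
apply: le_lt_trans (ler_normD _ _) _; rewrite normrM (ger0_norm k0).
have h1 : `|W w| * kappa w <= M * eta by rewrite ler_pM// ltW.
have h2 : eta * (1 + M) <= r * (1 - kappa w).
  apply: (@le_trans _ _ (2 * eta * (1 + M) * (1 - kappa w))).
    rewrite -subr_ge0.
    have -> : 2 * eta * (1 + M) * (1 - kappa w) - eta * (1 + M) =
      eta * (1 + M) * (1 - 2 * kappa w) by ring.
    by rewrite !mulr_ge0 ?(ltW eta0)//; lra.
  by rewrite ler_pM2r// ltW.
by lra.
Qed.

(** When [kappa < 1 / 2], a large [U] forces [W] or [e] to be large. *)
Lemma perturbation_tail (delta : R) : 0 < delta ->
  (P [set w | (delta < `|U w|)%R] <= (2 * a + 8 / delta ^+ 2 * (b + c))%:E)%E.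
Proof.
move=> d0; have d2 : 0 < delta ^+ 2 by rewrite exprn_gt0.
have mA := measurable_norm_gt delta mU.
rewrite -(fineK (fin_num_measure P _ mA)) lee_fin -expect_indic//.
have H1 : has_mean P (\1_[set w | delta < `|U w|] : T -> R) (\int[P]_w \1_[set w | delta < `|U w|] w).
  exact/bounded_has_mean/bounded_measurable_indic.
have H2 := has_meanD (has_meanD (has_meanZ 2 kappa_mean)
  (has_meanZ (8 / delta ^+ 2) (has_meanD W_mean e2_mean))) Z_mean.
rewrite addr0 in H2; apply: (has_mean_le H1 H2) => w.
have k0 := kappa_ge0 w.
have i2 : 0 <= 8 / delta ^+ 2 * (W w ^+ 2 + e2 w).
  by rewrite mulr_ge0 ?addr_ge0 ?sqr_ge0// divr_ge0// ltW.
have i4 : 0 <= \1_Z w :> R by rewrite indicE ler0n.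
rewrite [leLHS]indicE; have [|_] := boolP (_ \in _); last by rewrite /=; lra.
rewrite inE /= => Ud.
have [k1|k1] := leP (1 / 2) (kappa w); first by lra.
have [Zw|Zw] := pselect (Z w).
  by rewrite [\1_Z w]indicE mem_set//=; lra.
have : 1 <= 8 / delta ^+ 2 * (W w ^+ 2 + e2 w); last by lra.
have k2 : 0 < 1 - kappa w by lra.
move: Ud; rewrite UE//; last by lra.
rewrite normrM normfV (gtr0_norm k2) ltr_pdivlMr// => Ud.
have H : delta / 2 < `|W w + e w|.
  apply: le_lt_trans Ud; rewrite ler_pM2l//; lra.
have H3 : (delta / 2) ^+ 2 < (W w + e w) ^+ 2.
  rewrite -[ltRHS]real_normK ?num_real// ltr_pXn2r ?nnegrE//.
  by rewrite divr_ge0// ltW.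
have H4 : (W w + e w) ^+ 2 <= 2 * (W w ^+ 2 + e w ^+ 2).
  rewrite -subr_ge0.
  have -> : 2 * (W w ^+ 2 + e w ^+ 2) - (W w + e w) ^+ 2 = (W w - e w) ^+ 2 by ring.
  exact: sqr_ge0.
have H5 := e_le w.
rewrite mulrAC ler_pdivlMr// mul1r.
move: H3; rewrite expr_div_n; set q := delta ^+ 2; lra.
Qed.

End perturbation.

Section asymptotics.
Context {d} {T : measurableType d} {R : realType} (P : probability T R).
Variables (lambda c : R) (N : R -> {RV P >-> nat}) (s : nat -> T -> R).
Variables (theta : nat -> {RV P >-> R}) (Delta : nat -> R).
Hypothesis lambda_gt0 : 0 < lambda.
Hypothesis c_gt0 : 0 < c.
Hypothesis poissonN : poisson_process lambda N s.
Hypothesis directions : iid_uniform_directions theta.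
Hypothesis indep : independent_systems P
  (sigma_generated [set t : R | 0 <= t] (fun t => N t : T -> nat))
  (sigma_generated [set: nat] (fun j => theta j : T -> R)).
Hypothesis Delta_gt0 : forall n, (0 < n)%N -> 0 < Delta n.
Hypothesis Delta_cvg0 : Delta n @[n --> \oo] --> 0.
Hypothesis horizon_cvgy : n%:R * Delta n @[n --> \oo] --> +oo.
Let X := flight_x 0 c N s theta.
Let Y := flight_y 0 c N s theta.
Let horizon n := n%:R * Delta n.
Let lambda_hat n := pseudo_mle c (Delta n) X Y n.
Let W n w := standardized lambda (horizon n) (N (horizon n) w).
Let U n w := normalized_error lambda horizon lambda_hat n w.

Let mN t : measurable_fun setT (N t). Proof. exact: measurable_funP. Qed.

Let horizon_gt0 n : (0 < n)%N -> 0 < horizon n.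
Proof. by move=> n0; rewrite mulr_gt0 ?ltr0n ?Delta_gt0. Qed.

Let count_law n k : (0 < n)%N ->
  P [set w | N (horizon n) w = k] = (poisson_pmf (lambda * horizon n) k)%:E.
Proof.
move=> n0; have := poisson_increments poissonN k (lexx 0) (horizon_gt0 n0).
rewrite subr0 => <-; congr (P _); apply/seteqP.
by split => w /=; rewrite (event_count0 poissonN) subn0.
Qed.

(** For [n = 0] both sides are zero by the conventions on division. *)
Lemma count_error n w : normalized_error lambda horizon
  (fun n w => (N (horizon n) w)%:R / horizon n) n w = W n w.
Proof.
rewrite /normalized_error /W /standardized.
have h0 : horizon 0 = 0 by rewrite /horizon mulr0n mul0r.
case: n => [|n]; first by rewrite h0 sqrtr0 mul0r invr0 mulr0.
have t0 := horizon_gt0 (ltn0Sn n).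
set t := horizon _ in t0 *; have q0 : Num.sqrt t != 0 by rewrite gt_eqF ?sqrtr_gt0.
have tE : t = Num.sqrt t ^+ 2 by rewrite sqr_sqrtr// ltW.
move: q0 tE; set q := Num.sqrt t; set M := (N t w)%:R => q0 ->.
by field.
Qed.

Let measurable_W n : measurable_fun setT (W n).
Proof. exact: (measurable_fun_nat (standardized lambda (horizon n))). Qed.

Lemma measurable_estimator n : measurable_fun setT (lambda_hat n).
Proof.
case: n => [|n]; last first.
  exact: (@measurable_pseudo_mle _ _ _ P lambda N s theta poissonN (Delta n.+1) c
  (Delta_gt0 (ltn0Sn n)) c_gt0 n.+1).
rewrite (_ : lambda_hat 0 = cst 0)//; apply/funext => w.
by rewrite /lambda_hat /pseudo_mle /n_plus big_geq// mulr0 mul0r.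
Qed.

Let measurable_U n : measurable_fun setT (U n).
Proof.
apply: measurable_funM => //; apply: measurable_funB => //.
exact: measurable_estimator.
Qed.

Let W_mean n : (0 < n)%N -> has_mean P (fun w => W n w ^+ 2) lambda.
Proof.
move=> n0; apply: standardized_variance => //; first exact: horizon_gt0.
by move=> k; exact: count_law.
Qed.

(** Everything known about the difference of [U] and [W]: the null set where it is not
    controlled, the lost time, and the noise with a bound of its square. *)
Let error_terms n : (0 < n)%N -> exists (Z : set T) (kappa e e2 : T -> R) (a b : R),
  [/\ measurable Z /\ P Z = 0%E, forall w, 0 <= kappa w, forall w, e w ^+ 2 <= e2 w,
    (forall w, ~ Z w -> kappa w < 1 -> U n w = (W n w + e w) / (1 - kappa w)) &
    [/\ has_mean P kappa a, has_mean P e2 b, a <= lambda * Delta n &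
      b <= 4 * lambda ^+ 2 * Delta n]].
Proof.
move=> n0; have D0 := Delta_gt0 n0.
have [a Ha ale] := lost_time_mean poissonN directions indep lambda_gt0 D0 n0.
have [b [e2 He2 [ble e2le]]] := noise_mean_square poissonN directions indep lambda_gt0 D0 n0.
exists (missed_change N s theta (Delta n)), (lost_time N s theta (Delta n) n).
exists (noise lambda N s theta (Delta n) n), e2, a, b; split => //.
- split; first exact: (measurable_missed_change theta poissonN).
  exact: (missed_change_prob0 poissonN directions indep lambda_gt0).
- by move=> w; exact: (lost_time_ge0 theta poissonN).
- by move=> w Zw kw; exact: (pseudo_mle_error poissonN lambda_gt0 D0 c_gt0 n0 Zw kw).
Qed.

Let near_gt0 : \forall n \near \oo, (0 < n)%N.
Proof. by exists 1%N. Qed.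

Let near_Delta x : 0 < x -> \forall n \near \oo, Delta n < x.
Proof.
move=> x0; have /cvgrPdist_lt/(_ x x0) := Delta_cvg0; apply: filterS => n.
by rewrite sub0r normrN => /(le_lt_trans (ler_norm _)).
Qed.

(** The constants are chosen in the order [M], modulus of continuity, [eta]; then
    [Delta n] small makes the two remaining terms small. *)
Lemma expect_U_W (f : R -> R) (B eps : R) : continuous f ->
  (forall x, `|f x| <= B) -> 0 < eps ->
  \forall n \near \oo, `|\int[P]_w f (U n w) - \int[P]_w f (W n w)| <= eps.
Proof.
move=> fc fB eps0; have B0 : 0 <= B by apply: le_trans (fB 0).
have e3 : 0 < eps / 3 by rewrite divr_gt0.
pose M2 := 1 + 2 * B * lambda / (eps / 3); pose M := Num.sqrt M2.
have M2_gt0 : 0 < M2.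
  rewrite ltr_pwDl// divr_ge0 ?(ltW e3)// mulr_ge0 ?(ltW lambda_gt0)// mulr_ge0//.
have ME : M ^+ 2 = M2 by rewrite sqr_sqrtr// ltW.
have M0 : 0 < M by rewrite sqrtr_gt0.
have [r r0 modulus] := uniformly_continuous_itv M fc e3.
pose eta := Num.min (1 / 2) (r / (4 * (1 + M))).
have M1 : 0 < 1 + M by rewrite addr_gt0.
have eta0 : 0 < eta by rewrite lt_min !divr_gt0// mulr_gt0.
have eta2 : eta <= 1 / 2 by rewrite ge_min lexx.
have etar : 2 * eta * (1 + M) < r.
  have : eta <= r / (4 * (1 + M)) by rewrite ge_min lexx orbT.
  rewrite ler_pdivlMr ?mulr_gt0// => h.
  by move: h; lra.
(* [L * Delta n] bounds the terms with the means of [kappa] and [e2] in [perturbation_expect] *)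
pose L := 2 * B * (eta^-1 * lambda + (eta ^+ 2)^-1 * (4 * lambda ^+ 2)).
have L0 : 0 <= L.
  apply: mulr_ge0; first exact: mulr_ge0.
  by apply: addr_ge0; apply: mulr_ge0; rewrite ?invr_ge0 ?mulr_ge0 ?sqr_ge0 ?(ltW eta0) ?(ltW lambda_gt0).
near=> n.
have n0 : (0 < n)%N by near: n.
have Dn : Delta n < eps / 3 / (1 + L).
  by near: n; apply: near_Delta; rewrite divr_gt0// ltr_pwDl.
have [Z [kappa [e [e2 [a [b [[mZ Z0] k0 ee UE [Ha Hb ale ble]]]]]]]] := error_terms n0.
apply: le_trans (@perturbation_expect _ _ _ P (U n) (W n) kappa e e2 Z a lambda b
  (measurable_U n) (measurable_W n) mZ Z0 k0 ee UE Ha (W_mean n0) Hb f B M r (eps / 3) eta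
  fc fB M0 (ltW e3) modulus eta0 eta2 etar) _.
have D0 := Delta_gt0 n0.
have i1 : 2 * B * ((M ^+ 2)^-1 * lambda) <= eps / 3.
  rewrite ME mulrCA mulrC ler_pdivrMr// /M2 mulrDr mulr1 [eps / 3 * (_ / _)]mulrC.
  by rewrite divfK ?gt_eqF// lerDr ltW.
have i2 : 2 * B * (eta^-1 * a + (eta ^+ 2)^-1 * b) <= eps / 3.
  apply: (@le_trans _ _ (L * Delta n)).
    rewrite /L -[leRHS]mulrA; apply: ler_wpM2l; first exact: mulr_ge0.
    rewrite [leRHS]mulrDl -(mulrA eta^-1) -(mulrA (eta ^+ 2)^-1) lerD//.
      by rewrite ler_pM2l ?invr_gt0.
    by rewrite ler_pM2l ?invr_gt0 ?exprn_gt0.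
  move: Dn; rewrite ltr_pdivlMr; last by rewrite ltr_pwDl.
  by rewrite mulrDr mulr1 [L * _]mulrC; lra.
rewrite mulrDr; lra.
Unshelve. all: by end_near. Qed.

Lemma count_asymptotically_normal :
  cvg_in_distribution P W (normal_prob 0 (Num.sqrt lambda)).
Proof.
split=> [|f fc [B fB]]; first exact: measurable_W.
have law : \forall n \near \oo, forall k,
    P [set w | N (horizon n) w = k] = (poisson_pmf (lambda * horizon n) k)%:E.
  by apply: filterS near_gt0 => n n0 k; exact: count_law.
have [m [-> lim]] := poisson_central_limit (P := P) lambda_gt0 horizon_cvgy
  (fun n => mN (horizon n)) law fc (ex_intro _ B fB).
have bf n : bounded_measurable (fun w => f (W n w)).
  split; last by exists B.
  by apply: (measurableT_comp _ (measurable_W n)); exact: continuous_measurable_fun.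
rewrite (_ : (fun n => _) = (fun n => (\int[P]_w f (W n w))%:E)); last first.
  apply/funext => n; rewrite /Rintegral fineK//.
  exact: (integrable_fin_num measurableT (bounded_measurable_integrable P (bf n))).
by apply: cvg_EFin => //; apply: nearW.
Qed.

Lemma estimator_asymptotically_normal :
  cvg_in_distribution P (normalized_error lambda horizon lambda_hat)
    (normal_prob 0 (Num.sqrt lambda)).
Proof.
split=> [|f fc fB]; first exact: measurable_U.
have [_ /(_ f fc fB)] := count_asymptotically_normal.
have [B fB'] := fB.
have bf n V : measurable_fun setT V -> (\int[P]_w (f (V w))%:E = (\int[P]_w f (V w))%:E)%E.
  move=> mV; have b : bounded_measurable (fun w => f (V w)).
    split; last by exists B.
    by apply: (measurableT_comp _ mV); exact: continuous_measurable_fun.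
  rewrite /Rintegral fineK//.
  exact: (integrable_fin_num measurableT (bounded_measurable_integrable P b)).
have [m [-> _]] := poisson_central_limit (P := P) lambda_gt0 horizon_cvgy
  (fun n => mN (horizon n)) (filterS (fun n n0 k => count_law k n0) near_gt0) fc fB.
rewrite (_ : (fun n => _) = (fun n => (\int[P]_w f (W n w))%:E)); last first.
  by apply/funext => n; exact: bf.
move/fine_cvgP => [_ limW].
rewrite (_ : (fun n => _) = (fun n => (\int[P]_w f (U n w))%:E)); last first.
  by apply/funext => n; exact: bf.
apply: cvg_EFin; first exact: nearW.
apply/cvgrPdist_le => eps eps0; have e2 : 0 < eps / 2 by rewrite divr_gt0.
near=> n.
have h1 : `|\int[P]_w f (U n w) - \int[P]_w f (W n w)| <= eps / 2.
  by near: n; exact: (expect_U_W fc fB' e2).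
have h2 : `|m - \int[P]_w f (W n w)| <= eps / 2.
  by near: n; move/cvgrPdist_le : limW; apply.
have -> : m - \int[P]_w f (U n w) =
  (m - \int[P]_w f (W n w)) - (\int[P]_w f (U n w) - \int[P]_w f (W n w)) by ring.
by rewrite [eps]splitr (le_trans (ler_normB _ _))// lerD.
Unshelve. all: by end_near. Qed.

(** Divide by the normalization: [perturbation_tail] at the level
    [eps * sqrt (horizon n)]. *)
Lemma estimator_consistent : consistent P lambda lambda_hat.
Proof.
split=> [|eps eps0]; first exact: measurable_estimator.
have near_horizon x : \forall n \near \oo, x < horizon n.
  by move/cvgryPgt : horizon_cvgy; apply.
have mA n : measurable [set w | eps < `|lambda_hat n w - lambda|].
  by apply: measurable_norm_gt; apply: measurable_funB => //; exact: measurable_estimator.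
rewrite (_ : (fun n => _) = (fun n =>
    (fine (P [set w | eps < `|lambda_hat n w - lambda|]))%:E)); last first.
  by apply/funext => n; rewrite fineK//; exact: (fin_num_measure P _ (mA n)).
apply: cvg_EFin; first exact: nearW.
apply/cvgrPdist_le => e e0.
have eps2 : 0 < eps ^+ 2 by rewrite exprn_gt0.
pose L := 2 * lambda + 32 * lambda ^+ 2 / eps ^+ 2.
have L0 : 0 < L.
  by rewrite /L addr_gt0 ?mulr_gt0 ?invr_gt0 ?exprn_gt0.
near=> n.
have n0 : (0 < n)%N by near: n.
have D0 := Delta_gt0 n0; have t0 := horizon_gt0 n0.
have t1 : 1 < horizon n by near: n; exact: near_horizon.
have te : 8 * lambda / eps ^+ 2 / (e / 2) < horizon n by near: n; exact: near_horizon.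
have De : Delta n < e / 2 / L by near: n; apply: near_Delta; rewrite !divr_gt0.
rewrite /= sub0r normrN ger0_norm ?fine_ge0// -lee_fin fineK; last first.
  exact: (fin_num_measure P _ (mA n)).
have [Z [kappa [er [e2 [a [b [[mZ Z0] k0 ee UE [Ha Hb ale ble]]]]]]]] := error_terms n0.
have q0 : 0 < Num.sqrt (horizon n) by rewrite sqrtr_gt0.
have := @perturbation_tail _ _ _ P (U n) (W n) kappa er e2 Z a lambda b
  (measurable_U n) mZ Z0 k0 ee UE Ha (W_mean n0) Hb (eps * Num.sqrt (horizon n)).
rewrite mulr_gt0// => /(_ isT).
have -> : [set w | eps * Num.sqrt (horizon n) < `|U n w|] =
    [set w | eps < `|lambda_hat n w - lambda|].
  apply/seteqP; split => w /=;
    by rewrite /U /normalized_error normrM (gtr0_norm q0) [eps * _]mulrC ltr_pM2l.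
move=> /le_trans; apply; rewrite lee_fin exprMn sqr_sqrtr ?(ltW t0)//.
have i1 : 8 / (eps ^+ 2 * horizon n) * lambda <= e / 2.
  move: te; rewrite ltr_pdivrMr ?divr_gt0// => /ltW te.
  have -> : 8 / (eps ^+ 2 * horizon n) * lambda = 8 * lambda / eps ^+ 2 / horizon n.
    by field; rewrite !gt_eqF.
  by rewrite ler_pdivrMr// [e / 2 * _]mulrC.
have i2 : 8 / (eps ^+ 2 * horizon n) * b <= 32 * lambda ^+ 2 / eps ^+ 2 * Delta n.
  apply: (@le_trans _ _ (8 / (eps ^+ 2 * horizon n) * (4 * lambda ^+ 2 * Delta n))).
    by rewrite ler_pM2l// divr_gt0// mulr_gt0.
  have -> : 32 * lambda ^+ 2 / eps ^+ 2 * Delta n =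
    8 / eps ^+ 2 * (4 * lambda ^+ 2 * Delta n) by field; rewrite gt_eqF.
  rewrite ler_pM2r ?mulr_gt0 ?exprn_gt0// ler_pM2l// lef_pV2 ?posrE ?(mulr_gt0 eps2 t0)//.
  by rewrite ler_peMr ?ltW.
have i3 : 2 * lambda * Delta n + 32 * lambda ^+ 2 / eps ^+ 2 * Delta n <= e / 2.
  by move: De; rewrite ltr_pdivlMr// /L mulrC mulrDl => /ltW.
by rewrite mulrDr; move: i1 i2 i3 ale; lra.
Unshelve. all: by end_near. Qed.

End asymptotics.

Theorem theorem3p1 (d : measure_display) (T : measurableType d) (R : realType)
    (P : probability T R) (lambda c : R)
    (N : R -> {RV P >-> nat}) (s : nat -> T -> R)
    (theta : nat -> {RV P >-> R}) (Delta : nat -> R)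
    (lambda_gt0 : 0 < lambda) (c_gt0 : 0 < c)
    (poissonN : poisson_process lambda N s)
    (directions : iid_uniform_directions theta)
    (indep : independent_systems P
       (sigma_generated [set t : R | 0 <= t] (fun t => N t : T -> nat))
       (sigma_generated [set: nat] (fun j => theta j : T -> R)))
    (Delta_gt0 : forall n, (0 < n)%N -> 0 < Delta n)
    (Delta_cvg0 : Delta n @[n --> \oo] --> 0)
    (horizon_cvgy : n%:R * Delta n @[n --> \oo] --> +oo) :
  let X := flight_x 0 c N s theta in
  let Y := flight_y 0 c N s theta in
  let horizon n := n%:R * Delta n in
  let lambda_hat n := pseudo_mle c (Delta n) X Y n in
  [/\ consistent P lambda lambda_hat,
      asymptotically_normal P lambda horizon lambda_hat lambda &
      asymptotically_efficient P lambda N horizon lambda_hat].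
Proof.
have clt := count_asymptotically_normal lambda_gt0 poissonN Delta_gt0 horizon_cvgy.
have normal := estimator_asymptotically_normal lambda_gt0 c_gt0 poissonN directions
  indep Delta_gt0 Delta_cvg0 horizon_cvgy.
split.
- exact: (estimator_consistent lambda_gt0 c_gt0 poissonN directions indep Delta_gt0
    Delta_cvg0 horizon_cvgy).
- exact: normal.
- exists (normal_prob 0 (Num.sqrt lambda)); split; first exact: normal.
  move: clt; congr (cvg_in_distribution P _ _).
  by apply/funext => n; apply/funext => w; rewrite -count_error.
Qed.
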